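(* For each $n \in \{8, 9, 12, 13, 14, 15, 19, 20, 26\}$ there exist real numbers $\beta, a, b, c$ with $0<\beta<1$ such that the polynomial $$P(z)=\int_\beta^z (w-a)^{n-3}(w^2+bw+c)\,dw$$ belongs to $S(n)$ and is locally extremal.
   Context: For an integer $n\ge 2$, $S(n)$ denotes the set of all complex polynomials of degree $n$ all of whose roots lie in the closed unit disk $\{z\in\mathbb{C}: |z|\le 1\}$. For a polynomial $P$ of degree $n$ with roots $z_1,\dots,z_n$ and critical points (roots of $P'$) $\zeta_1,\dots,\zeta_{n-1}$, both listed with multiplicity, define $$d(P)=\max_{1\le i\le n}\left\{\min_{1\le j\le n-1}|z_i-\zeta_j|\right\}.$$ For $\epsilon>0$, the $\epsilon$-neighborhood of $P\in S(n)$ is the set of all $Q\in S(n)$ whose roots are within $\epsilon$ of the roots of $P$, in the sense that the roots of $Q$ can be paired with the roots of $P$ (with multiplicity, bijectively) so that in each pair the difference of the roots has modulus less than $\epsilon$. A polynomial $P\in S(n)$ is locally extremal if there is some $\epsilon>0$ such that $d(P)\ge d(Q)$ for all $Q$ in the $\epsilon$-neighborhood of $P$. *)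

(* Defs.v *)
From HB Require Import structures.
From mathcomp Require Import all_boot all_order all_algebra.
From mathcomp Require Import all_classical all_reals all_analysis.
From mathcomp.real_closed Require Import complex.

Set Implicit Arguments.
Unset Strict Implicit.
Unset Printing Implicit Defensive.

Import Order.TTheory GRing.Theory Num.Theory.
Import numFieldNormedType.Exports.

Local Open Scope ring_scope.
Local Open Scope complex_scope.

Section Sendov.
Variable R : realType.
Implicit Types (P Q : {poly R[i]}) (z w : R[i]) (s : seq R).

(* The [R]-valued modulus; the norm [`|z|] of [R[i]] takes values in [R[i]]
   and equals [(cmod z)%:C]. *)
Definition cmod z : R := ComplexField.Normc.normc z.

(* The roots with multiplicity, in an unspecified order; the property
   P = lead_coef P *: \prod_(z <- proots P) ('X - z%:P)
   determines the list up to permutation when P != 0. *)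
Definition proots P : seq R[i] := sval (closed_field_poly_normal P).

(* [seq_min s] is the least element of a nonempty [s], and [seq_max s] the
   greatest element of a nonempty [s]; both are 0 on [::]. *)
Definition seq_min s : R := \big[Num.min/head 0 s]_(x <- s) x.
Definition seq_max s : R := \big[Num.max/head 0 s]_(x <- s) x.

Definition sendov_d P : R :=
  seq_max [seq seq_min [seq cmod (z - w) | w <- proots P^`()]
          | z <- proots P].

Definition disk_poly (n : nat) P : Prop :=
  size P = n.+1 /\ forall z, root P z -> cmod z <= 1.

(* [all2] also forces both lists to have the same length. *)
Definition roots_within (eps : R) P Q : Prop :=
  exists2 t : seq R[i], perm_eq t (proots Q) &
    all2 (fun z w => cmod (w - z) < eps) (proots P) t.

Definition locally_extremal (n : nat) P : Prop :=
  exists2 eps : R, 0 < eps &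
    forall Q, disk_poly n Q -> roots_within eps P Q ->
      sendov_d Q <= sendov_d P.

(* Integral of a complex-valued function of a real variable over [0, 1]. *)
Definition integral01 (g : R -> R[i]) : R[i] :=
  (\int[lebesgue_measure]_(t in `[0%R, 1%R]) complex.Re (g t)) +i*
  (\int[lebesgue_measure]_(t in `[0%R, 1%R]) complex.Im (g t)).

(* Line integral of [f] along the segment [t |-> z0 + t (z1 - z0)]; for a
   polynomial integrand it does not depend on the path from [z0] to [z1]. *)
Definition line_integral (f : R[i] -> R[i]) (z0 z1 : R[i]) : R[i] :=
  integral01 (fun t => f (z0 + t%:C * (z1 - z0)) * (z1 - z0)).

End Sendov.

(* Main.v *)
From Stdlib Require Import ZArith.
Require Import Defs.
From mathcomp Require Import all_boot all_order all_algebra.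
From mathcomp Require Import all_classical all_reals all_analysis.
From mathcomp.real_closed Require Import complex.
From mathcomp Require Import ring lra zify ssrZ.

Set Implicit Arguments.
Unset Strict Implicit.
Unset Printing Implicit Defensive.

Import Order.TTheory GRing.Theory Num.Theory.
Import numFieldNormedType.Exports.
Local Open Scope ring_scope.
Local Open Scope complex_scope.

(* Write [P] in the coordinate [t = (beta - z) / s]: the zero [beta] is at [t = 0], and the critical
   points are chosen to be [1] (with multiplicity [n - 3]) and two conjugate points [w], [w^*] of
   modulus [1], so that [beta] is at distance exactly [s] from all of them. The only parameter is
   [g = 2 Re w - 2]. The unit disk becomes the disk of center [M] and radius [1 / s], and we ask
   that three zeros [t_0, t_1, t_2] of [P] (and their conjugates) lie on its boundary. Such a circle,
   centered on the real axis, exists when a determinant in [g] vanishes; this happens by the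
   intermediate value theorem.

   A nearby [Q] can be rotated so that its zero near [beta] is positive. If [d(Q) > d(P) = s], the
   reciprocals of the critical points of [Q], seen from that zero, are [omega (1 + delta)] with
   [omega] in [{1, w, w^*}] and [|1 + delta| < 1], hence [|delta|^2 <= - 2 Re delta]: second order
   terms in [delta] are of the same order as the first order terms [Re delta]. Expanding
   the condition that the zeros near the [t_i] and their conjugates stay in the disk gives six
   linear inequalities up to higher order. For suitable [g], a positive combination of them bounds all
   the [Re delta], the second order terms included, and then the whole perturbation, by something of
   higher order, so that the perturbation vanishes, a contradiction.

   For each degree the finitely many strict inequalities required are checked by ball arithmetic,
   from enclosures of the zeros that hold for all [g] in a small interval. *)

(** The constraint [|delta|^2 <= - 2 Re delta] allows each of the [m] merged critical points to move
    by the square root of the first order size [N]. Only the sum of these [delta] and the sum of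
    their squares enter at order [N], so these two sums are the variables of the linear problem, the
    squares being close to [- (Im delta)^2]. Conjugation symmetry writes the two inequalities at
    [t_i] and its conjugate as [F_i + G_i <= T] and [F_i - G_i <= T], with [F] even and [G] odd. In
    the even part two variables have no sign: the displacement of the center and the difference of
    the imaginary parts attached to [w] and its conjugate. Three rows are the least number that
    leaves a combination free of both; all other even variables have a sign, which is why positive
    weights and positive combined coefficients suffice. This is the reason for three contact points,
    and a circle centered on the real axis through three points costs one equation, matching the one
    parameter [g]. The odd part only needs an invertible 2 by 2 system, taken from the first two
    contact points because the third may be real. *)

#[local] Arguments cmod : simpl never.

(** * The modulus and a weighted coefficient norm on polynomials *)

Section Cmod.
Variable R : realType.
Implicit Types (x y z : R[i]) (p q : {poly R[i]}).

Lemma cmod_sqr z : cmod z ^+ 2 = complex.Re z ^+ 2 + complex.Im z ^+ 2.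
Proof. by case: z => a b; rewrite /cmod /= sqr_sqrtr // addr_ge0 ?sqr_ge0. Qed.

Lemma cmod_ge0 z : 0 <= cmod z.
Proof. by case: z => a b; rewrite /cmod /= sqrtr_ge0. Qed.
Hint Resolve cmod_ge0 : core.

Lemma cmod0 : cmod (0 : R[i]) = 0.
Proof. exact: ComplexField.Normc.normc0. Qed.

Lemma cmod1 : cmod (1 : R[i]) = 1.
Proof. exact: ComplexField.Normc.normc1. Qed.

Lemma cmodM x y : cmod (x * y) = cmod x * cmod y.
Proof. exact: ComplexField.Normc.normcM. Qed.

Lemma cmodV x : cmod x^-1 = (cmod x)^-1.
Proof. exact: ComplexField.Normc.normcV. Qed.

Lemma cmodX x k : cmod (x ^+ k) = cmod x ^+ k.
Proof. by elim: k => [|k IH]; rewrite ?expr0 ?cmod1 // !exprS cmodM IH. Qed.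

Lemma cmodD x y : cmod (x + y) <= cmod x + cmod y.
Proof. exact: le_normcD. Qed.

Lemma cmodN x : cmod (- x) = cmod x.
Proof. exact: normcN. Qed.

Lemma cmodB x y : cmod (x - y) <= cmod x + cmod y.
Proof. by rewrite -(cmodN y) cmodD. Qed.

Lemma cmod_distC x y : cmod (x - y) = cmod (y - x).
Proof. by rewrite -cmodN opprB. Qed.

Lemma cmod_triB x y : cmod x - cmod y <= cmod (x - y).
Proof. by rewrite lerBlDr (le_trans _ (cmodD _ _)) // subrK. Qed.

Lemma cmod_dist3 x y z : cmod (x - z) <= cmod (x - y) + cmod (y - z).
Proof. by rewrite (le_trans _ (cmodD _ _)) // addrA subrK. Qed.

Lemma cmod_eq0 x : (cmod x == 0) = (x == 0).
Proof.
apply/eqP/eqP => [|->]; last exact: cmod0.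
exact: ComplexField.Normc.eq0_normc.
Qed.

Lemma cmod_gt0 x : (0 < cmod x) = (x != 0).
Proof. by rewrite lt_neqAle cmod_ge0 andbT eq_sym cmod_eq0. Qed.

Lemma cmodJ z : cmod z^* = cmod z.
Proof. by case: z => a b; rewrite /cmod /= sqrrN. Qed.

Lemma cmodR (r : R) : cmod r%:C = `|r|.
Proof. by rewrite /cmod /= expr0n /= addr0 sqrtr_sqr. Qed.

Lemma cmod_nat k : cmod (k%:R : R[i]) = k%:R.
Proof.
rewrite (_ : k%:R = (k%:R : R)%:C); last by rewrite rmorph_nat.
by rewrite cmodR ger0_norm.
Qed.

Lemma Re_le_cmod z : `|complex.Re z| <= cmod z.
Proof. by case: z => a b; rewrite -sqrtr_sqr /cmod /= ler_wsqrtr // lerDl sqr_ge0. Qed.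

Lemma Im_le_cmod z : `|complex.Im z| <= cmod z.
Proof. by case: z => a b; rewrite -sqrtr_sqr /cmod /= ler_wsqrtr // lerDr sqr_ge0. Qed.

Lemma cmod_le_ReIm z : cmod z <= `|complex.Re z| + `|complex.Im z|.
Proof.
rewrite -(ler_pXn2r (n := 2)) ?nnegrE ?addr_ge0 // cmod_sqr sqrrD.
by rewrite !real_normK ?num_real // lerD2r lerDl mulrn_wge0 // mulr_ge0.
Qed.

Lemma cmod_lt_sqr z (r : R) : 0 <= r ->
  (cmod z < r) = (complex.Re z ^+ 2 + complex.Im z ^+ 2 < r ^+ 2).
Proof. by move=> r0; rewrite -cmod_sqr ltr_pXn2r ?nnegrE. Qed.

Lemma cmod_sum (I : Type) (s : seq I) (P : pred I) (F : I -> R[i]) :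
  cmod (\sum_(i <- s | P i) F i) <= \sum_(i <- s | P i) cmod (F i).
Proof.
apply: (big_ind2 (fun a b => cmod a <= b)) => //; first by rewrite cmod0.
by move=> a b c d ha hb; apply: le_trans (cmodD _ _) _; apply: lerD.
Qed.

Lemma cmod_prod (I : Type) (s : seq I) (F : I -> R[i]) :
  cmod (\prod_(i <- s) F i) = \prod_(i <- s) cmod (F i).
Proof. by apply: (big_morph _ cmodM cmod1). Qed.

(** A norm on coefficients rather than a supremum over the disk: it is submultiplicative and
    dominates the values on [cmod x <= r], so that perturbation estimates become algebra in the
    polynomial ring. *)
Definition pnorm (r : R) p : R := \sum_(k < size p) cmod p`_k * r ^+ k.

Variable r : R.
Hypothesis r1 : 1 <= r.
Let r0 : 0 <= r. Proof. exact: le_trans r1. Qed.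
Hint Resolve r0 : core.

Lemma pnormE k p : (size p <= k)%N -> pnorm r p = \sum_(i < k) cmod p`_i * r ^+ i.
Proof.
move=> sk; rewrite /pnorm (big_ord_widen _ (fun i => cmod p`_i * r ^+ i) sk).
rewrite big_mkcond /=; apply: eq_bigr => i _.
by case: ltnP => // ?; rewrite nth_default // cmod0 mul0r.
Qed.

Lemma pnorm_ge0 p : 0 <= pnorm r p.
Proof. by apply: sumr_ge0 => i _; rewrite mulr_ge0 ?exprn_ge0. Qed.
Hint Resolve pnorm_ge0 : core.

Lemma pnormD p q : pnorm r (p + q) <= pnorm r p + pnorm r q.
Proof.
set k := maxn (size p) (size q).
rewrite (@pnormE k (p + q)) ?size_polyD // (@pnormE k p) ?leq_maxl //.
rewrite (@pnormE k q) ?leq_maxr // -big_split /=; apply: ler_sum => i _.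
by rewrite coefD -mulrDl ler_wpM2r ?exprn_ge0 ?cmodD.
Qed.

Lemma pnormN p : pnorm r (- p) = pnorm r p.
Proof. by rewrite /pnorm size_polyN; apply: eq_bigr => i _; rewrite coefN cmodN. Qed.

Lemma pnormZ a p : pnorm r (a *: p) = cmod a * pnorm r p.
Proof.
rewrite (@pnormE (size p)) ?size_scale_leq // /pnorm mulr_sumr.
by apply: eq_bigr => i _; rewrite coefZ cmodM mulrA.
Qed.

Lemma pnormC a : pnorm r a%:P = cmod a.
Proof. by rewrite (@pnormE 1) ?size_polyC_leq1 // big_ord1 expr0 mulr1 coefC. Qed.

Lemma pnorm0 : pnorm r 0 = 0.
Proof. by rewrite /pnorm size_poly0 big_ord0. Qed.

Lemma pnormMX p : pnorm r (p * 'X) = r * pnorm r p.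
Proof.
rewrite (@pnormE (size p).+1); last first.
  by rewrite (leq_trans (size_polyMleq _ _)) // size_polyX addn2.
rewrite big_ord_recl coefMX /= cmod0 mul0r add0r /pnorm mulr_sumr.
by apply: eq_bigr => i _; rewrite coefMX /= exprS mulrCA.
Qed.

Lemma pnormX : pnorm r 'X = r.
Proof. by rewrite -[X in pnorm r X]mul1r pnormMX pnormC cmod1 mulr1. Qed.

Lemma pnormM p q : pnorm r (p * q) <= pnorm r p * pnorm r q.
Proof.
elim/poly_ind: p => [|p c IH]; first by rewrite mul0r pnorm0 mul0r.
have E : pnorm r (p * 'X + c%:P) = r * pnorm r p + cmod c.
  rewrite (@pnormE (size p).+1); last first.
    rewrite (leq_trans (size_polyD _ _)) // geq_max.
    rewrite (leq_trans (size_polyMleq _ _)) ?size_polyX ?addn2 //.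
    by rewrite (leq_trans (size_polyC_leq1 _)).
  rewrite big_ord_recl coefD coefMX coefC /= add0r expr0 mulr1 addrC.
  congr (_ + _); rewrite /pnorm mulr_sumr.
  by apply: eq_bigr => i _; rewrite coefD coefMX coefC /= addr0 exprS mulrCA.
rewrite E mulrDl (mulrDl _ (cmod c)) (le_trans (pnormD _ _)) // mul_polyC pnormZ.
by rewrite lerD2r mulrAC pnormMX -mulrA ler_wpM2l.
Qed.

Lemma pnorm_exp p k : pnorm r (p ^+ k) <= pnorm r p ^+ k.
Proof.
elim: k => [|k IH]; first by rewrite !expr0 pnormC cmod1.
by rewrite !exprS (le_trans (pnormM _ _)) // ler_wpM2l.
Qed.

Lemma cmod_horner p x : cmod x <= r -> cmod p.[x] <= pnorm r p.
Proof.
move=> xr; rewrite horner_coef (le_trans (cmod_sum _ _ _)) //.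
apply: ler_sum => i _; rewrite cmodM cmodX ler_wpM2l // lerXn2r ?nnegrE //.
Qed.

Lemma cmod_expB x y k : cmod x <= r -> cmod y <= r ->
  cmod (x ^+ k.+1 - y ^+ k.+1) <= cmod (x - y) * (k.+1%:R * r ^+ k).
Proof.
move=> xr yr; rewrite subrXX cmodM ler_wpM2l // (le_trans (cmod_sum _ _ _)) //.
rewrite mulr_natl -[X in _ <= _ *+ X]card_ord -sumr_const; apply: ler_sum => i _.
rewrite cmodM !cmodX -[X in _ <= r ^+ X](@subnK i k) -1?ltnS // exprD.
by apply: ler_pM; rewrite ?exprn_ge0 // lerXn2r ?nnegrE.
Qed.

(** Stands in for integrating the derivative along a segment: [x ^+ k.+1 - y ^+ k.+1] is [x - y]
    times [k.+1] terms of modulus at most [r ^+ k]. Bounds on derivatives thus pass to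
    primitives. *)
Lemma horner_lipschitz p x y : cmod x <= r -> cmod y <= r ->
  cmod (p.[x] - p.[y]) <= cmod (x - y) * pnorm r p^`().
Proof.
move=> xr yr; rewrite !horner_coef -sumrB.
case: (posnP (size p)) => [->|sp].
  by rewrite big_ord0 cmod0 mulr_ge0.
rewrite (@pnormE (size p).-1); last first.
  by rewrite -ltnS prednK // lt_size_deriv // -size_poly_gt0.
case: (size p) sp => [//|k] _ /=; rewrite big_ord_recl !expr0 subrr add0r.
rewrite (le_trans (cmod_sum _ _ _)) // mulr_sumr; apply: ler_sum => i _.
rewrite -mulrBr cmodM coef_deriv lift0 -[_ *+ _]mulr_natr cmodM cmod_nat.
rewrite (le_trans (ler_wpM2l (cmod_ge0 _) (cmod_expB _ xr yr))) //.
by rewrite mulrCA !mulrA.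
Qed.

End Cmod.

#[local] Hint Extern 0 (is_true (0 <= cmod _)) => exact: cmod_ge0 : core.

(** * Second order expansion of a product of perturbed factors *)

Section Expansion.
Variables (R : realType) (r : R).
Hypothesis r1 : 1 <= r.
Implicit Types (d x y z : R[i]) (p q u v : {poly R[i]}) (s : seq R[i]).

Lemma pnormD_le p q a b : pnorm r p <= a -> pnorm r q <= b -> pnorm r (p + q) <= a + b.
Proof. by move=> ha hb; apply: le_trans (pnormD r1 _ _) _; apply: lerD. Qed.

Lemma pnormM_le p q a b : pnorm r p <= a -> pnorm r q <= b -> pnorm r (p * q) <= a * b.
Proof.
by move=> ha hb; apply: le_trans (pnormM r1 _ _) _; apply: ler_pM; rewrite ?pnorm_ge0 //.
Qed.

Lemma pnormZ_le x p a b : cmod x <= a -> pnorm r p <= b -> pnorm r (x *: p) <= a * b.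
Proof. by move=> ha hb; rewrite pnormZ; apply: ler_pM; rewrite ?cmod_ge0 ?pnorm_ge0. Qed.

(** The second elementary symmetric polynomial of the entries. *)
Fixpoint esym2 s : R[i] := if s is d :: s' then esym2 s' + d * \sum_(y <- s') y else 0.

Lemma esym2E s : 2 * esym2 s = (\sum_(y <- s) y) ^+ 2 - \sum_(y <- s) y ^+ 2.
Proof.
elim: s => [|d s IH] /=; first by rewrite !big_nil expr0n /= subr0 mulr0.
by rewrite !big_cons mulrDr IH; ring.
Qed.

Lemma esym2_le s : cmod (esym2 s) <= (\sum_(y <- s) cmod y) ^+ 2.
Proof.
elim: s => [|d s IH] /=; first by rewrite cmod0 sqr_ge0.
have S0 : 0 <= \sum_(y <- s) cmod y by apply: sumr_ge0.
have D0 := cmod_ge0 d.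
rewrite big_cons (le_trans (cmodD _ _)) // cmodM.
have := ler_wpM2l D0 (cmod_sum s xpredT id).
by nra.
Qed.

(** Cauchy-Schwarz against the constant sequence. *)
Lemma sqr_sum_cmod s :
  (\sum_(y <- s) cmod y) ^+ 2 <= (size s)%:R * \sum_(y <- s) cmod y ^+ 2.
Proof.
have E (t : seq R[i]) a :
    2 * a * (\sum_(y <- t) cmod y) <= (size t)%:R * a ^+ 2 + \sum_(y <- t) cmod y ^+ 2.
  elim: t => [|d t IH]; first by rewrite !big_nil mulr0 mul0r addr0.
  by rewrite !big_cons /= -natr1; have := sqr_ge0 (a - cmod d); nra.
elim: s => [|d s IH]; first by rewrite !big_nil mul0r expr0n.
by rewrite !big_cons /= -natr1; have := E s (cmod d); nra.
Qed.

(** Adjoining a factor [u - d *: v] multiplies the old remainder by it and creates one new term,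
    [d * esym2 s] times [v ^+ 3 * u ^+ k.-2]; both are cubic, whence the factor [eps] before the
    squared sum. The truncated exponents [k.-1] and [k.-2] are harmless: the symmetric functions in
    front of them vanish when [k] is too small. *)
Lemma prod_expansion u v nu k : 1 <= nu -> pnorm r u <= nu -> pnorm r v <= nu ->
  exists2 C : R, 0 <= C & forall eps s, size s = k -> eps <= 1 ->
    (forall y, y \in s -> cmod y <= eps) ->
    pnorm r (\prod_(y <- s) (u - y *: v)
             - (u ^+ k - (\sum_(y <- s) y) *: (v * u ^+ k.-1)
                + esym2 s *: (v ^+ 2 * u ^+ k.-2)))
      <= C * eps * (\sum_(y <- s) cmod y) ^+ 2.
Proof.
move=> nu1 hu hv; have nu0 : 0 <= nu by apply: le_trans nu1.
elim: k => [|k [C C0 IH]].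
  exists 0 => // eps s /size0nil-> _ _; rewrite !big_nil /= !scale0r !mul0r.
  by rewrite subr0 addr0 subrr pnorm0.
exists (C * (nu + nu) + nu ^+ 3 * nu ^+ k.-2) => [|eps [//|d s] /= [sk] eps1 H].
  by rewrite addr_ge0 ?mulr_ge0 ?exprn_ge0 ?addr_ge0.
have Hs y : y \in s -> cmod y <= eps by move=> ys; apply: H; rewrite inE ys orbT.
have Hd : cmod d <= eps by apply: H; rewrite inE eqxx.
have eps0 : 0 <= eps by apply: le_trans Hd.
move: (IH eps s sk eps1 Hs).
set rem := \prod_(y <- s) _ - _ => Hrem.
have HP : \prod_(y <- s) (u - y *: v) = (u ^+ k - (\sum_(y <- s) y) *: (v * u ^+ k.-1)
                + esym2 s *: (v ^+ 2 * u ^+ k.-2)) + rem by rewrite /rem addrC subrK.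
have E1 : (\sum_(y <- s) y) *: (v * u ^+ k) = (\sum_(y <- s) y) *: (v * (u * u ^+ k.-1)).
  by case: (k) sk => [/size0nil->|k' _]; rewrite ?big_nil ?scale0r -?exprS.
have E2 : esym2 s *: (v ^+ 2 * u ^+ k.-1) = esym2 s *: (v ^+ 2 * (u * u ^+ k.-2)).
  case: (k) sk => [/size0nil->|[|k'] sk]; rewrite ?scale0r -?exprS //=.
  by case: (s) sk => [//|x [|//]] _; rewrite /= big_nil mulr0 addr0 !scale0r.
rewrite !big_cons HP.
have -> : (u - d *: v) * (u ^+ k - (\sum_(y <- s) y) *: (v * u ^+ k.-1)
                + esym2 s *: (v ^+ 2 * u ^+ k.-2) + rem) -
   (u ^+ k.+1 - (d + \sum_(y <- s) y) *: (v * u ^+ k)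
     + (esym2 s + d * (\sum_(y <- s) y)) *: (v ^+ 2 * u ^+ k.-1))
   = (u - d *: v) * rem - (d * esym2 s) *: (v ^+ 3 * u ^+ k.-2).
  rewrite !scalerDl E1 E2 -!scalerA (exprS u k) -!mul_polyC; ring.
have S0 : 0 <= \sum_(y <- s) cmod y by apply: sumr_ge0.
have B1 : pnorm r (u - d *: v) <= nu + nu.
  apply: pnormD_le => //; rewrite pnormN -[nu]mul1r; apply: pnormZ_le => //.
  exact: le_trans eps1.
have B2 := pnormM_le B1 Hrem.
have B3 : pnorm r (- ((d * esym2 s) *: (v ^+ 3 * u ^+ k.-2)))
           <= eps * (\sum_(y <- s) cmod y) ^+ 2 * (nu ^+ 3 * nu ^+ k.-2).
  rewrite pnormN; apply: pnormZ_le; first by rewrite cmodM ler_pM ?esym2_le.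
  by apply: pnormM_le; apply: le_trans (pnorm_exp r1 _ _) _; rewrite lerXn2r ?nnegrE ?pnorm_ge0.
apply: le_trans (pnormD_le B2 B3) _.
have -> : (nu + nu) * (C * eps * (\sum_(y <- s) cmod y) ^+ 2) +
  eps * (\sum_(y <- s) cmod y) ^+ 2 * (nu ^+ 3 * nu ^+ k.-2) =
  (C * (nu + nu) + nu ^+ 3 * nu ^+ k.-2) * eps * (\sum_(y <- s) cmod y) ^+ 2 by ring.
apply: ler_wpM2l.
  by rewrite mulr_ge0 // addr_ge0 ?mulr_ge0 ?exprn_ge0 ?addr_ge0.
by rewrite lerXn2r ?nnegrE ?addr_ge0 // lerDr.
Qed.

End Expansion.

(** * Expansion of the derivative in the displacements of the critical points *)

Section Integrand.
Variables (R : realType) (m : nat) (wp wm : R[i]).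
Implicit Types (s : seq R[i]) (dp dm : R[i]).

(* [k_crit] is the derivative, up to a constant, of a polynomial whose critical points have the
   reciprocals [1 + y] for [y \in s], [wp * (1 + dp)] and [wm * (1 + dm)]; [k_base + k_lin] is its
   expansion to the order of [\sum_(y <- s) y], [dp], [dm] and [\sum_(y <- s) y ^+ 2]. *)
Definition q_of (w : R[i]) : {poly R[i]} := 1 - w *: 'X.
Definition k_crit s dp dm : {poly R[i]} :=
  \prod_(y <- s) q_of (1 + y) * q_of (wp * (1 + dp)) * q_of (wm * (1 + dm)).
Definition k_base : {poly R[i]} := (1 - 'X) ^+ m * q_of wp * q_of wm.
Definition k_a : {poly R[i]} := 'X * (1 - 'X) ^+ m.-1 * q_of wp * q_of wm.
Definition k_e : {poly R[i]} := 'X ^+ 2 * (1 - 'X) ^+ m.-2 * q_of wp * q_of wm.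
Definition k_side (w w' : R[i]) : {poly R[i]} := w *: ('X * (1 - 'X) ^+ m * q_of w').
Definition k_lin s dp dm : {poly R[i]} :=
  - ((\sum_(y <- s) y) *: k_a + ((\sum_(y <- s) y ^+ 2) / 2) *: k_e
     + dp *: k_side wp wm + dm *: k_side wm wp).

Hypotheses (hwp : cmod wp = 1) (hwm : cmod wm = 1).
Variable r : R.
Hypothesis r1 : 1 <= r.

(** [N] controls sums only: a single [y] may have the size of the square root of [N]. By [esym2E]
    the quadratic term is half the square of the sum, which is [O(eps * N)], minus half the sum of
    squares, which is of order [N] and is therefore kept in [k_lin]. Every other neglected term has
    one factor of order [N] and another of order [eps]. *)
Lemma k_expansion : exists2 C : R, 0 <= C & forall eps N s dp dm,
  size s = m -> 0 <= eps -> eps <= 1 -> (forall y, y \in s -> cmod y <= eps) ->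
  cmod dp <= eps -> cmod dm <= eps ->
  cmod (\sum_(y <- s) y) + cmod dp + cmod dm <= N ->
  \sum_(y <- s) cmod y ^+ 2 <= 2 * N ->
  pnorm r (k_crit s dp dm - k_base - k_lin s dp dm) <= C * eps * N /\
  pnorm r (k_lin s dp dm) <= C * N.
Proof.
pose u : {poly R[i]} := 1 - 'X.
pose nu : R := 1 + r + pnorm r u + pnorm r (u ^+ m) + pnorm r ('X * u ^+ m.-1)
  + pnorm r ('X ^+ 2 * u ^+ m.-2) + pnorm r (q_of wp) + pnorm r (q_of wm).
have P0 p : 0 <= pnorm r p by apply: pnorm_ge0.
have r0 : 0 <= r by apply: le_trans r1.
have nu1 : 1 <= nu.
  rewrite /nu; move: (P0 u) (P0 (u ^+ m)) (P0 ('X * u ^+ m.-1)) (P0 ('X ^+ 2 * u ^+ m.-2)).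
  by move: (P0 (q_of wp)) (P0 (q_of wm)); lra.
have [bu [bX [bum [ba [be [bp bm]]]]]] : pnorm r u <= nu /\ pnorm r 'X <= nu /\
   pnorm r (u ^+ m) <= nu /\ pnorm r ('X * u ^+ m.-1) <= nu /\
   pnorm r ('X ^+ 2 * u ^+ m.-2) <= nu /\ pnorm r (q_of wp) <= nu /\
   pnorm r (q_of wm) <= nu.
  rewrite pnormX // /nu.
  move: (P0 u) (P0 (u ^+ m)) (P0 ('X * u ^+ m.-1)) (P0 ('X ^+ 2 * u ^+ m.-2)).
  by move: (P0 (q_of wp)) (P0 (q_of wm)); lra.
have [C0 C00 Hexp] := prod_expansion r1 m nu1 bu bX.
pose M : R := m%:R; have M0 : 0 <= M by rewrite /M.
have nu0 : 0 <= nu by apply: le_trans nu1.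
exists (M * nu ^+ 3 + 8 * M * C0 * nu ^+ 2 + 3 * (1 + 2 * M) * nu ^+ 3 + nu ^+ 3
        + 4 * nu ^+ 3) => [|eps N s dp dm sm eps0 eps1 Hs hdp hdm hN hS2].
  by rewrite !addr_ge0 ?mulr_ge0 ?exprn_ge0 ?addr_ge0 ?mulr_ge0.
set D := \sum_(y <- s) y in hN *.
have D0 := cmod_ge0 D; have dp0 := cmod_ge0 dp; have dm0 := cmod_ge0 dm.
have N0 : 0 <= N by apply: le_trans hN; rewrite !addr_ge0.
set S1 := \sum_(y <- s) cmod y.
have hS1 : S1 ^+ 2 <= 2 * M * N.
  apply: le_trans (sqr_sum_cmod s) _; rewrite sm -/M.
  by apply: le_trans (ler_wpM2l M0 hS2) _; rewrite mulrCA mulrA.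
have hS1' : S1 <= M * eps.
  rewrite /S1 big_seq (@le_trans _ _ (\sum_(y <- s | y \in s) eps)) //.
    by apply: ler_sum => y; apply: Hs.
  by rewrite -big_seq big_const_seq count_predT sm iter_addr_0 /M mulr_natl.
have hDS : cmod D <= S1 by apply: cmod_sum.
have hDN : cmod D <= N by lra.
have hdpN : cmod dp <= N by lra.
have hdmN : cmod dm <= N by lra.
have half : cmod (2^-1 : R[i]) = 2^-1 by rewrite cmodV cmod_nat.
have hE : cmod ((\sum_(y <- s) y ^+ 2) / 2) <= N.
  rewrite cmodM half ler_pdivrMr //; apply: le_trans (cmod_sum _ _ _) _.
  by rewrite (eq_bigr (fun y => cmod y ^+ 2)) 1?mulrC // => y _; rewrite cmodX.
have hD2 : cmod (D ^+ 2 / 2) <= M * eps * N.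
  rewrite cmodM half cmodX.
  have : cmod D * cmod D <= M * eps * N.
    by apply: ler_pM => //; apply: le_trans hS1'.
  by rewrite -expr2 => h; rewrite ler_pdivrMr // (le_trans h) // ler_peMr ?ler1n // !mulr_ge0.
have he2 : cmod (esym2 s) <= 2 * M * N by apply: le_trans (esym2_le s) _.
have e2E : esym2 s = D ^+ 2 / 2 - (\sum_(y <- s) y ^+ 2) / 2.
  by rewrite -mulrBl -esym2E mulrAC divff ?mul1r // pnatr_eq0.
have hkc : k_crit s dp dm = \prod_(y <- s) (u - y *: 'X) * (q_of wp - (wp * dp) *: 'X)
                            * (q_of wm - (wm * dm) *: 'X).
  rewrite /k_crit /q_of; congr (_ * _ * _); last 2 first.
  - by rewrite mulrDr mulr1 scalerDl opprD addrA.
  - by rewrite mulrDr mulr1 scalerDl opprD addrA.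
  by apply: eq_bigr => y _; rewrite scalerDl scale1r opprD addrA.
have := Hexp eps s sm eps1 Hs; set rem := \prod_(y <- s) _ - _ => Hrem.
have bA : \prod_(y <- s) (u - y *: 'X) =
   (u ^+ m - D *: ('X * u ^+ m.-1) + esym2 s *: ('X ^+ 2 * u ^+ m.-2)) + rem.
  by rewrite /rem addrC subrK.
pose bP : {poly R[i]} := - ((wp * dp) *: 'X); pose bM : {poly R[i]} := - ((wm * dm) *: 'X).
have hbP : pnorm r bP <= cmod dp * nu.
  by rewrite pnormN; apply: pnormZ_le; rewrite // cmodM hwp mul1r.
have hbM : pnorm r bM <= cmod dm * nu.
  by rewrite pnormN; apply: pnormZ_le; rewrite // cmodM hwm mul1r.
have hrem : pnorm r rem <= C0 * eps * (2 * M * N).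
  by apply: le_trans Hrem _; apply: ler_wpM2l => //; apply: mulr_ge0.
split.
  (* Sorted by origin: the square of the sum, the cubic remainder, the products of the power part
     with the perturbed side factors, and the product of the two side perturbations. *)
  have -> : k_crit s dp dm - k_base - k_lin s dp dm =
     (D ^+ 2 / 2) *: ('X ^+ 2 * u ^+ m.-2) * (q_of wp * q_of wm)
     + rem * ((q_of wp + bP) * (q_of wm + bM))
     + (- (D *: ('X * u ^+ m.-1)) + esym2 s *: ('X ^+ 2 * u ^+ m.-2))
       * (bP * q_of wm + q_of wp * bM + bP * bM)
     + u ^+ m * (bP * bM).
    rewrite hkc bA e2E /k_lin /k_base /k_a /k_e /k_side -/u /bP /bM -/D.
    move: (q_of wp) (q_of wm) => QP QM.
    rewrite scalerBl -!scalerA -!mul_polyC; ring.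
  have T1 : pnorm r ((D ^+ 2 / 2) *: ('X ^+ 2 * u ^+ m.-2) * (q_of wp * q_of wm))
     <= (M * eps * N) * nu * (nu * nu).
    by apply: pnormM_le => //; [apply: pnormZ_le | apply: pnormM_le].
  have dbl q w dd b : pnorm r q <= nu -> cmod dd <= eps -> pnorm r b <= cmod dd * nu ->
      w = q + b -> pnorm r w <= 2 * nu.
    move=> hq hd hb ->; rewrite mulrDl mul1r; apply: pnormD_le => //.
    by apply: le_trans hb _; rewrite ler_piMl // (le_trans hd).
  have T2 : pnorm r (rem * ((q_of wp + bP) * (q_of wm + bM)))
     <= C0 * eps * (2 * M * N) * (2 * nu * (2 * nu)).
    by apply: pnormM_le => //; apply: pnormM_le => //; [exact: (dbl _ _ _ _ bp hdp hbP erefl) | exact: (dbl _ _ _ _ bm hdm hbM erefl)].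
  have sml dd b : cmod dd <= eps -> pnorm r b <= cmod dd * nu -> pnorm r b <= eps * nu.
    by move=> hd hb; apply: le_trans hb _; rewrite ler_wpM2r.
  have T3 : pnorm r ((- (D *: ('X * u ^+ m.-1)) + esym2 s *: ('X ^+ 2 * u ^+ m.-2))
       * (bP * q_of wm + q_of wp * bM + bP * bM))
     <= (N * nu + 2 * M * N * nu) * (eps * nu * nu + nu * (eps * nu) + eps * nu * nu).
    apply: pnormM_le => //.
      by apply: pnormD_le => //; rewrite ?pnormN; apply: pnormZ_le.
    apply: pnormD_le => //.
      by apply: pnormD_le => //; apply: pnormM_le => //; [exact: (sml _ _ hdp hbP) | exact: (sml _ _ hdm hbM)].
    apply: pnormM_le => //; first exact: (sml _ _ hdp hbP).
    by apply: le_trans (sml _ _ hdm hbM) _; rewrite ler_piMl.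
  have T4 : pnorm r (u ^+ m * (bP * bM)) <= nu * (eps * nu * (N * nu)).
    apply: pnormM_le => //; apply: pnormM_le => //; first exact: (sml _ _ hdp hbP).
    by apply: le_trans hbM _; rewrite ler_wpM2r.
  apply: le_trans (pnormD_le r1 (pnormD_le r1 (pnormD_le r1 T1 T2) T3) T4) _.
  rewrite -subr_ge0 (_ : _ - _ = 4 * nu ^+ 3 * eps * N); last by ring.
  by rewrite !mulr_ge0 ?exprn_ge0.
have T1 : pnorm r (k_lin s dp dm) <= N * (nu * nu * nu) + N * (nu * nu * nu)
    + N * (1 * (nu * nu * nu)) + N * (1 * (nu * nu * nu)).
  rewrite /k_lin pnormN; apply: pnormD_le => //; last first.
    apply: pnormZ_le => //; apply: pnormZ_le; rewrite ?hwm //.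
    by apply: pnormM_le => //; apply: pnormM_le.
  apply: pnormD_le => //; last first.
    apply: pnormZ_le => //; apply: pnormZ_le; rewrite ?hwp //.
    by apply: pnormM_le => //; apply: pnormM_le.
  apply: pnormD_le => //; apply: pnormZ_le => //; apply: pnormM_le => //; exact: pnormM_le.
apply: le_trans T1 _; rewrite -subr_ge0.
rewrite (_ : _ - _ = (M * nu ^+ 3 + 8 * M * C0 * nu ^+ 2 + 3 * (1 + 2 * M) * nu ^+ 3
   + nu ^+ 3) * N); last by ring.
by rewrite mulr_ge0 // !addr_ge0 ?mulr_ge0 ?exprn_ge0 ?addr_ge0 ?mulr_ge0.
Qed.

End Integrand.

(** * First order displacement of a zero *)

Section RootShift.
Variables (R : realType).

(** Two uses of the factor theorem; the remainder is again a polynomial, so that [pnorm] bounds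
    it. *)
Lemma horner_taylor2 (p : {poly R[i]}) (x : R[i]) :
  exists q : {poly R[i]}, forall y, p.[y] = p.[x] + p^`().[x] * (y - x) + (y - x) ^+ 2 * q.[y].
Proof.
have [q1 E1] : exists q, p - p.[x]%:P = q * ('X - x%:P).
  by apply/factor_theorem; rewrite rootE !hornerE subrr.
have [q2 E2] : exists q, q1 - q1.[x]%:P = q * ('X - x%:P).
  by apply/factor_theorem; rewrite rootE !hornerE subrr.
have P1 : p = q1 * ('X - x%:P) + p.[x]%:P by rewrite -E1 subrK.
have P2 : q1 = q2 * ('X - x%:P) + q1.[x]%:P by rewrite -E2 subrK.
have D1 : p^`().[x] = q1.[x].
  by rewrite {1}P1 derivD derivC addr0 derivM derivXsubC mulr1 !hornerE subrr mulr0 add0r.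
exists q2 => y; rewrite D1 {1}P1 !hornerE {1}P2 !hornerE; ring.
Qed.

Variables (m : nat) (wp wm : R[i]).
Hypotheses (hwp : cmod wp = 1) (hwm : cmod wm = 1).
Variables (H0 Pa Pe Pp Pm : {poly R[i]}).
Hypotheses (dH0 : H0^`() = k_base m wp wm) (dPa : Pa^`() = k_a m wp wm)
  (dPe : Pe^`() = k_e m wp wm) (dPp : Pp^`() = k_side m wp wm)
  (dPm : Pm^`() = k_side m wm wp).
Hypotheses (H00 : H0.[0] = 0) (Pa0 : Pa.[0] = 0) (Pe0 : Pe.[0] = 0) (Pp0 : Pp.[0] = 0)
  (Pm0 : Pm.[0] = 0).
Variable t0 : R[i].
Hypotheses (Ht0 : H0.[t0] = 0) (h0 : (k_base m wp wm).[t0] != 0).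

(** Taylor's formula for [H0] at [t0] and [H.[t] = 0] express [h * (t - t0)] as minus the value of
    [H - H0] at [t], up to a quadratic term; and [H - H0] is close to the primitive of [k_lin]. The
    displacement has to be shown [O(N)] before its square can be counted as negligible. *)
Lemma root_shift (tau : R) : 0 < tau -> exists2 eps : R, 0 < eps & forall N s dp dm H t,
  size s = m -> (forall y, y \in s -> cmod y <= eps) ->
  cmod dp <= eps -> cmod dm <= eps -> N <= eps ->
  cmod (\sum_(y <- s) y) + cmod dp + cmod dm <= N ->
  \sum_(y <- s) cmod y ^+ 2 <= 2 * N ->
  H^`() = k_crit wp wm s dp dm -> H.[0] = 0 -> H.[t] = 0 -> cmod (t - t0) <= eps ->
  cmod ((k_base m wp wm).[t0] * (t - t0)
        - ((\sum_(y <- s) y) * Pa.[t0] + (\sum_(y <- s) y ^+ 2) / 2 * Pe.[t0]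
           + dp * Pp.[t0] + dm * Pm.[t0])) <= tau * N.
Proof.
move=> tau0; pose r : R := 1 + cmod t0 + 1.
have r1 : 1 <= r by rewrite /r; move: (cmod_ge0 t0); lra.
have r0 : 0 <= r by apply: le_trans r1.
have t0r : cmod t0 <= r by rewrite /r; lra.
have [C C0 Hexp] := k_expansion m hwp hwm r1.
have [q Hq] := horner_taylor2 H0 t0.
set h := (k_base m wp wm).[t0]; have hp : 0 < cmod h by rewrite cmod_gt0.
pose Q := pnorm r q; have Q0 : 0 <= Q by apply: pnorm_ge0.
pose C2 := 4 * r * C / cmod h; have C20 : 0 <= C2 by rewrite !mulr_ge0 // invr_ge0 ltW.
pose C3 := Q * C2 + 2 * C * C2 + r * C + 1.
have C30 : 0 < C3.
  by move: (mulr_ge0 Q0 C20) (mulr_ge0 C0 C20) (mulr_ge0 r0 C0); rewrite /C3 => ? ? ?; lra.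
(* Makes [eps * (Q + 2 * C)] at most half of [cmod h], so that the terms carrying an extra factor
   [eps] can be absorbed on the left. *)
pose e1 : R := cmod h / (2 * (Q + 2 * C + 1)).
have e10 : 0 < e1 by rewrite divr_gt0 // mulr_gt0 // ltr_wpDl // addr_ge0 // mulr_ge0.
exists (Num.min 1 (Num.min e1 (tau / C3))).
  by rewrite !lt_min ltr01 e10 divr_gt0.
set eps := Num.min _ _ => N s dp dm H t sm Hs hdp hdm hN hND hS2 dH Hz Ht htt.
have eps1 : eps <= 1 by rewrite ge_min lexx.
have epsE : eps <= e1 by rewrite !ge_min lexx !orbT.
have epsT : eps * C3 <= tau by rewrite -ler_pdivlMr // !ge_min lexx !orbT.
have eps0 : 0 <= eps by apply: le_trans htt.
have epsh : eps * (Q + 2 * C) <= cmod h / 2.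
  apply: (@le_trans _ _ (e1 * (Q + 2 * C + 1))).
    by apply: ler_pM => //; [rewrite addr_ge0 ?mulr_ge0 | rewrite lerDl].
  rewrite /e1 -mulrA ler_wpM2l // invfM -mulrA mulVf ?mulr1 //.
  by rewrite gt_eqF // ltr_wpDl // addr_ge0 // mulr_ge0.
have N0 : 0 <= N by apply: le_trans hND; rewrite !addr_ge0.
have [B1 B2] := Hexp eps N s dp dm sm eps0 eps1 Hs hdp hdm hND hS2.
set D := \sum_(y <- s) y in hND *; set E := \sum_(y <- s) y ^+ 2.
(* The primitive of [k_lin] that vanishes at [0]; minus its value at [t0] is the predicted value of
   [h * (t - t0)]. *)
pose Hl := - (D *: Pa + (E / 2) *: Pe + dp *: Pp + dm *: Pm).
have dHl : Hl^`() = k_lin m wp wm s dp dm.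
  by rewrite /Hl /k_lin derivN !derivD !derivZ dPa dPe dPp dPm.
have Hl0 : Hl.[0] = 0 by rewrite !hornerE Pa0 Pe0 Pp0 Pm0 !mulr0 !addr0 oppr0.
have -> : D * Pa.[t0] + E / 2 * Pe.[t0] + dp * Pp.[t0] + dm * Pm.[t0] = - Hl.[t0].
  by rewrite /Hl !hornerE opprK.
clearbody Hl; rewrite opprK; pose L := H - H0; pose d := t - t0.
have dL : L^`() = k_crit wp wm s dp dm - k_base m wp wm by rewrite derivB dH dH0.
have LE y : L.[y] = H.[y] - H0.[y] by rewrite !hornerE.
clearbody L.
have tr : cmod t <= r.
  have := cmodD t0 d; rewrite /d addrC subrK /r => hh; apply: le_trans hh _.
  by move: (le_trans htt eps1); lra.
have zr : cmod (0 : R[i]) <= r by rewrite cmod0.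
have L1 : cmod (L.[t] - L.[t0]) <= cmod d * (2 * C * N).
  apply: le_trans (horner_lipschitz r1 L tr t0r) _; apply: ler_wpM2l => //.
  have -> : L^`() = (k_crit wp wm s dp dm - k_base m wp wm - k_lin m wp wm s dp dm)
                      + k_lin m wp wm s dp dm.
    by rewrite dL subrK.
  apply: le_trans (pnormD_le r1 B1 B2) _.
  have : C * eps * N <= C * N by rewrite -mulrA mulrCA ler_piMl // mulr_ge0.
  lra.
have L2 : cmod (L.[t0] - Hl.[t0]) <= r * (C * eps * N).
  have := horner_lipschitz r1 (L - Hl) t0r zr.
  move=> hh; rewrite !hornerE (LE 0) Hz H00 Hl0 !subr0 in hh; apply: le_trans hh _.
  by apply: ler_pM => //; [exact: pnorm_ge0 | rewrite derivB dL dHl].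
have L3 : cmod Hl.[t0] <= r * (C * N).
  have := horner_lipschitz r1 Hl t0r zr.
  rewrite Hl0 !subr0 dHl => hh; apply: le_trans hh _.
  by apply: ler_pM => //; exact: pnorm_ge0.
have eq1 : h * d + Hl.[t0] = - (d ^+ 2 * q.[t] + ((L.[t] - L.[t0]) + (L.[t0] - Hl.[t0]))).
  have := Hq t; rewrite Ht0 dH0 -/h -/d add0r => HqE.
  have : H.[t] = H0.[t] + L.[t] by rewrite LE addrC subrK.
  rewrite Ht HqE => /esym e0; apply/eqP; rewrite -subr_eq0 opprK; apply/eqP.
  rewrite -[RHS]e0; ring.
have d0 := cmod_ge0 d.
have eq2 : cmod (h * d + Hl.[t0]) <= cmod d ^+ 2 * Q + (cmod d * (2 * C * N) + r * (C * eps * N)).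
  rewrite eq1 cmodN (le_trans (cmodD _ _)) // lerD //.
    by rewrite cmodM cmodX ler_wpM2l ?exprn_ge0 // cmod_horner.
  by rewrite (le_trans (cmodD _ _)) // lerD.
have hd : cmod d <= eps by [].
(* A crude bound: half of [cmod h * cmod d] absorbs the terms in [d], which gives
   [cmod d <= C2 * N]. Inserted in [eq2], it turns every term into [eps * N] times a constant. *)
have eq3 : cmod h * cmod d <= cmod d ^+ 2 * Q + (cmod d * (2 * C * N) + r * (C * eps * N)) + r * (C * N).
  rewrite -cmodM -[h * d](addrK Hl.[t0]) (le_trans (cmodB _ _)) //.
  exact: lerD.
have a1 : cmod d ^+ 2 * Q + cmod d * (2 * C * N) <= cmod h / 2 * cmod d.
  apply: (@le_trans _ _ (eps * (Q + 2 * C) * cmod d)); last by rewrite ler_wpM2r.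
  rewrite -subr_ge0 (_ : _ - _ = cmod d * Q * (eps - cmod d) + 2 * C * cmod d * (eps - N)); last by ring.
  by rewrite addr_ge0 // !mulr_ge0 // subr_ge0.
have a2 : r * (C * eps * N) <= r * (C * N).
  by rewrite ler_wpM2l // -mulrA ler_wpM2l // ler_piMl.
have a3 : cmod d <= C2 * N.
  rewrite /C2 mulrAC ler_pdivlMr //; move: a1 a2 eq3; lra.
apply: le_trans eq2 _; apply: (@le_trans _ _ (eps * C3 * N)); last by rewrite ler_wpM2r.
have b1 : cmod d ^+ 2 * Q <= eps * (Q * C2) * N.
  rewrite expr2 (_ : eps * (Q * C2) * N = eps * (C2 * N) * Q); last by ring.
  by rewrite ler_wpM2r // ler_pM.
have b2 : cmod d * (2 * C * N) <= eps * (2 * C * C2) * N.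
  rewrite (_ : eps * (2 * C * C2) * N = (C2 * N) * (2 * C * eps)); last by ring.
  by rewrite ler_pM ?mulr_ge0 // ler_wpM2l // mulr_ge0.
have b3 : 0 <= eps * N by apply: mulr_ge0.
rewrite /C3; move: b1 b2 b3; lra.
Qed.

End RootShift.

(** * The linear inequalities and their bounded solutions *)

Section LinearProgram.
Variable R : realType.

(** Cramer's rule. *)
Lemma solve22_bound (a b c d : R) : a * d - b * c != 0 ->
  exists2 C, 0 <= C & forall x y B : R, `|a * x + b * y| <= B -> `|c * x + d * y| <= B ->
    `|x| <= C * B /\ `|y| <= C * B.
Proof.
move=> D0; pose e := `|a * d - b * c|; have e0 : 0 < e by rewrite normr_gt0.
exists ((`|a| + `|b| + `|c| + `|d|) / e).
  by rewrite divr_ge0 ?addr_ge0 // ltW.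
move=> x y B h1 h2.
have B0 : 0 <= B by apply: le_trans h1.
have H (u v w : R) : `|w| * e <= `|u| * B + `|v| * B ->
    `|u| + `|v| <= `|a| + `|b| + `|c| + `|d| -> `|w| <= (`|a| + `|b| + `|c| + `|d|) / e * B.
  move=> hw huv; rewrite mulrAC ler_pdivlMr // (le_trans hw) // -mulrDl ler_wpM2r //.
have := (normr_ge0 a, normr_ge0 b, normr_ge0 c, normr_ge0 d) => -[[[a0 b0] c0] d0].
split.
  apply: (H d b); last by lra.
  rewrite -normrM (_ : x * _ = d * (a * x + b * y) - b * (c * x + d * y)); last by ring.
  by rewrite (le_trans (ler_normB _ _)) // !normrM lerD // ler_wpM2l.
apply: (H a c); last by lra.
rewrite -normrM (_ : y * _ = a * (c * x + d * y) - c * (a * x + b * y)); last by ring.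
by rewrite (le_trans (ler_normB _ _)) // !normrM lerD // ler_wpM2l.
Qed.

Lemma norm_le_add_sub (x y : R) : `|x| <= `|x - y| + `|x + y|.
Proof.
have : `|x + x| <= `|x - y| + `|x + y|.
  by rewrite (_ : x + x = (x - y) + (x + y)) ?ler_normD //; ring.
by rewrite -mulr2n normrMn mulr2n; have := normr_ge0 x; lra.
Qed.

(** In a vanishing sum with positive weights, each term is minus the sum of the two others, so the
    common upper bound also gives lower bounds. *)
Lemma balanced_bound (l l1 l2 l3 b : R) (p : nat -> R) : l = l1 + l2 + l3 -> 0 < l1 -> 0 < l2 -> 0 < l3 -> 0 <= b ->
  (forall i, (i < 3)%N -> p i <= b) -> l1 * p 0%N + l2 * p 1%N + l3 * p 2%N = 0 ->
  forall i, (i < 3)%N ->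
    `|p i| <= (l / l1 + l / l2 + l / l3) * b.
Proof.
move=> lE p1 p2 p3 b0 hp h0.
have key la pa : 0 < la -> 0 <= la * pa + l * b -> - (l / la * b) <= pa.
  by move=> la0 h; rewrite mulrAC -mulNr ler_pdivrMr // (mulrC pa) -subr_ge0 opprK.
have E (la : R) : 0 < la -> la <= l -> 0 <= l / la * b /\ b <= l / la * b.
  move=> la0 lal; have h : 1 <= l / la by rewrite ler_pdivlMr // mul1r.
  by split; [rewrite mulr_ge0 // (le_trans _ h)|rewrite ler_peMl].
have [e1 f1] : 0 <= l / l1 * b /\ b <= l / l1 * b by apply: E; rewrite // lE; lra.
have [e2 f2] : 0 <= l / l2 * b /\ b <= l / l2 * b by apply: E; rewrite // lE; lra.
have [e3 f3] : 0 <= l / l3 * b /\ b <= l / l3 * b by apply: E; rewrite // lE; lra.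
have M j la : (j < 3)%N -> 0 < la -> la * p j <= la * b by move=> hj la0; rewrite ler_wpM2l ?hp // ltW.
have m1 := M 0%N l1 isT p1; have m2 := M 1%N l2 isT p2; have m3 := M 2%N l3 isT p3.
have lb : l * b = l1 * b + l2 * b + l3 * b by rewrite lE; ring.
have [z1 z2 z3] : [/\ 0 <= l1 * b, 0 <= l2 * b & 0 <= l3 * b] by split; rewrite mulr_ge0 // ltW.
have k1 : - (l / l1 * b) <= p 0%N by apply: key; rewrite // lb; move: m2 m3 h0 z1; lra.
have k2 : - (l / l2 * b) <= p 1%N by apply: key; rewrite // lb; move: m1 m3 h0 z2; lra.
have k3 : - (l / l3 * b) <= p 2%N by apply: key; rewrite // lb; move: m1 m2 h0 z3; lra.
have [u1 u2 u3] : [/\ p 0%N <= b, p 1%N <= b & p 2%N <= b] by split; apply: hp.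
move=> i hi; rewrite ler_norml (mulrDl (_ + _) (l / l3) b) (mulrDl (l / l1) (l / l2) b).
move: (l / l1 * b) (l / l2 * b) (l / l3 * b) e1 e2 e3 f1 f2 f3 k1 k2 k3 => x1 x2 x3.
clear E key M lE lb h0 m1 m2 m3 z1 z2 z3; move=> e1 e2 e3 f1 f2 f3 k1 k2 k3.
by case: i hi => [|[|[|//]]] _; apply/andP; split; lra.
Qed.

Lemma le_of_two_sided (x y T : R) : x + y <= T -> x - y <= T -> x <= T.
Proof. lra. Qed.

(** Here [p + r1] is the even part and [q + r2] the odd part of a row, each split into free
    variables and variables already bounded. Both signs of the odd part are bounded above, hence its
    modulus is bounded once the even part is. *)
Lemma abs_of_two_sided (p q r1 r2 T P w : R) : (p + r1) + (q + r2) <= T -> (p + r1) - (q + r2) <= T ->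
  `|p| <= P -> `|r1| + `|r2| <= w -> `|q| <= T + P + w.
Proof.
rewrite !ler_norml => h1 h2 /andP[h3 _] h4.
have s1 := ler_norm (- r1); have s2 := ler_norm r2; have s3 := ler_norm (- r2).
by rewrite !normrN in s1 s3; apply/andP; split; lra.
Qed.

(** The three minors used as weights form the cross product of [Z] and [V], which is orthogonal to
    both. *)
Definition minor (Z V : nat -> R) (i j : nat) := Z i * V j - Z j * V i.

(* [Z], [V] are the coefficients of the two free symmetric variables, [A], [E], [X] those of
   the symmetric slacks, and [I], [U], [k] those of the antisymmetric variables. *)
Lemma lp_bound (Z V A E X I U k : nat -> R) :
  let l1 := minor Z V 1 2 in let l2 := minor Z V 2 0 in let l3 := minor Z V 0 1 in
  let comb (F : nat -> R) := l1 * F 0%N + l2 * F 1%N + l3 * F 2%N in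
  0 < l1 -> 0 < l2 -> 0 < l3 -> 0 < comb A -> 0 < comb A + comb E -> 0 < comb X ->
  minor I U 0 1 != 0 ->
  exists2 C, 0 <= C & forall db S Q xp xm yp ym Y T : R,
    0 <= Q <= S -> 0 <= xp -> 0 <= xm ->
    (forall i, (i < 3)%N ->
      let F := Z i * db + A i * S + E i * Q + X i * (xp + xm) + V i * (yp - ym) in
      let G := I i * Y + k i * (xp - xm) + U i * (yp + ym) in
      F + G <= T /\ F - G <= T) ->
    `|db| + S + `|Y| + xp + xm + `|yp| + `|ym| <= C * T.
Proof.
move=> l1 l2 l3 comb l1p l2p l3p kA kAE kX hIU.
pose cA := comb A; pose cE := comb E; pose cX := comb X.
rewrite -/cA -/cE -/cX in kA kAE kX *.
(* This determinant is [l3], so the positivity of the weight also makes the system in the two free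
   even variables solvable. *)
have hZV : Z 0%N * V 1%N - V 0%N * Z 1%N != 0 by rewrite (mulrC (V 0%N)) gt_eqF.
have hIU' : I 0%N * U 1%N - U 0%N * I 1%N != 0 by rewrite (mulrC (U 0%N)).
have [C1 C10 HC1] := solve22_bound hZV.
have [C2 C20 HC2] := solve22_bound hIU'.
pose l := l1 + l2 + l3; have lp : 0 < l by exact: (addr_gt0 (addr_gt0 l1p l2p) l3p).
(* On [0 <= Q <= S] the form [cA * S + cE * Q] is linear in [Q], so its minimum is reached at
   [Q = 0] or [Q = S]; it is therefore at least [mu * S]. *)
pose mu := Num.min (cA) (cA + cE).
have mup : 0 < mu by rewrite /mu lt_min kA kAE.
pose B0 := l / mu + l / cX.
have B01 : 0 < l / mu by rewrite divr_gt0.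
have B02 : 0 < l / cX by rewrite divr_gt0.
have B00 : 0 <= B0 by rewrite addr_ge0 // ltW.
pose W := \sum_(i < 3) (`|A i| + `|E i| + `|X i| + `|k i|).
have Wle i : (i < 3)%N -> `|A i| + `|E i| + `|X i| + `|k i| <= W.
  move=> hi; rewrite /W (bigD1 (Ordinal hi)) //= lerDl; apply: sumr_ge0 => j _.
  by rewrite !addr_ge0.
have W0 : 0 <= W by apply: sumr_ge0 => j _; rewrite !addr_ge0.
pose B1 := 1 + W * B0; have B10 : 0 <= B1 by rewrite addr_ge0 ?mulr_ge0.
pose B2 := B1 * (l / l1 + l / l2 + l / l3).
have B20 : 0 <= B2 by rewrite mulr_ge0 // !addr_ge0 // divr_ge0 // ltW.
have WB : 0 <= W * B0 by rewrite mulr_ge0.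
pose B3 := 1 + B2 + W * B0; have B30 : 0 <= B3 by rewrite !addr_ge0.
exists (C1 * B2 + B0 + C2 * B3 + B0 + B0 + (C1 * B2 + C2 * B3) + (C1 * B2 + C2 * B3)).
  have c1 := mulr_ge0 C10 B20; have c2 := mulr_ge0 C20 B30.
  by do !(apply: addr_ge0 => //).
move=> db S Q xp xm yp ym Y T /andP[Q0 QS] xp0 xm0 H.
have S0 : 0 <= S by apply: le_trans QS.
pose p i := Z i * db + V i * (yp - ym).
pose F i := Z i * db + A i * S + E i * Q + X i * (xp + xm) + V i * (yp - ym).
have HF i : (i < 3)%N -> F i <= T by case/H; exact: le_of_two_sided.
(* The weights annihilate [Z] and [V], so [db] and [yp - ym] disappear from the combination and only
   variables with a sign remain. *)
have p0 : l1 * p 0%N + l2 * p 1%N + l3 * p 2%N = 0.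
  by rewrite /l1 /l2 /l3 /p /minor; ring.
have sumF : comb F = cA * S + cE * Q + cX * (xp + xm).
  apply/eqP; rewrite -subr_eq0 -[X in _ == X]p0 /cA /cE /cX /comb /F /p; apply/eqP; ring.
have lE x : l * x = l1 * x + l2 * x + l3 * x by rewrite /l; ring.
have hsum : cA * S + cE * Q + cX * (xp + xm) <= l * T.
  rewrite -sumF lE /comb.
  by apply: lerD; [apply: lerD|]; apply: ler_wpM2l; rewrite ?HF // ltW.
have lS : l = l1 + l2 + l3 by [].
clearbody l cA cE cX.
have muS : mu * S <= cA * S + cE * Q.
  have mA : mu <= cA by rewrite ge_min lexx.
  have mAE : mu <= cA + cE by rewrite ge_min lexx orbT.
  rewrite -subr_ge0.
  rewrite (_ : _ - _ = (cA - mu) * (S - Q) + (cA + cE - mu) * Q); last by ring.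
  by rewrite addr_ge0 // mulr_ge0 // subr_ge0.
have xx0 : 0 <= xp + xm by rewrite addr_ge0.
have kXx : 0 <= cX * (xp + xm) by rewrite mulr_ge0 // ltW.
have muS0 : 0 <= mu * S by rewrite mulr_ge0 // ltW.
have lT0 : 0 <= l * T by apply: le_trans hsum; rewrite addr_ge0 // (le_trans muS0).
have T0 : 0 <= T by rewrite -(pmulr_rge0 _ lp).
have hS' : S <= l / mu * T.
  by rewrite mulrAC ler_pdivlMr // mulrC (le_trans muS) // (le_trans _ hsum) // lerDl.
have hX' : xp + xm <= l / cX * T.
  by rewrite mulrAC ler_pdivlMr // mulrC (le_trans _ hsum) // lerDr (le_trans muS0).
have BE : B0 * T = l / mu * T + l / cX * T by rewrite /B0 mulrDl.
have hS : S <= B0 * T by rewrite BE (le_trans hS') // lerDl mulr_ge0 // ltW.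
have hX : xp + xm <= B0 * T by rewrite BE (le_trans hX') // lerDr mulr_ge0 // ltW.
clearbody B0.
have B0T : 0 <= B0 * T by rewrite mulr_ge0.
have rest i : (i < 3)%N -> `|A i * S + E i * Q + X i * (xp + xm)| + `|k i * (xp - xm)| <= W * B0 * T.
  move=> /Wle hi; rewrite -mulrA; apply: le_trans (ler_wpM2r B0T hi); rewrite !mulrDl.
  rewrite lerD //; last first.
    by rewrite normrM ler_wpM2l // (le_trans (ler_normB _ _)) // !ger0_norm //.
  apply: le_trans (ler_normD _ _) _; apply: lerD.
    apply: le_trans (ler_normD _ _) _; apply: lerD.
  - by rewrite normrM ler_wpM2l // ger0_norm.
  - by rewrite normrM ler_wpM2l // ger0_norm //; apply: le_trans QS hS.
  - by rewrite normrM ler_wpM2l // ger0_norm.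
have pF i : p i = F i - (A i * S + E i * Q + X i * (xp + xm)) by rewrite /p /F; ring.
have pub i : (i < 3)%N -> p i <= B1 * T.
  move=> hi; rewrite pF /B1 mulrDl mul1r lerD ?HF //.
  apply: le_trans (rest i hi); by rewrite -normrN (le_trans (ler_norm _)) // lerDl.
have B1T : 0 <= B1 * T by rewrite mulr_ge0.
(* The variables with a sign are now [O(T)], so each row bounds [p i] above; the relation [p0]
   supplies the lower bounds, and the free variables follow from two 2 by 2 systems. *)
have pabs i : (i < 3)%N -> `|p i| <= B2 * T.
  move=> hi; rewrite /B2 mulrAC (mulrC _ (_ + _)).
  exact: balanced_bound lS l1p l2p l3p B1T pub p0 i hi.
have gabs i : (i < 3)%N -> `|I i * Y + U i * (yp + ym)| <= B3 * T.
  move=> hi; have [a1 a2] := H i hi; rewrite /B3 !mulrDl mul1r.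
  apply: (abs_of_two_sided _ _ (pabs i hi) (rest i hi)).
    by apply: le_trans a1; rewrite /p le_eqVlt; apply/orP; left; apply/eqP; ring.
  by apply: le_trans a2; rewrite /p le_eqVlt; apply/orP; left; apply/eqP; ring.
have [e1 e2] := HC1 db (yp - ym) _ (pabs 0%N isT) (pabs 1%N isT).
have [e3 e4] := HC2 Y (yp + ym) _ (gabs 0%N isT) (gabs 1%N isT).
have e5 := norm_le_add_sub yp ym.
have e6 : `|ym| <= `|yp - ym| + `|yp + ym|.
  by rewrite distrC addrC (addrC yp) addrC norm_le_add_sub.
have f5 := le_trans e5 (lerD e2 e4); have f6 := le_trans e6 (lerD e2 e4).
have x1 : xp <= B0 * T by apply: le_trans hX; rewrite lerDl.
have x2 : xm <= B0 * T by apply: le_trans hX; rewrite lerDr.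
clearbody B2 B3; rewrite !mulrDl -!(mulrA _ _ T).
by do !(apply: lerD => //).
Qed.

End LinearProgram.

(* No admissible perturbation keeps the zeros near the contact points inside the disk. *)
Definition rigid (R : realType) (m : nat) (M : R) (wp : R[i]) (t : nat -> R[i]) : Prop :=
  exists2 eps : R, 0 < eps & forall (M' : R) (s : seq R[i]) dp dm (H : {poly R[i]}), size s = m ->
    (forall y, y \in s -> cmod y <= eps /\ cmod (1 + y) < 1) ->
    cmod dp <= eps -> cmod (1 + dp) <= 1 -> cmod dm <= eps -> cmod (1 + dm) <= 1 ->
    `|M' - M| <= eps -> H^`() = k_crit wp wp^* s dp dm -> H.[0] = 0 ->
    (forall (i : nat) z, (i < 3)%N -> z = t i \/ z = (t i)^* -> exists t', [/\ H.[t'] = 0,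
        cmod (t' - z) <= eps & cmod (M'%:C - t') <= cmod (M%:C - t i)]) ->
    False.

(** * Local rigidity of the contact configuration *)

Section LocalRigidity.
Variable R : realType.
Implicit Types (z w t d : R[i]) (s : seq R[i]).

Lemma Re_cartM (x y : R) z : complex.Re ((x +i* y) * z) = x * complex.Re z - y * complex.Im z.
Proof. by case: z. Qed.

Lemma conj_realB (x : R) z : (x%:C - z)^* = x%:C - z^*.
Proof.
by case: z => a b; apply/eqP; rewrite eq_complex /=; apply/andP; split; apply/eqP; ring.
Qed.

Lemma ReJM z w : complex.Re (z^* * w) = complex.Re z * complex.Re w + complex.Im z * complex.Im w.
Proof. by case: z w => a b [c d] /=; rewrite mulNr opprK. Qed.

Lemma disk_row (M M' : R) (t0 t1 h ell W : R[i]) (e : R) :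
  cmod (M'%:C - t1) <= cmod (M%:C - t0) -> W = ((M%:C - t0) * h)^* ->
  cmod (h * (t1 - t0) - ell) <= e ->
  cmod h ^+ 2 * complex.Re (M%:C - t0) * (M' - M) - complex.Re (W * ell) <= cmod W * e.
Proof.
move=> hd hW he; set z := M%:C - t0 in hd hW *; set d := t1 - t0 in he *.
set err := h * d - ell in he.
have Eell : ell = h * d - err by rewrite /err opprB addrC subrK.
have hv : complex.Re (z^* * ((M' - M)%:C - d)) <= 0.
  have : cmod (z + ((M' - M)%:C - d)) ^+ 2 <= cmod z ^+ 2.
    rewrite lerXn2r ?nnegrE // (le_trans _ hd) // le_eqVlt; apply/orP; left; apply/eqP.
    by congr cmod; rewrite /z /d rmorphB /=; ring.
  rewrite !cmod_sqr ReJM; case: (z) => a b; case: (_ - d) => a' b' /=.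
  have := sqr_ge0 a'; have := sqr_ge0 b'; lra.
have hW2 : complex.Re (W * err) <= cmod W * e.
  apply: le_trans (ler_norm _) _; apply: le_trans (Re_le_cmod _) _.
  by rewrite cmodM ler_wpM2l.
have : cmod h ^+ 2 * complex.Re (z^* * ((M' - M)%:C - d)) <= 0.
  by rewrite mulr_ge0_le0 ?exprn_ge0.
have -> : cmod h ^+ 2 * complex.Re (z^* * ((M' - M)%:C - d)) =
    cmod h ^+ 2 * complex.Re z * (M' - M) - complex.Re (W * (h * d)).
  rewrite hW cmod_sqr; case: (z) (h) (d) => a b [a' b'] [a2 b2] /=; ring.
have -> : complex.Re (W * ell) = complex.Re (W * (h * d)) - complex.Re (W * err).
  by rewrite Eell (mulrBr W) raddfB.
by move: hW2; lra.
Qed.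

Variables (m : nat) (M : R).
Variable (wp : R[i]).
Hypotheses (hwp : cmod wp = 1).
Let wm := wp^*.
Variables (H0 Pa Pe PB PC : {poly R[i]}).
Hypotheses (dH0 : H0^`() = k_base m wp wm) (dPa : Pa^`() = k_a m wp wm)
  (dPe : Pe^`() = k_e m wp wm) (dPB : PB^`() = 'X * (1 - 'X) ^+ m)
  (dPC : PC^`() = 'X ^+ 2 * (1 - 'X) ^+ m).
Hypotheses (H00 : H0.[0] = 0) (Pa0 : Pa.[0] = 0) (Pe0 : Pe.[0] = 0) (PB0 : PB.[0] = 0)
  (PC0 : PC.[0] = 0).
Definition conj_equiv (p : {poly R[i]}) := forall z, p.[z^*] = p.[z]^*.
Hypotheses (cH0 : conj_equiv H0) (cPa : conj_equiv Pa) (cPe : conj_equiv Pe)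
  (cPB : conj_equiv PB) (cPC : conj_equiv PC) (cK : conj_equiv (k_base m wp wm)).

Definition weight t := ((M%:C - t) * (k_base m wp wm).[t])^*.
(** The mean of the primitives attached to [wp] and [wm]. Their half difference is [i * Im wp * PB],
    which is where [contactV] and [contactk] come from. The real parts [Z], [V], [A], [E], [X]
    multiply the variables even under conjugation, and [I], [U], [k] the odd ones. *)
Definition sideval t := (complex.Re wp)%:C * PB.[t] - PC.[t].
Definition contactZ t := cmod (k_base m wp wm).[t] ^+ 2 * complex.Re (M%:C - t).
Definition contactV t := complex.Im wp * complex.Re (weight t * PB.[t]).
Definition contactA t := complex.Re (weight t * Pa.[t]).
Definition contactE t := complex.Re (weight t * Pe.[t]).
Definition contactX t := complex.Re (weight t * sideval t).
Definition contactI t := complex.Im (weight t * Pa.[t]).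
Definition contactU t := complex.Im (weight t * sideval t).
Definition contactk t := - (complex.Im wp * complex.Im (weight t * PB.[t])).

Lemma wpwm : wp * wm = 1.
Proof.
have := cmod_sqr wp; rewrite hwp expr1n /wm; case: (wp) => a b /= h.
by apply/eqP; rewrite eq_complex /=; apply/andP; split; apply/eqP; [rewrite h|]; ring.
Qed.

Lemma cwm : cmod wm = 1. Proof. by rewrite cmodJ. Qed.

(** Since [wp * wm = 1], the product [wp 'X (1 - wm 'X)] is [wp 'X - 'X ^+ 2]: the same two
    primitives [PB] and [PC] serve both side factors. *)
Lemma dPp : (wp *: PB - PC)^`() = k_side m wp wm.
Proof.
rewrite derivB derivZ dPB dPC /k_side /q_of -!mul_polyC.
have : wp%:P * wm%:P = 1 :> {poly R[i]} by rewrite -polyCM wpwm.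
move: (_ ^+ m) => v e; apply/eqP; rewrite -subr_eq0.
rewrite (_ : _ - _ = 'X ^+ 2 * v * (wp%:P * wm%:P - 1)); last by ring.
by rewrite e subrr mulr0.
Qed.

Lemma dPm : (wm *: PB - PC)^`() = k_side m wm wp.
Proof.
rewrite derivB derivZ dPB dPC /k_side /q_of -!mul_polyC.
have : wp%:P * wm%:P = 1 :> {poly R[i]} by rewrite -polyCM wpwm.
move: (_ ^+ m) => v e; apply/eqP; rewrite -subr_eq0.
rewrite (_ : _ - _ = 'X ^+ 2 * v * (wp%:P * wm%:P - 1)); last by ring.
by rewrite e subrr mulr0.
Qed.

(** The sum of the displacements is [- S +i* Y], and half the sum of squares [E] is replaced by
    [- Q]; the last term is the price of this replacement. *)
Lemma row_expand (S Y xp yp xm ym Q : R) (E W a e p q : R[i]) :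
  S * complex.Re (W * a) + Y * complex.Im (W * a) + Q * complex.Re (W * e)
  + (xp * complex.Re (W * p) + yp * complex.Im (W * p))
  + (xm * complex.Re (W * q) + ym * complex.Im (W * q))
  <= - complex.Re (W * ((- S +i* Y) * a + E / 2 * e + (- xp +i* yp) * p + (- xm +i* ym) * q))
     + cmod (W * e) * cmod (E / 2 + Q%:C).
Proof.
have -> : W * ((- S +i* Y) * a + E / 2 * e + (- xp +i* yp) * p + (- xm +i* ym) * q) =
   (- S +i* Y) * (W * a) - Q%:C * (W * e) + (- xp +i* yp) * (W * p)
   + (- xm +i* ym) * (W * q) + (W * e) * (E / 2 + Q%:C) by ring.
move: (W * a) (W * e) (W * p) (W * q) (E / 2) => {a e p q E W} a e p q E.
have : complex.Re (e * (E + Q%:C)) <= cmod e * cmod (E + Q%:C).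
  by rewrite -cmodM (le_trans (ler_norm _)) // Re_le_cmod.
have r4 x y : complex.Re (x + y) = complex.Re x + complex.Re y :> R by rewrite raddfD.
have rN x : complex.Re (- x) = - complex.Re x :> R by rewrite raddfN.
by rewrite !(r4, rN) !Re_cartM; lra.
Qed.

Ltac keep_section :=
  clear -hwp dH0 dPa dPe dPB dPC H00 Pa0 Pe0 PB0 PC0 cH0 cPa cPe cPB cPC cK m M.

Lemma disk_tangent z : cmod (1 + z) <= 1 -> cmod z ^+ 2 <= 2 * - complex.Re z.
Proof.
move=> h; have : cmod (1 + z) ^+ 2 <= 1 by rewrite exprn_ile1.
by rewrite !cmod_sqr; case: z {h} => a b /=; lra.
Qed.

Lemma Re_sum s : complex.Re (\sum_(y <- s) y) = \sum_(y <- s) complex.Re y.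
Proof. by apply: (big_morph (@complex.Re R)) => [x y|] //; rewrite raddfD. Qed.

(** A bound that improves itself: the rows hold up to [2 * Wt * tau * N], [lp_bound] then returns
    [N <= C * (2 * Wt * tau) * N], and [tau] makes the factor at most a third. Hence [N = 0], so
    every [y] vanishes; since [0 < m] there is at least one, and [cmod (1 + y) < 1] fails for it. *)
Lemma local_rigid (t : nat -> R[i]) :
  let A i := contactA (t i) in let E i := contactE (t i) in let X i := contactX (t i) in
  let mn := minor (fun i => contactZ (t i)) (fun i => contactV (t i)) in
  let comb (F : nat -> R) := mn 1%N 2%N * F 0%N + mn 2%N 0%N * F 1%N + mn 0%N 1%N * F 2%N in
  (forall i, (i < 3)%N -> H0.[t i] = 0 /\ (k_base m wp wm).[t i] != 0) ->
  0 < mn 1%N 2%N -> 0 < mn 2%N 0%N -> 0 < mn 0%N 1%N ->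
  0 < comb A -> 0 < comb A + comb E -> 0 < comb X ->
  minor (fun i => contactI (t i)) (fun i => contactU (t i)) 0 1 != 0 -> (0 < m)%N ->
  rigid m M wp t.
Proof.
move=> A E X mn comb Ht l1 l2 l3 kA kAE kX hIU m0.
have [C C0 HC] := lp_bound (fun i => contactk (t i)) l1 l2 l3 kA kAE kX hIU.
pose Wt : R := 1 + \sum_(i < 3) (cmod (weight (t i)) + cmod (weight (t i) * Pe.[t i])).
have Wle i : (i < 3)%N -> cmod (weight (t i)) + cmod (weight (t i) * Pe.[t i]) <= Wt.
  move=> hi; rewrite /Wt (bigD1 (Ordinal hi)) //= addrCA lerDl addr_ge0 //.
  by apply: sumr_ge0 => j _; rewrite addr_ge0.
have Wt0 : 0 < Wt.
  by rewrite /Wt ltr_wpDr //; apply: sumr_ge0 => j _; rewrite addr_ge0.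
pose tau : R := (6 * (C + 1) * Wt)^-1.
have C1 : 0 < C + 1 by rewrite ltr_wpDl.
have tau0 : 0 < tau by rewrite invr_gt0 !mulr_gt0.
have tauE : C * (2 * Wt * tau) <= 1 / 3.
  have e : tau * (6 * (C + 1) * Wt) = 1.
    by rewrite mulVf // gt_eqF // !mulr_gt0.
  have : 0 < tau * Wt by rewrite mulr_gt0.
  by move: e; keep_section; lra.
have CwpM z : (k_base m wp wm).[z^*] = ((k_base m wp wm).[z])^* by apply: cK.
pose RS (e : R) z := forall (N : R) s dp dm (H : {poly R[i]}) t',
  size s = m -> (forall y, y \in s -> cmod y <= e) ->
  cmod dp <= e -> cmod dm <= e -> N <= e ->
  cmod (\sum_(y <- s) y) + cmod dp + cmod dm <= N ->
  \sum_(y <- s) cmod y ^+ 2 <= 2 * N ->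
  H^`() = k_crit wp wm s dp dm -> H.[0] = 0 -> H.[t'] = 0 -> cmod (t' - z) <= e ->
  cmod ((k_base m wp wm).[z] * (t' - z)
        - ((\sum_(y <- s) y) * Pa.[z] + (\sum_(y <- s) y ^+ 2) / 2 * Pe.[z]
           + dp * (wp *: PB - PC).[z] + dm * (wm *: PB - PC).[z])) <= tau * N.
have RSw (e e' : R) z : e' <= e -> RS e z -> RS e' z.
  move=> ee h N s dp dm H t' sm Hs hp hm hN h1 h2 h3 h4 h5 h6; apply: (h N s dp dm H t') => //.
  - by move=> y ys; apply: le_trans (Hs y ys) ee.
  - exact: le_trans hp ee.
  - exact: le_trans hm ee.
  - exact: le_trans hN ee.
  - exact: le_trans h6 ee.
have get z : H0.[z] = 0 -> (k_base m wp wm).[z] != 0 -> exists2 e, 0 < e & RS e z.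
  move=> hz kz.
  have Pp0 : (wp *: PB - PC).[0] = 0 by rewrite !hornerE PB0 PC0 mulr0 subr0.
  have Pm0 : (wm *: PB - PC).[0] = 0 by rewrite !hornerE PB0 PC0 mulr0 subr0.
  exact: (root_shift hwp cwm dH0 dPa dPe dPp dPm H00 Pa0 Pe0 Pp0 Pm0 hz kz tau0).
have get2 i : (i < 3)%N -> exists2 e, 0 < e & RS e (t i) /\ RS e (t i)^*.
  move=> hi; have [hz kz] := Ht i hi.
  have [e1 e10 he1] := get _ hz kz.
  have [|| e2 e20 he2] := get (t i)^*.
  - by rewrite cH0 hz conjc0.
  - by rewrite cK conjc_eq0.
  exists (Num.min e1 e2); first by rewrite lt_min e10.
  by split; [apply: RSw he1 | apply: RSw he2]; rewrite ge_min lexx ?orbT.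
have [e0 e00 [he0 he0']] := get2 0%N isT.
have [e1 e10 [he1 he1']] := get2 1%N isT.
have [e2 e20 [he2 he2']] := get2 2%N isT.
pose e := Num.min tau (Num.min e0 (Num.min e1 e2)).
have ep : 0 < e by rewrite /e !lt_min tau0 e00 e10 e20.
have etau : e <= tau by rewrite ge_min lexx.
have RSe i z : (i < 3)%N -> z = t i \/ z = (t i)^* -> RS e z.
  have h0 : e <= e0 by rewrite /e !ge_min lexx ?orbT.
  have h1 : e <= e1 by rewrite /e !ge_min lexx ?orbT.
  have h2 : e <= e2 by rewrite /e !ge_min lexx ?orbT.
  by case: i => [|[|[|//]]] _ [->|->];
    (exact: RSw h0 _ || exact: RSw h1 _ || exact: RSw h2 _).
(* The [m] displacements in the sum, [dp], [dm] and [M' - M] contribute at most [eps] each, so that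
   [N <= e]. *)
pose eps := e / (m%:R + 3).
have m3 : 1 <= m%:R + 3 :> R by rewrite ler_wpDl //; lra.
have m3p : 0 < m%:R + 3 :> R by apply: lt_le_trans m3.
have epsE : eps * (m%:R + 3) = e by rewrite /eps divfK // gt_eqF.
have eps0 : 0 < eps by rewrite divr_gt0.
have epse : eps <= e by rewrite -epsE ler_peMr // ltW.
exists eps => // M' s dp dm H sm Hs hdp cdp hdm cdm hM dH Hz Hroots.
set D := \sum_(y <- s) y.
pose N := `|M' - M| + cmod D + cmod dp + cmod dm.
have Hs1 y : y \in s -> cmod y <= eps by move=> /Hs[].
have Hs2 y : y \in s -> cmod y ^+ 2 <= 2 * - complex.Re y.
  by move=> /Hs[_ /ltW]; apply: disk_tangent.
have hDeps : cmod D <= m%:R * eps.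
  apply: le_trans (cmod_sum _ _ _) _; rewrite big_seq.
  apply: (@le_trans _ _ (\sum_(y <- s | y \in s) eps)).
    by apply: ler_sum => y; apply: Hs1.
  by rewrite -big_seq big_const_seq count_predT sm iter_addr_0 mulr_natl.
have N0 : 0 <= N by rewrite /N !addr_ge0.
have hNe : N <= e by rewrite -epsE /N; move: hDeps hdp hdm hM; keep_section; lra.
pose S := - complex.Re D; pose Y := complex.Im D.
have SE : S = \sum_(y <- s) - complex.Re y by rewrite /S /D Re_sum sumrN.
have hSD : S <= cmod D by rewrite /S (le_trans _ (Re_le_cmod D)) // -normrN ler_norm.
have hDN : cmod D <= N by rewrite /N; move: (normr_ge0 (M' - M)) (cmod_ge0 dp) (cmod_ge0 dm); keep_section; lra.
have sq2 : \sum_(y <- s) cmod y ^+ 2 <= 2 * S.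
  by rewrite SE mulr_sumr big_seq [X in _ <= X]big_seq; apply: ler_sum => y; apply: Hs2.
(* The factor one half gives [Q <= S], because the squares sum to at most [2 * S]. *)
pose Q := (\sum_(y <- s) complex.Im y ^+ 2) / 2.
have Q0 : 0 <= Q by rewrite divr_ge0 // sumr_ge0 // => y _; rewrite sqr_ge0.
have QS : Q <= S.
  rewrite /Q ler_pdivrMr // mulrC (le_trans _ sq2) //; apply: ler_sum => y _.
  by rewrite cmod_sqr lerDr sqr_ge0.
have S0 : 0 <= S by apply: le_trans QS.
pose EE := \sum_(y <- s) y ^+ 2.
(* [y ^+ 2] plus the squared imaginary part is [Re y * (Re y + 2 i Im y)]: the first factors sum in
   modulus to [S], and the second is at most [3 * eps]. *)
have hEQ : cmod (EE / 2 + Q%:C) <= 2 * tau * N.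
  have -> : EE / 2 + Q%:C = (\sum_(y <- s) (y ^+ 2 + (complex.Im y ^+ 2)%:C)) / 2.
    rewrite big_split /= mulrDl; congr (_ + _); rewrite /Q rmorphM /= rmorph_sum /=.
    by rewrite fmorphV rmorph_nat.
  rewrite cmodM cmodV cmod_nat ler_pdivrMr //.
  apply: le_trans (cmod_sum _ _ _) _.
  apply: (@le_trans _ _ (3 * eps * S)).
    rewrite SE mulr_sumr big_seq [X in _ <= X]big_seq; apply: ler_sum => y ys.
    have xy : 0 <= - complex.Re y.
      by have := Hs2 y ys; have := exprn_ge0 2 (cmod_ge0 y); keep_section; lra.
    have -> : y ^+ 2 + (complex.Im y ^+ 2)%:C =
        - (- complex.Re y)%:C * (complex.Re y +i* (2 * complex.Im y)).
      by case: (y) => a b; apply/eqP; rewrite eq_complex /=; apply/andP; split; apply/eqP; ring.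
    rewrite cmodM cmodN cmodR ger0_norm // mulrC ler_wpM2r //.
    apply: le_trans (cmod_le_ReIm _) _ => /=; rewrite normrM (ger0_norm (ler0n _ 2)).
    have := Re_le_cmod y; have := Im_le_cmod y; have := Hs1 y ys; keep_section; lra.
  have : eps * S <= tau * N by apply: ler_pM (ltW eps0) S0 (le_trans epse etau) (le_trans hSD hDN).
  have : 0 <= tau * N by rewrite mulr_ge0 // ltW.
  keep_section; lra.
have cart z : z = (- - complex.Re z) +i* complex.Im z by rewrite opprK; case: z.
have hxp : 0 <= - complex.Re dp by have := disk_tangent cdp; have := exprn_ge0 2 (cmod_ge0 dp); keep_section; lra.
have hxm : 0 <= - complex.Re dm by have := disk_tangent cdm; have := exprn_ge0 2 (cmod_ge0 dm); keep_section; lra.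
have hQS : 0 <= Q <= S by rewrite Q0.
have ND : cmod D + cmod dp + cmod dm <= N by rewrite /N; have := normr_ge0 (M' - M); keep_section; lra.
have sqN : \sum_(y <- s) cmod y ^+ 2 <= 2 * N by move: sq2 (le_trans hSD hDN); keep_section; lra.
have rows i z W : (i < 3)%N -> z = t i \/ z = (t i)^* ->
    W = ((M%:C - z) * (k_base m wp wm).[z])^* ->
    contactZ (t i) * (M' - M)
    + (S * complex.Re (W * Pa.[z]) + Y * complex.Im (W * Pa.[z])
       + Q * complex.Re (W * Pe.[z])
       + (- complex.Re dp * complex.Re (W * (wp *: PB - PC).[z])
          + complex.Im dp * complex.Im (W * (wp *: PB - PC).[z]))
       + (- complex.Re dm * complex.Re (W * (wm *: PB - PC).[z])
          + complex.Im dm * complex.Im (W * (wm *: PB - PC).[z]))) <= 2 * Wt * tau * N.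
  move=> hi hz hW; have [t' [Ht' ht' hd]] := Hroots i z hi hz.
  have [cM cW cWe] : [/\ cmod (M%:C - t i) = cmod (M%:C - z),
     cmod W = cmod (weight (t i)) & cmod (W * Pe.[z]) = cmod (weight (t i) * Pe.[t i])].
    rewrite hW /weight; case: hz => ->; first by [].
    have eC : M%:C - (t i)^* = (M%:C - t i)^* by rewrite conj_realB.
    by rewrite CwpM cPe eC -rmorphM /= conjcK !cmodM !cmodJ cmodM.
  have cZ : contactZ (t i) = cmod (k_base m wp wm).[z] ^+ 2 * complex.Re (M%:C - z).
    rewrite /contactZ; case: hz => -> //; rewrite CwpM cmodJ; congr (_ * _).
    by case: (t i).
  have shift := RSe i z hi hz N s dp dm H t' sm
    (fun y ys => le_trans (Hs1 y ys) epse) (le_trans hdp epse) (le_trans hdm epse) hNe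
    ND sqN dH Hz Ht' (le_trans ht' epse).
  rewrite cM in hd; have r1 := disk_row hd hW shift.
  have r2 := row_expand S Y (- complex.Re dp) (complex.Im dp) (- complex.Re dm) (complex.Im dm)
    Q EE W Pa.[z] Pe.[z] (wp *: PB - PC).[z] (wm *: PB - PC).[z].
  rewrite -!cart in r2.
  have r3 : cmod W * (tau * N) + cmod (W * Pe.[z]) * cmod (EE / 2 + Q%:C) <= 2 * Wt * tau * N.
    rewrite cW cWe.
    apply: (@le_trans _ _ ((cmod (weight (t i)) + cmod (weight (t i) * Pe.[t i])) * (2 * tau * N))).
      rewrite mulrDl lerD // ler_wpM2l // -mulrA ler_peMl ?ler1n //.
      by rewrite mulr_ge0 // ltW.
    rewrite (_ : 2 * Wt * tau * N = Wt * (2 * tau * N)); last by ring.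
    by rewrite ler_wpM2r ?Wle // !mulr_ge0 // ltW.
  by rewrite cZ; move: r1 r2 r3; rewrite -/D -/EE; keep_section; lra.
(* Passing to the conjugate point reverses the sign of the imaginary parts and exchanges the roles
   of [wp] and [wm], so the two rows of a contact point are [F + G] and [F - G]. *)
unshelve epose proof (HC (M' - M) S Q (- complex.Re dp) (- complex.Re dm) (complex.Im dp) (complex.Im dm) Y
  (2 * Wt * tau * N) hQS hxp hxm _) as final.
  move=> i hi.
  have r1 := rows i (t i) _ hi (or_introl erefl) erefl.
  have := rows i (t i)^* _ hi (or_intror erefl) erefl.
  have cside w : (w *: PB - PC).[(t i)^*] = ((w^* *: PB - PC).[t i])^*.
    rewrite !hornerE cPB cPC; case: w (PB.[_]) (PC.[_]) => a b [c d] [e' f].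
    by apply/eqP; rewrite eq_complex /=; apply/andP; split; apply/eqP; ring.
  have cMt : M%:C - (t i)^* = (M%:C - t i)^* by rewrite conj_realB.
  have cWt : ((M%:C - (t i)^*) * (k_base m wp wm).[(t i)^*])^* = (weight (t i))^*.
    by rewrite cMt CwpM -rmorphM.
  have cwm : wm^* = wp by exact: conjcK.
  have c1 : (wp *: PB - PC).[(t i)^*] = ((wm *: PB - PC).[t i])^* by exact: cside.
  have c2 : (wm *: PB - PC).[(t i)^*] = ((wp *: PB - PC).[t i])^* by rewrite cside /wm; congr ((_ *: _ - _).[_]^*); exact: conjcK.
  rewrite c1 c2 cWt cPa cPe -!rmorphM.
  have RJ z : complex.Re z^* = complex.Re z by case: z.
  have IJ z : complex.Im z^* = - complex.Im z by case: z.
  rewrite !(RJ, IJ).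
  move: r1; rewrite -/(weight (t i)) /A /E /X /contactA /contactE /contactX /contactV /contactI /contactU /contactk.
  have sp : (wp *: PB - PC).[t i] = sideval (t i) + (0 +i* complex.Im wp) * PB.[t i].
    by rewrite /sideval !hornerE; case: (wp) (PB.[_]) (PC.[_]) => a b [c d] [e' f];
       apply/eqP; rewrite eq_complex /=; apply/andP; split; apply/eqP; ring.
  have sm' : (wm *: PB - PC).[t i] = sideval (t i) - (0 +i* complex.Im wp) * PB.[t i].
    by rewrite /sideval !hornerE /wm; case: (wp) (PB.[_]) (PC.[_]) => a b [c d] [e' f];
       apply/eqP; rewrite eq_complex /=; apply/andP; split; apply/eqP; ring.
  rewrite sp sm'.
  have expR W u v : complex.Re (W * (u + (0 +i* complex.Im wp) * v)) =
      complex.Re (W * u) - complex.Im wp * complex.Im (W * v).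
    by case: W u v => [a b] [a1 b1] [a2 b2] /=; ring.
  have expI W u v : complex.Im (W * (u + (0 +i* complex.Im wp) * v)) =
      complex.Im (W * u) + complex.Im wp * complex.Re (W * v).
    by case: W u v => [a b] [a1 b1] [a2 b2] /=; ring.
  have expR' W u v : complex.Re (W * (u - (0 +i* complex.Im wp) * v)) =
      complex.Re (W * u) + complex.Im wp * complex.Im (W * v).
    by case: W u v => [a b] [a1 b1] [a2 b2] /=; ring.
  have expI' W u v : complex.Im (W * (u - (0 +i* complex.Im wp) * v)) =
      complex.Im (W * u) - complex.Im wp * complex.Re (W * v).
    by case: W u v => [a b] [a1 b1] [a2 b2] /=; ring.
  rewrite !expR !expR' !expI !expI'.
  by keep_section; move=> r1 r2; split; lra.
have NN : N <= C * (2 * Wt * tau) * N.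
  rewrite -mulrA; apply: le_trans final; rewrite /N.
  have := cmod_le_ReIm D; have := cmod_le_ReIm dp; have := cmod_le_ReIm dm.
  by rewrite -(ger0_norm hxp) -(ger0_norm hxm) -(ger0_norm S0) /S !normrN -/Y; keep_section; lra.
have N00 : N = 0.
  apply/le_anti/andP; split => //.
  have : C * (2 * Wt * tau) * N <= 1 / 3 * N by rewrite ler_wpM2r.
  by move: NN; keep_section; lra.
have S00 : \sum_(y <- s) cmod y ^+ 2 <= 0 by move: sqN; rewrite N00 mulr0.
case: (s) sm Hs S00 => [/= m00|y s' _ Hy]; first by rewrite -m00 in m0.
rewrite big_cons => hy.
have y0 : cmod y = 0.
  have h1 : 0 <= \sum_(y <- s') cmod y ^+ 2 by apply: sumr_ge0 => z _; rewrite exprn_ge0.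
  apply/eqP; rewrite -sqrf_eq0 eq_le exprn_ge0 // andbT; move: hy h1; keep_section; lra.
have [_] := Hy y (mem_head _ _).
by move/eqP: y0; rewrite cmod_eq0 => /eqP->; rewrite addr0 cmod1 ltxx.
Qed.

End LocalRigidity.

(** * Continuity of the roots in the coefficients, and the Gauss-Lucas theorem for the unit disk *)

Section RootContinuity.
Variable R : realType.
Implicit Types (x y z : R[i]) (p q : {poly R[i]}) (s a b : seq R[i]).

Definition of_roots s : {poly R[i]} := \prod_(z <- s) ('X - z%:P).

Lemma of_roots_cons z s : of_roots (z :: s) = ('X - z%:P) * of_roots s.
Proof. by rewrite /of_roots big_cons. Qed.

Lemma of_roots_perm s1 s2 : perm_eq s1 s2 -> of_roots s1 = of_roots s2.
Proof. by move=> h; apply: perm_big. Qed.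

Lemma horner_of_roots s x : (of_roots s).[x] = \prod_(z <- s) (x - z).
Proof. by rewrite /of_roots horner_prod; apply: eq_bigr => z _; rewrite !hornerE. Qed.

Lemma root_of_roots s x : root (of_roots s) x = (x \in s).
Proof. by rewrite /of_roots root_prod_XsubC. Qed.

Lemma monic_of_roots s : of_roots s \is monic.
Proof. exact: monic_prod_XsubC. Qed.

Lemma size_of_roots s : size (of_roots s) = (size s).+1.
Proof. by rewrite /of_roots size_prod_XsubC. Qed.

Lemma pnorm_XsubC z : pnorm 1 ('X - z%:P) <= 1 + cmod z.
Proof.
by apply: pnormD_le; rewrite ?lexx // ?pnormX // pnormN pnormC.
Qed.

Lemma pnorm_of_roots (c : R) s : 0 <= c -> (forall z, z \in s -> cmod z <= c) ->
  pnorm 1 (of_roots s) <= (1 + c) ^+ size s.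
Proof.
move=> c0; elim: s => [|z s IH] H; first by rewrite /of_roots big_nil pnormC cmod1.
rewrite of_roots_cons /= exprS; apply: pnormM_le => //.
  by apply: le_trans (pnorm_XsubC z) _; rewrite lerD2l H ?mem_head.
by apply: IH => y ys; apply: H; rewrite inE ys orbT.
Qed.

(** Factors are exchanged one at a time. The entries of [b] have modulus at most [2], so the
    remaining product has norm at most [3 ^+ k]. *)
Lemma of_roots_near k : exists2 C : R, 0 <= C & forall eps a b, size a = k ->
  0 <= eps -> eps <= 1 -> (forall z, z \in a -> cmod z <= 1) ->
  all2 (fun z w => cmod (w - z) <= eps) a b ->
  pnorm 1 (of_roots a - of_roots b) <= C * eps.
Proof.
elim: k => [|k [C C0 IH]].
  exists 0 => // eps a b /size0nil-> _ _ _; case: b => // _.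
  by rewrite subrr pnorm0 mul0r.
exists (2 * C + 3 ^+ k) => [|eps [//|x a] [//|y b] /= [sa] e0 e1 Ha /andP[hxy hab]].
  by rewrite addr_ge0 ?mulr_ge0 ?exprn_ge0.
have Ha' z : z \in a -> cmod z <= 1 by move=> za; apply: Ha; rewrite inE za orbT.
have hb : (forall z, z \in b -> cmod z <= 2) /\ size b = k.
  rewrite -sa; elim: a b hab Ha' {sa Ha} => [|u a IHa] [|v b] //= /andP[h1 h2] Ha.
  have [|h3 h4] := IHa b h2.
    by move=> z za; apply: Ha; rewrite inE za orbT.
  split; last by rewrite h4.
  move=> z; rewrite inE => /orP[/eqP->|/h3//].
  rewrite -[v](subrK u) (le_trans (cmodD _ _)) //.
  have := Ha u (mem_head _ _); lra.
rewrite !of_roots_cons.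
have -> : ('X - x%:P) * of_roots a - ('X - y%:P) * of_roots b
   = ('X - x%:P) * (of_roots a - of_roots b) + (y - x) *: of_roots b.
  by rewrite -mul_polyC polyCB; ring.
rewrite (mulrDl (2 * C)); apply: pnormD_le; rewrite ?lexx //.
  rewrite -(mulrA 2); apply: pnormM_le; rewrite ?lexx //; last exact: IH.
  by apply: le_trans (pnorm_XsubC x) _; have := Ha x (mem_head _ _); lra.
rewrite mulrC; apply: pnormZ_le => //.
have [h1 <-] := hb.
rewrite (_ : 3 = 1 + 2); last by ring.
exact: pnorm_of_roots.
Qed.

Lemma coef_le_pnorm p i : cmod p`_i <= pnorm 1 p.
Proof.
case: (ltnP i (size p)) => hi; last by rewrite nth_default // cmod0 pnorm_ge0 ?lexx.
rewrite /pnorm (bigD1 (Ordinal hi)) //= expr1n mulr1 lerDl; apply: sumr_ge0 => j _.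
by rewrite expr1n mulr1.
Qed.

Lemma pnorm_le_coef p (c : R) : (forall i, cmod p`_i <= c) -> pnorm 1 p <= (size p)%:R * c.
Proof.
move=> h; rewrite mulr_natl -[X in _ *+ X]card_ord -sumr_const /pnorm.
by apply: ler_sum => i _; rewrite expr1n mulr1.
Qed.

Lemma pnorm_deriv p : pnorm 1 p^`() <= (size p)%:R ^+ 2 * pnorm 1 p.
Proof.
have P0 : 0 <= pnorm 1 p by apply: pnorm_ge0.
rewrite expr2 -mulrA; apply: le_trans (@pnorm_le_coef _ ((size p)%:R * pnorm 1 p) _) _.
  move=> i; rewrite coef_deriv -[_ *+ _]mulr_natr cmodM cmod_nat mulrC.
  case: (ltnP i.+1 (size p)) => hi.
    by apply: ler_pM => //; [rewrite ler_nat ltnW | exact: coef_le_pnorm].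
  by rewrite nth_default // cmod0 mulr0 mulr_ge0.
rewrite ler_wpM2r ?mulr_ge0 // ler_nat.
by case: (posnP (size p)) => [/eqP|/lt0n_neq0]; rewrite size_poly_eq0;
  [move/eqP->; rewrite deriv0 size_poly0 | move/lt_size_deriv/ltnW].
Qed.

(** Synthetic division from the top coefficient, with [s] the product: the coefficient of index [j]
    of [p] is that of index [j.+1] of [s] plus [x] times that of index [j.+1] of [p]. As
    [cmod x <= 1], the contributions add up instead of growing geometrically. *)
Lemma pnorm_divX p x : cmod x <= 1 ->
  pnorm 1 p <= (size p)%:R ^+ 2 * pnorm 1 (p * ('X - x%:P)).
Proof.
move=> hx; set s := p * _.
have P0 : 0 <= pnorm 1 s by apply: pnorm_ge0.
have H d j : (size p <= j + d)%N -> cmod p`_j <= d%:R * pnorm 1 s.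
  elim: d j => [|d IH] j; first by rewrite addn0 => hj; rewrite nth_default // cmod0 mul0r.
  rewrite addnS -addSn => /IH hj.
  have -> : p`_j = s`_j.+1 + x * p`_j.+1.
    by rewrite /s mulrBr coefB coefMX /= coefMC [x * _]mulrC subrK.
  rewrite (le_trans (cmodD _ _)) // -natr1 mulrDl mul1r addrC lerD ?coef_le_pnorm //.
  rewrite cmodM (le_trans _ hj) // ler_piMl //.
rewrite expr2 -mulrA; apply: pnorm_le_coef => i; apply: H; exact: leq_addl.
Qed.

Lemma size_deriv_complex p : size p^`() = (size p).-1.
Proof.
have [->|p0] := eqVneq p 0; first by rewrite deriv0 size_poly0.
have := lt_size_deriv p0; case E : (size p) => [//|[|j]] h.
  by apply/eqP; rewrite -leqn0 -ltnS.
apply/eqP; rewrite eqn_leq -ltnS h /= ltnNge; apply/negP => hj.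
have : p^`()`_j = 0 by rewrite nth_default.
rewrite coef_deriv => /eqP; rewrite mulrn_eq0 /= => /eqP hl.
by move: p0; rewrite -lead_coef_eq0 lead_coefE E hl eqxx.
Qed.

(** Induction on the degree. At a root [x] of the first polynomial the second one is small, so one
    of its roots [y] is near [x]; the two are matched and divided out, and [pnorm_divX] keeps the
    quotients close. *)
Lemma root_continuity k (eta : R) : 0 < eta -> exists2 eps : R, 0 < eps & forall a b,
  size a = k -> size b = k ->
  (forall z, z \in a -> cmod z <= 1) -> (forall z, z \in b -> cmod z <= 1) ->
  pnorm 1 (of_roots a - of_roots b) <= eps ->
  exists2 b', perm_eq b' b & all2 (fun z w => cmod (w - z) <= eta) a b'.
Proof.
move=> eta0; elim: k => [|k [eps eps0 IH]].
  by exists 1 => // a b /size0nil-> /size0nil-> _ _ _; exists [::].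
pose K : R := k.+1%:R ^+ 2; have K0 : 0 < K by rewrite exprn_gt0.
pose e1 := Num.min eta (eps / (2 * K * 2 ^+ k)).
have e10 : 0 < e1 by rewrite lt_min eta0 divr_gt0 // !mulr_gt0 ?exprn_gt0.
have e11 : e1 <= eta by rewrite ge_min lexx.
have e12 : K * (e1 * 2 ^+ k) <= eps / 2.
  have : e1 <= eps / (2 * K * 2 ^+ k) by rewrite ge_min lexx orbT.
  by rewrite ler_pdivlMr ?mulr_gt0 ?exprn_gt0 //; lra.
(* The first entry forces one of the [k.+1] distances to [x] to be at most [e1]. The second leaves
   half of the inductive [eps] for the difference of the polynomials, the other half paying for
   [y - x]. *)
exists (Num.min (e1 ^+ k.+1) (eps / (2 * K))).
  by rewrite lt_min exprn_gt0 //= divr_gt0 // mulr_gt0.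
move=> [//|x a] b /= [sa] sb Ha Hb hab.
have hx : cmod x <= 1 by apply: Ha; rewrite mem_head.
have [y yb hy] : exists2 y, y \in b & cmod (y - x) <= e1.
  apply: contrapT => hno.
  have hall y : y \in b -> e1 < cmod (x - y).
    by move=> yb; rewrite ltNge; apply/negP => h; apply: hno; exists y; rewrite // cmod_distC.
  have h1 : cmod (of_roots b).[x] <= e1 ^+ k.+1.
    have := @cmod_horner _ 1 (lexx _) (of_roots (x :: a) - of_roots b) x hx.
    rewrite hornerD hornerN horner_of_roots big_cons subrr mul0r sub0r cmodN => h.
    by rewrite (le_trans h) // (le_trans hab) // ge_min lexx.
  have h2 : e1 ^+ k.+1 < cmod (of_roots b).[x].
    rewrite horner_of_roots cmod_prod -sb.
    case: (b) sb hall => [//|y b'] _ {hab Hb hno h1}.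
    elim: b' y => [|y' b' IHb] y hall.
      by rewrite big_cons big_nil mulr1 expr1; apply: hall; rewrite mem_head.
    rewrite big_cons /= exprS ltr_pM ?exprn_ge0 ?(ltW e10) //.
      by apply: hall; rewrite mem_head.
    by apply: IHb => z zb; apply: hall; rewrite inE zb orbT.
  by move: (lt_le_trans h2 h1); rewrite ltxx.
have pb := perm_to_rem yb.
have sb' : size (rem y b) = k by rewrite size_rem // sb.
have Ha' z : z \in a -> cmod z <= 1 by move=> za; apply: Ha; rewrite inE za orbT.
have Hb' z : z \in rem y b -> cmod z <= 1 by move=> zb; apply: Hb; apply: mem_rem zb.
have [|b' pb' hb'] := IH a (rem y b) sa sb' Ha' Hb'.
  set p := of_roots a - of_roots (rem y b).
  have sp : (size p <= k.+1)%N.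
    by rewrite (leq_trans (size_polyD _ _)) // size_polyN !size_of_roots sa sb' maxnn.
  have E : p * ('X - x%:P) = (of_roots (x :: a) - of_roots b) - (y - x) *: of_roots (rem y b).
    by rewrite (of_roots_perm pb) !of_roots_cons /p -mul_polyC polyCB; ring.
  have := pnorm_divX p hx; rewrite E => h; apply: le_trans h _.
  apply: (@le_trans _ _ (K * (eps / (2 * K) + e1 * 2 ^+ k))).
    apply: ler_pM; rewrite ?exprn_ge0 ?pnorm_ge0 ?lexx //.
      by rewrite /K lerXn2r ?nnegrE // ler_nat.
    apply: pnormD_le; rewrite ?lexx //; first by rewrite (le_trans hab) // ge_min lexx orbT.
    rewrite pnormN; apply: pnormZ_le; rewrite ?lexx //.
    by rewrite -sb' (_ : 2 = 1 + 1) //; apply: pnorm_of_roots.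
  rewrite mulrDr; have -> : K * (eps / (2 * K)) = eps / 2.
    by have := lt0r_neq0 K0; move: (K) => L hL; field.
  lra.
exists (y :: b').
  by rewrite perm_sym (perm_trans pb) // perm_cons perm_sym.
by rewrite /= (le_trans hy).
Qed.

Lemma deriv_of_roots s x : x \notin s ->
  (of_roots s)^`().[x] = (of_roots s).[x] * \sum_(z <- s) (x - z)^-1.
Proof.
elim: s => [|z s IH]; first by rewrite /of_roots !big_nil -polyC1 derivC horner0 mulr0.
rewrite inE negb_or => /andP[xz /IH IHx].
rewrite of_roots_cons derivM derivXsubC mul1r hornerD !hornerM IHx big_cons !hornerXsubC.
have h : x - z != 0 by rewrite subr_eq0.
by move: (\sum_(_ <- _) _) (_.[x]) (x - z) h => S P d hd; field.
Qed.

(** When [cmod x > 1], every [x / (x - z)] has positive real part, twice this real part being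
    [1 + (|x|^2 - |z|^2) / |x - z|^2]; hence the logarithmic derivative cannot vanish at [x]. *)
Lemma gauss_lucas_disk s x : (0 < size s)%N -> (forall z, z \in s -> cmod z <= 1) ->
  root (of_roots s)^`() x -> cmod x <= 1.
Proof.
move=> s0 Hs; apply: contraLR; rewrite -ltNge => hx.
have xs : x \notin s by apply/negP => /Hs; rewrite leNgt hx.
rewrite rootE deriv_of_roots // mulf_eq0 -rootE root_of_roots (negbTE xs) /=.
apply/eqP => h; have : x * \sum_(z <- s) (x - z)^-1 = 0 by rewrite h mulr0.
rewrite mulr_sumr => {}h.
have pos z : z \in s -> 0 < complex.Re (x * (x - z)^-1).
  move=> zs; have zx : x - z != 0 by rewrite subr_eq0; apply: contraNneq xs => ->.
  have n0 : 0 < cmod (x - z) by rewrite cmod_gt0.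
  have E : 2 * complex.Re (x * (x - z)^-1) = 1 + (cmod x ^+ 2 - cmod z ^+ 2) / cmod (x - z) ^+ 2.
    rewrite -[X in _ = X + _](@divff _ (cmod (x - z) ^+ 2)) ?expf_neq0 ?gt_eqF // -mulrDl.
    apply: (canRL (mulfK _)); first by rewrite expf_neq0 ?gt_eqF.
    have -> : x * (x - z)^-1 = (x * (x - z)^*) * ((cmod (x - z) ^+ 2)^-1)%:C.
      have -> : ((cmod (x - z) ^+ 2)^-1)%:C = ((x - z) * (x - z)^*)^-1.
        rewrite fmorphV; congr (_^-1); rewrite cmod_sqr; case: (x - z) => u v.
        by apply/eqP; rewrite eq_complex /=; apply/andP; split; apply/eqP; ring.
      have cx : (x - z)^* != 0 by rewrite conjc_eq0.
      by field; apply/andP; split=> //; rewrite -rmorphB; exact: cx.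
    rewrite [complex.Re _](_ : _ = complex.Re (x * (x - z)^*) / cmod (x - z) ^+ 2); last first.
      by case: (x * _) => u v /=; rewrite mulr0 subr0.
    rewrite mulrA divfK ?expf_neq0 ?gt_eqF // !cmod_sqr; case: (x) (z) => u v [u' v'] /=; ring.
  have : 0 <= (cmod x ^+ 2 - cmod z ^+ 2) / cmod (x - z) ^+ 2.
    rewrite divr_ge0 ?exprn_ge0 // subr_ge0 lerXn2r ?nnegrE //.
    exact: le_trans (Hs z zs) (ltW hx).
  by move: E; lra.
have : 0 < complex.Re (\sum_(z <- s) x * (x - z)^-1).
  rewrite (big_morph (@complex.Re R) (id1 := 0) (op1 := +%R)) //; last first.
    by move=> u v; rewrite raddfD.
  case: (s) s0 pos => [//|z s'] _ pos; rewrite big_cons big_seq.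
  apply: ltr_pwDl; first by apply: pos; rewrite mem_head.
  by apply: sumr_ge0 => y ys; rewrite ltW // pos // inE ys orbT.
by rewrite h ltxx.
Qed.

End RootContinuity.

(** * Bounds for the minimum and maximum of a list *)

Section SeqExtrema.
Variable R : realType.
Implicit Types (s : seq R) (x c : R).

Lemma seq_min_le s x : x \in s -> seq_min s <= x.
Proof.
rewrite /seq_min; move: (head 0 s) => d; elim: s => [//|y s IH].
rewrite inE big_cons ge_min => /orP[/eqP->|/IH->]; by rewrite ?lexx ?orbT.
Qed.

Lemma le_seq_max s x : x \in s -> x <= seq_max s.
Proof.
rewrite /seq_max; move: (head 0 s) => d; elim: s => [//|y s IH].
rewrite inE big_cons le_max => /orP[/eqP->|/IH->]; by rewrite ?lexx ?orbT.
Qed.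

Lemma le_seq_min s c : (0 < size s)%N -> (forall x, x \in s -> c <= x) -> c <= seq_min s.
Proof.
move=> s0 H; rewrite /seq_min big_seq; apply: (big_ind (fun x => c <= x)) => //.
- by case: s s0 H => [//|y s] _ H; apply: H; rewrite mem_head.
- by move=> x y hx hy; rewrite le_min hx.
Qed.

Lemma seq_max_le s c : 0 <= c -> (forall x, x \in s -> x <= c) -> seq_max s <= c.
Proof.
move=> c0 H; rewrite /seq_max big_seq; apply: (big_ind (fun x => x <= c)) => //.
- by case: s H => [//|y s] H; apply: H; rewrite mem_head.
- by move=> x y hx hy; rewrite ge_max hx.
Qed.

End SeqExtrema.

(** * From rigidity to local extremality *)

Section Criterion.
Variable R : realType.
Implicit Types (x y z w : R[i]) (P Q : {poly R[i]}).

Lemma proots_eq P : P = lead_coef P *: of_roots (proots P).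
Proof. exact: (svalP (closed_field_poly_normal P)). Qed.

Lemma mem_proots P z : P != 0 -> (z \in proots P) = root P z.
Proof. by move=> P0; rewrite {2}(proots_eq P) rootZ ?lead_coef_eq0 // root_of_roots. Qed.

Lemma size_proots P : P != 0 -> size P = (size (proots P)).+1.
Proof. by move=> P0; rewrite {1}(proots_eq P) size_scale ?lead_coef_eq0 // size_of_roots. Qed.

Lemma all2_mem_l (T1 T2 : eqType) (r : T1 -> T2 -> bool) (s : seq T1) (t : seq T2) (x : T1) :
  all2 r s t -> x \in s -> exists2 y, y \in t & r x y.
Proof.
elim: s t => [//|a s IH] [//|b t] /= /andP[h1 h2]; rewrite inE => /orP[/eqP->|/(IH _ h2)[y yt ry]].
  by exists b; rewrite // mem_head.
by exists y; rewrite // inE yt orbT.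
Qed.

Lemma all2_mem_r (T1 T2 : eqType) (r : T1 -> T2 -> bool) (s : seq T1) (t : seq T2) (y : T2) :
  all2 r s t -> y \in t -> exists2 x, x \in s & r x y.
Proof.
elim: s t => [|a s IH] [//|b t] //= /andP[h1 h2]; rewrite inE => /orP[/eqP->|/(IH _ h2)[x xt rx]].
  by exists a; rewrite // mem_head.
by exists x; rewrite // inE xt orbT.
Qed.

Lemma all2_sub (T1 T2 : Type) (r r' : T1 -> T2 -> bool) (s : seq T1) (t : seq T2) :
  (forall (x : T1) (y : T2), r x y -> r' x y) -> all2 r s t -> all2 r' s t.
Proof. by move=> h; elim: s t => [|a s IH] [|b t] //= /andP[/h-> /IH->]. Qed.

(* The rotation [kap] takes [z] to [`|z|], hence nearly fixes everything when [z] is near [beta]. *)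
Lemma rotation_near (beta e : R) z kap x x' : 0 < beta -> e <= beta / 2 ->
  kap * z = (cmod z)%:C -> cmod z <= 1 -> cmod x' <= 1 ->
  cmod (z - beta%:C) <= e -> cmod (x' - x) <= e ->
  [/\ cmod kap = 1, `|cmod z - beta| <= e
    & cmod (kap * (z - x') - (beta%:C - x)) <= (8 / beta + 2) * e].
Proof.
move=> b0 eb hk z1 x1 hz hx.
have e0 : 0 <= e by apply: le_trans hz.
have zb : `|cmod z - beta| <= e.
  have h1 := cmod_triB z beta%:C; have h2 := cmod_triB beta%:C z.
  rewrite cmodR (ger0_norm (ltW b0)) in h1 h2; rewrite (cmod_distC _ z) in h2.
  by rewrite ler_norml; apply/andP; split; move: h1 h2 hz; clear; lra.
have zb2 : beta / 2 <= cmod z.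
  by move: zb; rewrite ler_norml => /andP[]; move: eb; clear; lra.
have zp : 0 < cmod z by apply: lt_le_trans zb2; rewrite divr_gt0.
have z0 : z != 0 by rewrite -cmod_gt0.
have k1 : cmod kap = 1.
  apply: (mulIf (lt0r_neq0 zp)); rewrite -cmodM hk cmodR mul1r ger0_norm //.
split => //.
(* From [|kap - 1| * |z| <= 2 * e] and [|z| >= beta / 2]. The factor [z - x'] of modulus at most [2]
   then gives [8 / beta], and the two displacements give the remaining [2]. *)
have hk1 : cmod (kap - 1) <= 4 / beta * e.
  have : cmod (kap - 1) * cmod z <= 2 * e.
    rewrite -cmodM mulrBl mul1r hk.
    have -> : (cmod z)%:C - z = (cmod z - beta)%:C - (z - beta%:C) by rewrite rmorphB /=; ring.
    by rewrite (le_trans (cmodB _ _)) // cmodR; move: zb hz; clear; lra.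
  rewrite mulrAC ler_pdivlMr // => h.
  have : cmod (kap - 1) * (beta / 2) <= 2 * e by apply: le_trans h; rewrite ler_wpM2l.
  by clear; lra.
have -> : kap * (z - x') - (beta%:C - x) =
   (kap - 1) * (z - x') + ((z - beta%:C) - (x' - x)) by ring.
apply: le_trans (cmodD _ _) _; rewrite cmodM.
have h2 : cmod (z - x') <= 2 by rewrite (le_trans (cmodB _ _)) //; move: z1 x1; clear; lra.
have h3 : cmod (kap - 1) * cmod (z - x') <= 4 / beta * e * 2 by apply: ler_pM.
have h4 : cmod ((z - beta%:C) - (x' - x)) <= e + e.
  by rewrite (le_trans (cmodB _ _)) // lerD.
have -> : (8 / beta + 2) * e = 4 / beta * e * 2 + (e + e) by ring.
exact: lerD.
Qed.

Lemma finite_gap (T : eqType) (l : seq T) (p : T -> Prop) (F : T -> R -> Prop) :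
  (forall (x : T) (e e' : R), F x e -> e' <= e -> F x e') ->
  (forall x : T, x \in l -> p x -> exists2 e : R, 0 < e & F x e) ->
  exists2 e : R, 0 < e & forall x : T, x \in l -> p x -> F x e.
Proof.
move=> mono; elim: l => [|x l IH] H; first by exists 1.
have [|e e0 he] := IH; first by move=> y yl; apply: H; rewrite inE yl orbT.
case: (EM (p x)) => px; last first.
  by exists e => // y; rewrite inE => /orP[/eqP->|/he].
have [e' e'0 he'] := H x (mem_head _ _) px.
exists (Num.min e e'); first by rewrite lt_min e0.
move=> y; rewrite inE => /orP[/eqP-> _|yl py].
  by apply: mono he' _; rewrite ge_min lexx orbT.
by apply: mono (he y yl py) _; rewrite ge_min lexx.
Qed.

(* In the coordinate [t = kap (z - x) / s] centred at the root [z] of [Q], the derivative of [Q]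
   becomes a product of factors [1 - t / eta]. *)
Lemma recentred_polynomial Q z (u : R[i]) (l : seq R[i]) (c : R[i]) :
  u != 0 -> c != 0 -> Q^`() = c *: of_roots l -> root Q z -> (forall w, w \in l -> z != w) ->
  exists H : {poly R[i]}, [/\ H^`() = \prod_(w <- l) q_of (u / (z - w)), H.[0] = 0
    & forall t, root Q (z - u * t) -> H.[t] = 0].
Proof.
move=> u0 c0 dQ Qz Hl.
pose k := - u * c * \prod_(w <- l) (z - w).
have P0 : \prod_(w <- l) (z - w) != 0.
  rewrite prodf_seq_neq0; apply/allP => w wl; rewrite subr_eq0; exact: Hl.
have k0 : k != 0 by rewrite /k !mulf_neq0 ?oppr_eq0.
pose v : {poly R[i]} := z%:P - u *: 'X.
have hv t : (Q \Po v).[t] = Q.[z - u * t] by rewrite horner_comp !hornerE.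
exists (k^-1 *: (Q \Po v)); split.
- rewrite derivZ deriv_comp dQ /v derivB derivC sub0r derivZ derivX.
  rewrite comp_polyZ /of_roots rmorph_prod /=.
  have E : \prod_(w <- l) (('X - w%:P) \Po (z%:P - u *: 'X)) =
     (\prod_(w <- l) (z - w))%:P * \prod_(w <- l) q_of (u / (z - w)).
    rewrite rmorph_prod /= -big_split /= big_seq [RHS]big_seq; apply: eq_bigr => w wl.
    rewrite comp_polyB comp_polyX comp_polyC /q_of.
    have zw : z - w != 0 by rewrite subr_eq0 Hl.
    rewrite -!mul_polyC mulrBr mulr1 mulrA -polyCM mulrCA divff // mulr1 polyCB; ring.
  rewrite E -!mul_polyC mulr1.
  have kk : k^-1%:P * (- u%:P * c%:P * (\prod_(w <- l) (z - w))%:P) = 1 :> {poly R[i]}.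
    by rewrite -polyCN -!polyCM -/k mulVf.
  rewrite -[RHS]mul1r -kk; ring.
- by rewrite hornerZ hv mulr0 subr0 (rootP Qz) mulr0.
- by move=> t /rootP h; rewrite hornerZ hv h mulr0.
Qed.

Lemma lead_deriv_of_roots (a l : seq R[i]) (k : R[i]) : size a = (size l).+1 ->
  (of_roots a)^`() = k *: of_roots l -> k = (size a)%:R.
Proof.
move=> sa /(congr1 (fun p : {poly R[i]} => p`_(size l))).
rewrite coef_deriv coefZ.
have lc (b : seq R[i]) : (of_roots b)`_(size b) = 1.
  by have /monicP := monic_of_roots b; rewrite lead_coefE size_of_roots.
by rewrite -{1}sa !lc mulr1 sa => <-.
Qed.

Variables (m : nat) (M s : R) (wp : R[i]) (t : nat -> R[i]).
Let wm := wp^*.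
Let beta : R := s * M.
(** The point with coordinate [wm] comes first because perturbations are measured on reciprocals:
    its reciprocal is [wp], the one perturbed by [dp]. *)
Let cs : seq R[i] :=
  (beta%:C - s%:C * wm) :: (beta%:C - s%:C * wp) :: nseq m (beta%:C - s%:C).
Let n := m.+3.
Variables (P : {poly R[i]}) (c : R[i]).
Hypotheses (s0 : 0 < s) (M0 : 0 < M) (hwp : cmod wp = 1) (c0 : c != 0).
Hypotheses (hP : disk_poly n P) (dP : P^`() = c *: of_roots cs) (Pb : root P beta%:C).
Hypothesis Pother : forall z, root P z -> z != beta%:C ->
  exists2 y, y \in cs & cmod (z - y) < s.
Hypothesis Pt : forall i z, (i < 3)%N -> z = t i \/ z = (t i)^* ->
  root P (beta%:C - s%:C * z).
Hypothesis tM : forall i, (i < 3)%N -> s * cmod (M%:C - t i) = 1.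
Hypothesis Prigid : rigid m M wp t.

Ltac keep_hyps := clear -c0 hP dP Pb Pother Pt tM Prigid s0 M0 hwp.

Lemma sC_neq0 : s%:C != 0 :> R[i].
Proof. by rewrite -cmod_eq0 cmodR normr_eq0 gt_eqF. Qed.

Lemma beta_gt0 : 0 < beta. Proof. exact: mulr_gt0. Qed.

Lemma disk_poly_neq0 Q : disk_poly n Q -> Q != 0.
Proof. by case=> sQ _; rewrite -size_poly_gt0 sQ. Qed.

Lemma disk_poly_deriv Q : disk_poly n Q ->
  [/\ Q^`() != 0, size (proots Q) = n, size (proots Q^`()) = m.+2
    & forall w, w \in proots Q^`() -> cmod w <= 1].
Proof.
move=> hQ; have Q0 := disk_poly_neq0 hQ; have [sQ dQ] := hQ.
have sQ' : size Q^`() = n by rewrite size_deriv_complex sQ.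
have Q'0 : Q^`() != 0 by rewrite -size_poly_gt0 sQ'.
have sp : size (proots Q) = n by apply/eqP; rewrite -eqSS -size_proots // sQ.
split=> //; first by apply/eqP; rewrite -eqSS -size_proots // sQ'.
move=> w; rewrite mem_proots // (proots_eq Q) derivZ rootZ ?lead_coef_eq0 // => h.
apply: gauss_lucas_disk h; first by rewrite sp.
by move=> z; rewrite mem_proots //; apply: dQ.
Qed.

Lemma sendov_ge : s <= sendov_d P.
Proof.
have P0 := disk_poly_neq0 hP; have [P'0 _ sP' _] := disk_poly_deriv hP.
apply: (@le_trans _ _ (seq_min [seq cmod (beta%:C - w) | w <- proots P^`()])); last first.
  by apply: le_seq_max; apply/mapP; exists beta%:C; rewrite // mem_proots.
apply: le_seq_min; first by rewrite size_map sP'.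
move=> x /mapP[w]; rewrite mem_proots // dP rootZ // root_of_roots !inE mem_nseq => hw ->.
have {hw} [k k1 ->] : exists2 k, cmod k = 1 & w = beta%:C - s%:C * k.
  case/or3P: hw => [/eqP->|/eqP->|/andP[_ /eqP->]]; [exists wm|exists wp|exists 1] => //.
  - by rewrite cmodJ.
  - by rewrite cmod1.
  - by rewrite mulr1.
by rewrite opprB addrCA subrr addr0 cmodM k1 mulr1 cmodR ger0_norm // ltW.
Qed.

(** As [s <= d(P)], each zero of [Q] only needs a critical point within [s]. Near a zero of [P]
    other than [beta], the strict inequality in [Pother] survives the perturbation. A zero near
    [beta] without such a critical point yields, after rotation and recentring, a configuration that
    [Prigid] excludes. *)
Lemma extremal_criterion : locally_extremal n P.
Proof.
have P0 := disk_poly_neq0 hP; have [P'0 sP sP' Pw] := disk_poly_deriv hP.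
have b0 := beta_gt0; set rs := proots P in sP.
have rs1 z : z \in rs -> cmod z <= 1 by rewrite mem_proots //; case: hP => _; apply.
have cs1 z : z \in cs -> cmod z <= 1.
  by move=> zc; apply: Pw; rewrite mem_proots // dP rootZ // root_of_roots.
(* The margin [2 * e] pays once for the displacement of the zero and once for that of the critical
   point. *)
have [e1 e10 gap] : exists2 e : R, 0 < e & forall z : R[i], z \in rs -> z != beta%:C ->
    exists2 y, y \in cs & cmod (z - y) + 2 * e <= s.
  apply: (@finite_gap _ rs (fun z => z != beta%:C)
    (fun z e => exists2 y, y \in cs & cmod (z - y) + 2 * e <= s)).
    by move=> x e e' [y yc h] ee; exists y => //; apply: le_trans h; rewrite lerD2l ler_wpM2l.
  move=> z; rewrite mem_proots // => zP zb; have [y yc h] := Pother zP zb.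
  exists ((s - cmod (z - y)) / 2); first by rewrite divr_gt0 // subr_gt0.
  by exists y => //; move: h; keep_hyps; lra.
have [er er0 Hrig] := Prigid.
pose B : R := 8 / beta + 2.
have B1 : 1 <= B.
  have : 0 < 8 / beta by rewrite divr_gt0.
  by rewrite /B; keep_hyps; lra.
have B0 : 0 < B by apply: lt_le_trans B1.
(* The second bound keeps the perturbed zero away from [0], so that it can be rotated; the third
   makes displacements at most [er] after rotation, which costs a factor [B], and division by
   [s]. *)
pose e := Num.min e1 (Num.min (beta / 2) (er * s / B)).
have e0 : 0 < e by rewrite /e !lt_min e10 !divr_gt0 // mulr_gt0.
have ee1 : e <= e1 by rewrite ge_min lexx.
have eb : e <= beta / 2 by rewrite !ge_min lexx ?orbT.
have eB : B * e <= er * s by rewrite mulrC -ler_pdivlMr // !ge_min lexx ?orbT.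
have [ec ec0 Hcont] := root_continuity m.+2 e0.
have [Cn Cn0 Hnear] := of_roots_near R n.
pose K : R := n.+1%:R ^+ 2 * (Cn + 1).
have K0 : 0 < K by rewrite mulr_gt0 ?exprn_gt0 // ltr_wpDl.
exists (Num.min e (Num.min 1 (ec / K))).
  by rewrite lt_min e0 /= lt_min ltr01 divr_gt0.
set eps := Num.min _ _ => Q hQ [tt ptt htt].
have epe : eps <= e by rewrite ge_min lexx.
have ep1 : eps <= 1 by rewrite !ge_min lexx ?orbT.
have epK : eps * K <= ec by rewrite -ler_pdivlMr // !ge_min lexx ?orbT.
have ep0 : 0 < eps by rewrite lt_min e0 /= lt_min ltr01 divr_gt0.
have Q0 := disk_poly_neq0 hQ; have [Q'0 sQ sQ' Qw] := disk_poly_deriv hQ.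
set qs := proots Q^`() in sQ' Qw.
have Qtt z : (z \in tt) = root Q z by rewrite (perm_mem ptt) mem_proots.
have stt : size tt = n by rewrite (perm_size ptt).
have dQ : Q^`() = lead_coef Q^`() *: of_roots qs by exact: proots_eq.
(* Close zeros give close coefficients, hence close derivatives. Normalised, the derivatives are [n]
   times the monic polynomials of the critical points, and dividing by [n] only lowers the norm. *)
have near : pnorm 1 (of_roots cs - of_roots qs) <= ec.
  have h1 : (of_roots rs)^`() = n%:R *: of_roots cs.
    have lP : lead_coef P != 0 by rewrite lead_coef_eq0.
    have E : (of_roots rs)^`() = (c / lead_coef P) *: of_roots cs.
      apply: (scalerI lP); rewrite -derivZ -(proots_eq P) dP scalerA mulrCA divff //.
      by rewrite mulr1.
    rewrite E; congr (_ *: _); rewrite -sP; apply: lead_deriv_of_roots E.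
    by rewrite sP /= size_nseq.
  have h2 : (of_roots tt)^`() = n%:R *: of_roots qs.
    have lQ : lead_coef Q != 0 by rewrite lead_coef_eq0.
    have E : (of_roots tt)^`() = (lead_coef Q^`() / lead_coef Q) *: of_roots qs.
      apply: (scalerI lQ); rewrite -derivZ (of_roots_perm ptt) -(proots_eq Q) scalerA mulrCA.
      by rewrite divff // mulr1.
    rewrite E; congr (_ *: _); rewrite -stt; apply: lead_deriv_of_roots E.
    by rewrite stt sQ'.
  have P1 p : 0 <= pnorm (1 : R) p by apply: pnorm_ge0.
  apply: (@le_trans _ _ (pnorm 1 ((of_roots rs - of_roots tt)^`()))).
    rewrite derivB h1 h2 -scalerBr pnormZ cmod_nat ler_peMl //.
    by rewrite ler1n.
  apply: le_trans (pnorm_deriv _) _; apply: le_trans epK.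
  rewrite (_ : eps * K = n.+1%:R ^+ 2 * ((Cn + 1) * eps)); last by rewrite /K; ring.
  apply: ler_pM; rewrite ?exprn_ge0 //.
    rewrite lerXn2r ?nnegrE // ler_nat (leq_trans (size_polyD _ _)) //.
    by rewrite size_polyN !size_of_roots sP stt maxnn.
  have := Hnear eps rs tt sP (ltW ep0) ep1 rs1; rewrite mulrDl mul1r => h.
  apply: le_trans (h _) _; last by rewrite lerDl ltW.
  by apply: all2_sub htt => x y; apply: ltW.
have scs : size cs = m.+2 by rewrite /= size_nseq.
have [cs' pcs hcs] := Hcont cs qs scs sQ' cs1 Qw near.
have Hcs' w : w \in cs' -> w \in qs by rewrite (perm_mem pcs).
apply: le_trans sendov_ge; apply: seq_max_le (ltW s0) _ => _ /mapP[z' zQ ->].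
have Qz : root Q z' by rewrite -mem_proots.
have [z zrs hz] : exists2 z, z \in rs & cmod (z' - z) < eps.
  by apply: all2_mem_r htt _; rewrite Qtt.
have hz' : cmod (z' - z) <= e by apply: le_trans (ltW hz) epe.
have [zb|zb] := eqVneq z beta%:C; last first.
  have [y yc hy] := gap z zrs zb.
  have [w wc hw] := all2_mem_l hcs yc.
  apply: le_trans (seq_min_le (map_f _ (Hcs' w wc))) _.
  apply: le_trans (cmod_dist3 _ z _) _; apply: le_trans hy.
  have := cmod_dist3 z y w; rewrite (cmod_distC y w).
  by move: hz' hw ee1; keep_hyps; lra.
rewrite zb in hz hz' => {zb zrs z}.
rewrite leNgt; apply/negP => hmin.
have far w : w \in qs -> s < cmod (z' - w).
  by move=> wq; apply: lt_le_trans hmin _; apply/seq_min_le/map_f.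
have z1 : cmod z' <= 1 by case: hQ => _; apply.
have zpos : z' != 0.
  rewrite -cmod_gt0; have h1 := cmod_triB beta%:C z'.
  rewrite cmodR (ger0_norm (ltW b0)) (cmod_distC _ z') in h1.
  by move: h1 hz' eb b0; keep_hyps; lra.
pose kap := (cmod z')%:C / z'.
have hk : kap * z' = (cmod z')%:C by rewrite divfK.
have rot x x' := @rotation_near beta e z' kap x x' b0 eb hk z1.
have [k1 zbe _] := rot 0 0 ltac:(by rewrite cmod0) hz' ltac:(by rewrite subrr cmod0 ltW).
have k0 : kap != 0 by rewrite -cmod_eq0 k1 oner_eq0.
(* In the coordinate [kap * (z' - x) / s], a critical point [w] has reciprocal [u / (z' - w)], whose
   modulus [s / cmod (z' - w)] is less than [1] by [far]. *)
pose u := s%:C / kap.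
have u0 : u != 0 by rewrite mulf_neq0 ?sC_neq0 // invr_eq0.
have dQ' : Q^`() = lead_coef Q^`() *: of_roots cs' by rewrite (of_roots_perm pcs).
have lQ' : lead_coef Q^`() != 0 by rewrite lead_coef_eq0.
have [w wc|H [dH Hz Hr]] := recentred_polynomial u0 lQ' dQ' Qz.
  by rewrite -subr_eq0 -cmod_gt0; apply: lt_trans (far w (Hcs' w wc)).
have crit eta0 w : cmod eta0 = 1 -> w \in cs' ->
    cmod (w - (beta%:C - s%:C * eta0)) <= e ->
    cmod (eta0 * (u / (z' - w)) - 1) <= er /\ cmod (1 + (eta0 * (u / (z' - w)) - 1)) < 1.
  move=> h1 wc hw; have hf := far w (Hcs' w wc).
  have zw : 0 < cmod (z' - w) by apply: lt_trans hf.
  have zw0 : z' - w != 0 by rewrite -cmod_gt0.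
  have w1 : cmod w <= 1 by apply: Qw (Hcs' w wc).
  have [_ _] := rot _ w w1 hz' hw; rewrite subKr -/B => hh.
  split; last first.
    rewrite addrCA subrr addr0 !cmodM !cmodV k1 h1 mul1r invr1 mulr1 cmodR ger0_norm ?ltW //.
    by rewrite ltr_pdivrMr // mul1r.
  have -> : eta0 * (u / (z' - w)) - 1 = - (kap * (z' - w) - s%:C * eta0) / (kap * (z' - w)).
    by rewrite /u; field; rewrite k0 zw0.
  rewrite cmodM cmodN cmodV cmodM k1 mul1r ler_pdivrMr //.
  apply: le_trans hh _; apply: le_trans eB _; rewrite ler_pM2l //; exact: ltW.
case: cs' pcs hcs Hcs' dQ' dH crit => [//|c1 [|c2 as']] pcs //=.
  by rewrite andbF.
move=> /and3P[hc1 hc2 has] Hcs' _ dH crit.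
have wpm : wp * wm = 1 by apply: wpwm.
have sas : size as' = m by have := perm_size pcs; rewrite sQ' => -[].
have [dp1 dp2] := crit wm c1 ltac:(by rewrite cmodJ) (mem_head _ _) hc1.
have [dm1 dm2] := crit wp c2 hwp ltac:(by rewrite !inE eqxx orbT) hc2.
(* The center [0] of the unit disk has coordinate [kap * z' / s], which the rotation has made the
   real number [cmod z' / s]. *)
apply: (Hrig (cmod z' / s) [seq u / (z' - w) - 1 | w <- as'] _ _ H _ _ dp1 (ltW dp2)
  dm1 (ltW dm2)).
- by rewrite size_map.
- move=> _ /mapP[w wa ->].
  have [|||h1 h2] := crit 1 w.
  + by rewrite cmod1.
  + by rewrite !inE wa !orbT.
  + have [y] := all2_mem_r has wa.
    by rewrite mem_nseq => /andP[_ /eqP->]; rewrite mulr1.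
  by rewrite mul1r in h1 h2.
- have -> : M = beta / s by rewrite /beta mulrC mulKf ?gt_eqF.
  rewrite -mulrBl normrM normfV (gtr0_norm s0) ler_pdivrMr //.
  by apply: le_trans zbe _; apply: le_trans eB; rewrite ler_peMl // ltW.
- rewrite dH !big_cons /k_crit big_map -/wm.
  have E1 : wp * (1 + (wm * (u / (z' - c1)) - 1)) = u / (z' - c1).
    by rewrite addrCA subrr addr0 mulrA wpm mul1r.
  have E2 : wm * (1 + (wp * (u / (z' - c2)) - 1)) = u / (z' - c2).
    by rewrite addrCA subrr addr0 mulrA (mulrC wm) wpm mul1r.
  rewrite E1 E2 mulrA mulrC mulrA; congr (_ * _ * _).
  by apply: eq_bigr => w _; rewrite addrCA subrr addr0.
- exact: Hz.
move=> i y hi hy; have rP := Pt hi hy.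
have [w wt hw] : exists2 w, w \in tt & cmod (w - (beta%:C - s%:C * y)) < eps.
  by apply: all2_mem_l htt _; rewrite mem_proots.
have w1 : cmod w <= 1 by case: hQ => _; apply; rewrite -Qtt.
have [_ _] := rot _ w w1 hz' (le_trans (ltW hw) epe).
rewrite subKr -/B => hh.
exists (kap * (z' - w) / s%:C); split.
- apply: Hr; rewrite -Qtt (_ : _ - _ = w) //.
  by rewrite /u; field; rewrite sC_neq0 k0.
- have -> : kap * (z' - w) / s%:C - y = (kap * (z' - w) - s%:C * y) / s%:C.
    by field; rewrite sC_neq0.
  rewrite cmodM cmodV cmodR (gtr0_norm s0) ler_pdivrMr //.
  exact: le_trans hh eB.
have -> : (cmod z' / s)%:C - kap * (z' - w) / s%:C = kap * w / s%:C.
  by rewrite rmorphM /= fmorphV -hk; field; rewrite sC_neq0.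
rewrite (cmodM (kap * w)) (cmodM kap) k1 mul1r cmodV cmodR (gtr0_norm s0) ler_pdivrMr //.
by rewrite mulrC tM.
Qed.

End Criterion.

(** * Line integrals of polynomials *)

Section LineIntegral.
Variable R : realType.
Implicit Types (p : {poly R}) (P : {poly R[i]}).

Lemma integral01_deriv p :
  \int[lebesgue_measure]_(t in `[0%R, 1%R]) p^`().[t] = p.[1] - p.[0].
Proof.
rewrite /Rintegral (@continuous_FTC2 _ (fun t => p^`().[t]) (fun t => p.[t])) //.
- by apply: continuous_subspaceT => x; exact: continuous_horner.
- split=> [x _| |]; first exact: derivable_horner.
  + by apply: cvg_at_right_filter; exact: continuous_horner.
  + by apply: cvg_at_left_filter; exact: continuous_horner.
- by move=> x _; rewrite derivE.
Qed.

Section Part.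
Variable f : R[i] -> R.
Hypotheses (fD : {morph f : x y / x + y}) (fM : forall z t, f (z * t%:C) = f z * t).

Let f0 : f 0 = 0. Proof. by rewrite -[0](mulr0 (1 : R[i])) fM mulr0. Qed.

(** Here [f] is the real or the imaginary part. On real arguments the part of a complex polynomial
    is a real polynomial, to which the fundamental theorem of calculus applies. *)
Definition part_poly P : {poly R} := \poly_(i < size P) f P`_i.

Lemma coef_part_poly P i : (part_poly P)`_i = f P`_i.
Proof. by rewrite coef_poly; case: ltnP => // h; rewrite nth_default. Qed.

Lemma horner_part_poly P t : (part_poly P).[t] = f P.[t%:C].
Proof.
rewrite horner_poly horner_coef (big_morph f fD f0); apply: eq_bigr => i _.
by rewrite -rmorphXn fM.
Qed.

Lemma deriv_part_poly P : (part_poly P)^`() = part_poly P^`().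
Proof.
apply/polyP => i; rewrite coef_deriv !coef_part_poly coef_deriv.
by rewrite -[in RHS]mulr_natr -(rmorph_nat (real_complex R)) fM mulr_natr.
Qed.

Lemma integral01_part P :
  \int[lebesgue_measure]_(t in `[0%R, 1%R]) f P^`().[t%:C] = f P.[1] - f P.[0].
Proof.
have -> : f P.[1] = (part_poly P).[1] by rewrite horner_part_poly.
have -> : f P.[0] = (part_poly P).[0] by rewrite horner_part_poly.
rewrite -integral01_deriv.
by apply: eq_Rintegral => t _; rewrite deriv_part_poly horner_part_poly.
Qed.

End Part.

Lemma line_integral_deriv P (z0 z1 : R[i]) :
  line_integral (fun w => P^`().[w]) z0 z1 = P.[z1] - P.[z0].
Proof.
pose Q := P \Po (z0%:P + (z1 - z0) *: 'X).
have dQ (t : R) : P^`().[z0 + t%:C * (z1 - z0)] * (z1 - z0) = Q^`().[t%:C].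
  rewrite /Q deriv_comp hornerM horner_comp derivD derivC add0r derivZ derivX.
  by rewrite !hornerE (mulrC t%:C); exact/esym/mulr1.
rewrite /line_integral /integral01.
have part f : \int[lebesgue_measure]_(t in `[0%R, 1%R])
      f (P^`().[z0 + t%:C * (z1 - z0)] * (z1 - z0)) =
    \int[lebesgue_measure]_(t in `[0%R, 1%R]) f Q^`().[t%:C] :> R.
  by apply: eq_Rintegral => t _; rewrite dQ.
rewrite !part !integral01_part ?horner_comp.
- rewrite !(hornerD, hornerC, hornerZ, hornerX) mulr1 mulr0 addr0 [_ + (z1 - z0)]addrC subrK.
  by case: (P.[z1]) (P.[z0]) => a b [a' b'].
- by move=> x y; rewrite raddfD.
- by case=> a b t /=; rewrite mulr0 add0r.
- by move=> x y; rewrite raddfD.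
- by case=> a b t /=; rewrite mulr0 subr0.
Qed.

End LineIntegral.

(** * Explicit primitives in powers of [v = 1 - t] *)

Section Model.
Variable R : realType.
Implicit Types (z v t : R[i]).

(* Throughout, [v = 1 - t]. *)
Definition prim (j : nat) : {poly R[i]} := (j.+1%:R^-1 : R)%:C *: (1 - (1 - 'X) ^+ j.+1).

Definition primv (j : nat) v : R[i] := (j.+1%:R^-1 : R)%:C * (1 - v ^+ j.+1).

Lemma deriv_prim j : (prim j)^`() = (1 - 'X) ^+ j.
Proof.
rewrite /prim derivZ derivB deriv_exp derivB derivX -polyC1 derivC !sub0r polyC1 mulN1r.
rewrite mulNrn opprK -(scaler_nat j.+1 (_ ^+ _)) scalerA.
have -> : (j.+1%:R^-1 : R)%:C * j.+1%:R = 1 :> R[i].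
  by rewrite -(rmorph_nat (real_complex R)) -rmorphM /= mulVf // pnatr_eq0.
by rewrite scale1r.
Qed.

Lemma horner_prim j t : (prim j).[t] = primv j (1 - t).
Proof. by rewrite /prim /primv -polyC1 !(hornerZ, hornerD, hornerN, horner_exp, hornerX, hornerC). Qed.

Lemma primv1 j : primv j 1 = 0.
Proof. by rewrite /primv expr1n subrr mulr0. Qed.

Lemma primvJ j v : primv j v^* = (primv j v)^*.
Proof.
rewrite /primv rmorphM rmorphB rmorphXn rmorph1 /=; congr (_ * _).
by rewrite oppr0.
Qed.

Variables (k : nat) (g : R).
(** In this form the exponents [m.-1] and [m.-2] of [k_a] and [k_e] are true differences; the degree
    is [k + 5]. *)
Let m := k.+2.

Definition cosv : R := (2 + g) / 2.
(** Each [val] function is the integrand of [k_base], [k_a], [k_e], [PB] or [PC] expanded in powers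
    of [v] and integrated termwise from [t = 0]. The coefficients are affine in [g], and the root
    [w] itself does not occur. *)
Definition valF v := primv k.+4 v + g%:C * primv k.+3 v - g%:C * primv k.+2 v.
Definition valA v := - primv k.+4 v + (1 - g)%:C * primv k.+3 v + (2 * g)%:C * primv k.+2 v
  - g%:C * primv k.+1 v.
Definition valE v := primv k.+4 v + (g - 2)%:C * primv k.+3 v + (1 - 3 * g)%:C * primv k.+2 v
  + (3 * g)%:C * primv k.+1 v - g%:C * primv k v.
Definition valB v := primv k.+2 v - primv k.+3 v.
Definition valC v := primv k.+2 v - 2%:C * primv k.+3 v + primv k.+4 v.
Definition valh v := v ^+ m * (v ^+ 2 + g%:C * v - g%:C).

Let cD (p q : R[i]) : conjc (p + q) = conjc p + conjc q. Proof. exact: rmorphD. Qed.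
Let cN (p : R[i]) : conjc (- p) = - conjc p. Proof. exact: rmorphN. Qed.
Let cM (p q : R[i]) : conjc (p * q) = conjc p * conjc q. Proof. exact: rmorphM. Qed.
Let cX (p : R[i]) j : conjc (p ^+ j) = conjc p ^+ j. Proof. exact: rmorphXn. Qed.
Let cE := (cX, cD, cN, cM, conjc_real).

Lemma valFJ v : valF (conjc v) = conjc (valF v).
Proof. by rewrite /valF !primvJ !cE. Qed.

Lemma valAJ v : valA (conjc v) = conjc (valA v).
Proof. by rewrite /valA !primvJ !cE. Qed.

Lemma valEJ v : valE (conjc v) = conjc (valE v).
Proof. by rewrite /valE !primvJ !cE. Qed.

Lemma valBJ v : valB (conjc v) = conjc (valB v).
Proof. by rewrite /valB !primvJ !cE. Qed.

Lemma valCJ v : valC (conjc v) = conjc (valC v).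
Proof. by rewrite /valC !primvJ !cE. Qed.

Lemma valhJ v : valh (conjc v) = conjc (valh v).
Proof. by rewrite /valh !cE. Qed.

Definition polF : {poly R[i]} := prim k.+4 + g%:C *: prim k.+3 - g%:C *: prim k.+2.
Definition polA : {poly R[i]} := - prim k.+4 + (1 - g)%:C *: prim k.+3
  + (2 * g)%:C *: prim k.+2 - g%:C *: prim k.+1.
Definition polE : {poly R[i]} := prim k.+4 + (g - 2)%:C *: prim k.+3
  + (1 - 3 * g)%:C *: prim k.+2 + (3 * g)%:C *: prim k.+1 - g%:C *: prim k.
Definition polB : {poly R[i]} := prim k.+2 - prim k.+3.
Definition polC : {poly R[i]} := prim k.+2 - 2%:C *: prim k.+3 + prim k.+4.

Definition hornerP := (horner_prim, hornerD, hornerN, hornerZ).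

Definition derivP := (deriv_prim, derivB, derivD, derivN, derivZ).

Lemma horner_polF t : polF.[t] = valF (1 - t).
Proof. by rewrite /polF !hornerP. Qed.
Lemma horner_polA t : polA.[t] = valA (1 - t).
Proof. by rewrite /polA !hornerP. Qed.
Lemma horner_polE t : polE.[t] = valE (1 - t).
Proof. by rewrite /polE !hornerP. Qed.
Lemma horner_polB t : polB.[t] = valB (1 - t).
Proof. by rewrite /polB !hornerP. Qed.
Lemma horner_polC t : polC.[t] = valC (1 - t).
Proof. by rewrite /polC !hornerP. Qed.

Hypotheses (g_gt : -4 < g) (g_lt : g < 0).
Definition wp : R[i] := cosv +i* Num.sqrt (1 - cosv ^+ 2).

Lemma sin2_gt0 : 0 < 1 - cosv ^+ 2.
Proof. by rewrite /cosv; move: g_gt g_lt => h1 h2; nra. Qed.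

Lemma cmod_wp : cmod wp = 1.
Proof.
have h : cmod wp ^+ 2 = 1 by rewrite cmod_sqr /= sqr_sqrtr ?ltW ?sin2_gt0 //; ring.
by apply/eqP; rewrite -sqrp_eq1 ?cmod_ge0 // h.
Qed.

(** The factor [1 - (2 + g) t + t ^+ 2] written in [v = 1 - t]: only the sum and the product of the
    conjugate points enter, so the irrational imaginary part of [wp] drops out. *)
Lemma q_prod : q_of wp * q_of wp^* = (1 - 'X) ^+ 2 + g%:C *: (1 - 'X) - g%:C%:P :> {poly R[i]}.
Proof.
have e : wp + wp^* = 2 + g%:C.
  by apply/eqP; rewrite eq_complex /= /cosv; apply/andP; split; apply/eqP; [field|ring].
have e2 : wp * wp^* = 1 by apply: wpwm; exact: cmod_wp.
have -> : q_of wp * q_of wp^* = 1 - (wp + wp^*) *: 'X + (wp * wp^*) *: 'X ^+ 2.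
  by rewrite /q_of -!mul_polyC polyCM polyCD; ring.
by rewrite e e2 scale1r scalerDl -!mul_polyC; ring.
Qed.

Ltac ring_k := rewrite !exprS; move: ((1 - 'X) ^+ k) => w; ring.

Lemma dpolF : polF^`() = k_base m wp wp^*.
Proof.
rewrite /k_base -mulrA q_prod /polF !derivP -!mul_polyC /m; ring_k.
Qed.

Lemma dpolA : polA^`() = k_a m wp wp^*.
Proof.
rewrite /k_a -mulrA q_prod /polA !derivP.
rewrite -!mul_polyC /m /= ; ring_k.
Qed.

Lemma dpolE : polE^`() = k_e m wp wp^*.
Proof.
rewrite /k_e -mulrA q_prod /polE !derivP.
rewrite -!mul_polyC /m /= ; ring_k.
Qed.

Lemma dpolB : polB^`() = 'X * (1 - 'X) ^+ m.
Proof. by rewrite /polB !derivP /m; ring_k. Qed.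

Lemma dpolC : polC^`() = 'X ^+ 2 * (1 - 'X) ^+ m.
Proof.
by rewrite /polC !derivP -!mul_polyC /m; ring_k.
Qed.

Lemma horner_k_base t : (k_base m wp wp^*).[t] = valh (1 - t).
Proof.
rewrite /k_base -mulrA q_prod /valh hornerM horner_exp !(hornerD, hornerN, hornerZ, hornerC).
by rewrite horner_exp !(hornerD, hornerN, hornerX, hornerC).
Qed.

End Model.

(** Returns from [t] to [z]: with [a = beta - s], this supplies the coefficients of the quadratic
    factor in the theorem as real expressions in [a], [g] and [s]. *)
Lemma quadratic_factor (R : realType) (a g s : R) (y w : R[i]) :
  w + conjc w = 2 + g%:C -> w * conjc w = 1 ->
  y ^+ 2 + (g * s - 2 * a)%:C * y + (a ^+ 2 - g * s * a - g * s ^+ 2)%:C =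
  (y - ((a + s)%:C - s%:C * conjc w)) * (y - ((a + s)%:C - s%:C * w)).
Proof.
move=> e e2; rewrite !(rmorphB, rmorphD, rmorphM, rmorphXn) /= !rmorph1.
transitivity ((y - a%:C) ^+ 2 - 2 * s%:C * (y - a%:C) + s%:C ^+ 2
  + s%:C * (y - a%:C - s%:C) * (2 + g%:C) + s%:C ^+ 2 * 1); first by ring.
by rewrite -e -[X in _ + s%:C ^+ 2 * X]e2; ring.
Qed.

(** * The extremal polynomial from certified strict inequalities *)

Section Certificate.
Variable R : realType.
Implicit Types (z v t : R[i]).
Variables (k : nat) (g M K : R) (v : nat -> R[i]).
Let m := k.+2.
Let n := m.+3.

Definition valW (v : R[i]) : R[i] := ((M%:C - 1 + v) * valh k g v)^*.
Definition valS (v : R[i]) : R[i] := (cosv g)%:C * valB k v - valC k v.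
Definition rowZ v := cmod (valh k g v) ^+ 2 * complex.Re (M%:C - 1 + v).
Definition rowB v := complex.Re (valW v * valB k v).
Definition rowA v := complex.Re (valW v * valA k g v).
Definition rowE v := complex.Re (valW v * valE k g v).
Definition rowX v := complex.Re (valW v * valS v).
Definition rowI v := complex.Im (valW v * valA k g v).
Definition rowU v := complex.Im (valW v * valS v).

(** The minors of [local_rigid] carry an extra factor [Im w], positive and common to all of them.
    Leaving it out changes no sign and keeps the square root away from the numerical checks. *)
Definition lam (i j : nat) := minor (fun l => rowZ (v l)) (fun l => rowB (v l)) i j.
Definition lam_comb (F : R[i] -> R) :=
  lam 1 2 * F (v 0%N) + lam 2 0 * F (v 1%N) + lam 0 1 * F (v 2%N).

(* [t = 1 - v] is at distance less than [1] from one of [1], [wp g], [(wp g)^*]. *)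
Definition near_crit (v : R[i]) :=
  cmod v < 1 \/ (cmod (1 - v) ^+ 2 - (2 + g) * complex.Re (1 - v)) ^+ 2
                < complex.Im v ^+ 2 * (4 - (2 + g) ^+ 2).

Hypotheses (g_gt : -4 < g) (g_lt : g < 0) (M0 : 0 < M) (K0 : 0 < K).
Hypothesis contact : forall i, (i < 3)%N -> [/\ valF k g (v i) = 0, valh k g (v i) != 0
  & cmod (1 - v i) ^+ 2 = 2 * M * complex.Re (1 - v i) + K].
Hypothesis all_roots : forall y, valF k g y = 0 ->
  cmod (1 - y) ^+ 2 <= 2 * M * complex.Re (1 - y) + K /\ (y != 1 -> near_crit y).
Hypotheses (lam0 : 0 < lam 1 2) (lam1 : 0 < lam 2 0) (lam2 : 0 < lam 0 1).
Hypotheses (kapA : 0 < lam_comb rowA) (kapAE : 0 < lam_comb rowA + lam_comb rowE)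
  (kapX : 0 < lam_comb rowX).
Hypothesis anti : rowI (v 0%N) * rowU (v 1%N) - rowI (v 1%N) * rowU (v 0%N) != 0.

Let w := wp g.
Let t i := 1 - v i.
(** The curve [|t|^2 = 2 * M * Re t + K] is the circle of center [M] and this radius; it is the
    image of the unit circle, whence the scale [s]. *)
Let rho := Num.sqrt (M ^+ 2 + K).
Let s := rho^-1.
Let beta : R := s * M.
Let a := beta - s.

Lemma rho_gt0 : 0 < rho.
Proof. by rewrite /rho sqrtr_gt0 addr_gt0 // exprn_gt0. Qed.

Lemma s_gt0 : 0 < s. Proof. by rewrite /s invr_gt0 rho_gt0. Qed.

Lemma beta_bounds : 0 < beta < 1.
Proof.
rewrite /beta mulr_gt0 ?s_gt0 //= /s mulrC ltr_pdivrMr ?rho_gt0 // mul1r.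
by rewrite -(ltr_pXn2r (n := 2)) ?nnegrE ?(ltW rho_gt0) ?ltW // sqr_sqrtr ?addr_ge0 ?sqr_ge0 ?ltW // ltrDl.
Qed.

Lemma dist_sqr (y : R[i]) :
  cmod (M%:C - y) ^+ 2 = M ^+ 2 - 2 * M * complex.Re y + cmod y ^+ 2.
Proof. by rewrite !cmod_sqr; case: y => p q /=; ring. Qed.

Lemma rho_sqr : rho ^+ 2 = M ^+ 2 + K.
Proof. by rewrite sqr_sqrtr // addr_ge0 ?sqr_ge0 // ltW. Qed.

Lemma root_rigid : rigid m M w t.
Proof.
have wg := cmod_wp g_gt g_lt.
have cp (p : {poly R[i]}) q : (forall y, p.[y] = q (1 - y)) ->
    (forall y, q y^* = (q y)^*) -> conj_equiv p.
  by move=> hp hq y; rewrite !hp -hq rmorphB rmorph1.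
have cF : conj_equiv (polF k g) by apply: (cp _ _ (horner_polF k g)) => y; apply: valFJ.
have cA : conj_equiv (polA k g) by apply: (cp _ _ (horner_polA k g)) => y; apply: valAJ.
have cE : conj_equiv (polE k g) by apply: (cp _ _ (horner_polE k g)) => y; apply: valEJ.
have cB : conj_equiv (polB R k) by apply: (cp _ _ (horner_polB k)) => y; apply: valBJ.
have cC : conj_equiv (polC R k) by apply: (cp _ _ (horner_polC k)) => y; apply: valCJ.
have cK : conj_equiv (k_base m w w^*).
  by apply: (cp _ _ (horner_k_base k g_gt g_lt)) => y; apply: valhJ.
have z0 (p : {poly R[i]}) q : (forall y, p.[y] = q (1 - y)) -> q 1 = 0 -> p.[0] = 0.
  by move=> hp hq; rewrite hp subr0.
have F0 : (polF k g).[0] = 0.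
  by apply: (z0 _ _ (horner_polF k g)); rewrite /valF !primv1; ring.
have A0 : (polA k g).[0] = 0.
  by apply: (z0 _ _ (horner_polA k g)); rewrite /valA !primv1; ring.
have E0 : (polE k g).[0] = 0.
  by apply: (z0 _ _ (horner_polE k g)); rewrite /valE !primv1; ring.
have B0 : (polB R k).[0] = 0.
  by apply: (z0 _ _ (horner_polB k)); rewrite /valB !primv1; ring.
have C0 : (polC R k).[0] = 0.
  by apply: (z0 _ _ (horner_polC k)); rewrite /valC !primv1; ring.
have tv i : 1 - t i = v i by rewrite /t subKr.
have wE (i : nat) : weight m M w (t i) = valW (v i).
  rewrite /weight /valW (horner_k_base k g_gt g_lt) tv; congr ((_ * _)^*).
  by rewrite /t opprB addrA addrAC.
have sE i : sideval w (polB R k) (polC R k) (t i) = valS (v i).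
  by rewrite /sideval /valS horner_polB horner_polC tv.
have ZE i : contactZ m M w (t i) = rowZ (v i).
  rewrite /contactZ /rowZ (horner_k_base k g_gt g_lt) tv; congr (_ * complex.Re _).
  by rewrite /t opprB addrA addrAC.
have VE i : contactV m M w (polB R k) (t i) = complex.Im w * rowB (v i).
  by rewrite /contactV wE horner_polB tv.
have AE i : contactA m M w (polA k g) (t i) = rowA (v i).
  by rewrite /contactA wE horner_polA tv.
have EE i : contactE m M w (polE k g) (t i) = rowE (v i).
  by rewrite /contactE wE horner_polE tv.
have XE i : contactX m M w (polB R k) (polC R k) (t i) = rowX (v i).
  by rewrite /contactX wE sE.
have IE i : contactI m M w (polA k g) (t i) = rowI (v i).
  by rewrite /contactI wE horner_polA tv.
have UE i : contactU m M w (polB R k) (polC R k) (t i) = rowU (v i).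
  by rewrite /contactU wE sE.
have sw : 0 < complex.Im w by rewrite /= sqrtr_gt0 sin2_gt0.
have mE i j : minor (fun i => contactZ m M w (t i)) (fun i => contactV m M w (polB R k) (t i)) i j
    = complex.Im w * lam i j.
  by rewrite /lam /minor !ZE !VE !(mulrCA _ (complex.Im w)) -mulrBr.
have cE3 (F : R[i] -> R) : complex.Im w * lam 1 2 * F (v 0%N) + complex.Im w * lam 2 0 * F (v 1%N)
   + complex.Im w * lam 0 1 * F (v 2%N) = complex.Im w * lam_comb F.
  by rewrite /lam_comb; move: (lam 1 2) (lam 2 0) (lam 0 1) => x y z; ring.
apply: (local_rigid wg (dpolF k g_gt g_lt) (dpolA k g_gt g_lt) (dpolE k g_gt g_lt)
  (dpolB R k) (dpolC R k) F0 A0 E0 B0 C0 cF cA cE cB cC cK).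
- move=> i hi; have [h1 h2 _] := contact hi.
  by rewrite horner_polF (horner_k_base k g_gt g_lt) tv.
- by rewrite mE mulr_gt0.
- by rewrite mE mulr_gt0.
- by rewrite mE mulr_gt0.
- by rewrite !mE !AE cE3 mulr_gt0.
- by rewrite !mE !AE !EE !cE3 -mulrDr mulr_gt0.
- by rewrite !mE !XE cE3 mulr_gt0.
- by rewrite /minor !IE !UE.
- by [].
Qed.

Definition zpoly : {poly R[i]} := (M%:C)%:P - (rho%:C) *: 'X.
(** [zpoly] is the coordinate [t] as a function of [z]; the factor [- s ^+ n] makes the derivative
    monic, as the integrand of the theorem requires. *)
Definition extP : {poly R[i]} := - (s ^+ n)%:C *: (polF k g \Po zpoly).

Lemma s_rho : s * rho = 1.
Proof. by rewrite /s mulVf // gt_eqF // rho_gt0. Qed.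

Lemma sC_rho : s%:C * rho%:C = 1 :> R[i].
Proof. by rewrite -rmorphM s_rho. Qed.

Lemma horner_zpoly y : zpoly.[y] = M%:C - rho%:C * y.
Proof. by rewrite /zpoly hornerD hornerN hornerC hornerZ hornerX. Qed.

Lemma horner_extP y : extP.[y] = - (s ^+ n)%:C * valF k g (1 - (M%:C - rho%:C * y)).
Proof. by rewrite /extP hornerZ horner_comp horner_zpoly horner_polF. Qed.

Lemma deriv_extP : extP^`() =
  of_roots ((beta%:C - s%:C * (conjc w)) :: (beta%:C - s%:C * w) :: nseq m (beta%:C - s%:C)).
Proof.
have ww : w * (conjc w) = 1 by apply: wpwm; apply: cmod_wp.
have sr := sC_rho.
have lin y : y * (conjc y) = 1 ->
    q_of y \Po zpoly = (y * rho%:C) *: ('X - (beta%:C - s%:C * (conjc y))%:P).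
  move=> hy; rewrite /q_of comp_polyB comp_polyC comp_polyZ comp_polyX /zpoly.
  have e1 : y * rho%:C * (s%:C * (conjc y)) = 1.
    by rewrite -[RHS]hy -[RHS]mulr1 -sr; ring.
  have e2 : y * rho%:C * beta%:C = y * M%:C.
    rewrite /beta rmorphM /= mulrA -(mulrA y) (mulrC rho%:C) sr mulr1 //.
  have e1p : (y * rho%:C)%:P * (s%:C * (conjc y))%:P = 1 :> {poly R[i]} by rewrite -polyCM e1.
  have e2p : (y * rho%:C)%:P * beta%:C%:P = (y * M%:C)%:P :> {poly R[i]}.
    by rewrite -polyCM e2.
  by rewrite -!mul_polyC polyCB (mulrBr (y * rho%:C)%:P) (mulrBr (y * rho%:C)%:P) e2p e1p
     !polyCM; ring.
have cexp (p : {poly R[i]}) j : (p ^+ j) \Po zpoly = (p \Po zpoly) ^+ j by exact: rmorphXn.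
rewrite /extP derivZ deriv_comp (dpolF k g_gt g_lt) /k_base 2!comp_polyM cexp.
have -> : (1 - 'X : {poly R[i]}) = q_of 1 by rewrite /q_of scale1r.
have h1 : (1 : R[i]) * (conjc 1) = 1 by rewrite rmorph1 mulr1.
have h2 : (conjc w) * (conjc (conjc w)) = 1 by rewrite conjcK mulrC.
rewrite !lin // conjcK rmorph1 mul1r mulr1 /zpoly derivB derivC derivZ derivX sub0r.
rewrite 2!of_roots_cons exprZn -!mul_polyC.
have -> : of_roots (nseq m (beta%:C - s%:C)) = ('X - (beta%:C - s%:C)%:P) ^+ m.
  by elim: m => [|j IH]; [rewrite /of_roots big_nil expr0|rewrite of_roots_cons IH exprS].
move: ('X - (_ - s%:C * _)%:P) ('X - (_ - s%:C * _)%:P) ('X - _) => X1 X2 X3.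
have -> : (s ^+ n)%:C = s%:C ^+ m * s%:C ^+ 3 by rewrite rmorphXn /= -exprD addn3.
have e3 : s%:C ^+ m * rho%:C ^+ m = 1 :> R[i] by rewrite -exprMn sr expr1n.
have e4 : (s%:C)%:P * (rho%:C)%:P = 1 :> {poly R[i]} by rewrite -polyCM sr.
have e5 : w%:P * (conjc w)%:P = 1 :> {poly R[i]} by rewrite -polyCM ww.
rewrite -/m -/w (_ : s%:C ^+ 3 = s%:C * s%:C * s%:C); last by ring.
move: (s%:C ^+ m) (rho%:C ^+ m) (X3 ^+ m) e3 => A B Y e3.
have {}e3 : A%:P * B%:P = 1 :> {poly R[i]} by rewrite -polyCM e3.
rewrite polyCN !polyCM mulr1.
transitivity ((A%:P * B%:P) * ((s%:C)%:P * (rho%:C)%:P) ^+ 3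
   * (w%:P * (conjc w)%:P) * (X2 * X1 * Y)); first by ring.
by rewrite e3 e4 e5 expr1n !mul1r mulrA.
Qed.

Lemma root_extP y : root extP y = (valF k g (1 - (M%:C - rho%:C * y)) == 0).
Proof.
rewrite rootE horner_extP mulf_eq0 oppr_eq0 -cmod_eq0 cmodR normr_eq0 expf_eq0 /=.
by rewrite gt_eqF // s_gt0.
Qed.

Lemma zpolyK y : M%:C - rho%:C * (beta%:C - s%:C * y) = y.
Proof.
by rewrite mulrBr mulrA (mulrC rho%:C s%:C) sC_rho mul1r /beta rmorphM /= mulrA
   (mulrC rho%:C) sC_rho mul1r subKr.
Qed.

Lemma zpolyKV y : beta%:C - s%:C * (M%:C - rho%:C * y) = y.
Proof.
by rewrite mulrBr mulrA sC_rho mul1r /beta rmorphM subKr.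
Qed.

Lemma size_extP : size extP = n.+1.
Proof.
have : size extP^`() = n by rewrite deriv_extP size_of_roots /= size_nseq.
by rewrite size_deriv_complex; case: (size _) => [//|j] /= ->.
Qed.

Lemma disk_extP : disk_poly n extP.
Proof.
split; first exact: size_extP.
move=> z; rewrite root_extP => /eqP /all_roots [h _].
rewrite -(zpolyKV z); move: (M%:C - rho%:C * z) h => y h.
have -> : beta%:C - s%:C * y = s%:C * (M%:C - y) by rewrite (mulrBr s%:C) /beta rmorphM.
rewrite cmodM cmodR (gtr0_norm s_gt0) /s mulrC ler_pdivrMr ?rho_gt0 // mul1r.
rewrite -(ler_pXn2r (n := 2)) ?nnegrE ?cmod_ge0 ?(ltW rho_gt0) // rho_sqr dist_sqr.
by move: h; rewrite subKr; lra.
Qed.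

Lemma extP_locally_extremal : locally_extremal n extP.
Proof.
have sp := s_gt0.
have F1 : valF k g 1 = 0 by rewrite /valF !primv1; ring.
apply: (@extremal_criterion _ m M s w t extP 1 sp M0) => //.
- exact: cmod_wp.
- exact: disk_extP.
- by rewrite scale1r deriv_extP.
- by rewrite -/beta root_extP; have := zpolyK 0; rewrite mulr0 subr0 => ->; rewrite subr0 F1.
- move=> z; rewrite root_extP => /eqP hz; rewrite -/beta => zb.
  have [_ hc] := all_roots hz; rewrite -(zpolyKV z) in zb *.
  move: (M%:C - rho%:C * z) hc zb {hz} => y hc zb.
  have y1 : 1 - y != 1.
    apply: contraNneq zb => h; suff -> : y = 0 by rewrite mulr0 subr0.
    by apply/eqP; rewrite -oppr_eq0 -(inj_eq (addrI 1)) addr0 h.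
  have dst (x : R[i]) : cmod (y - x) < 1 ->
     cmod (beta%:C - s%:C * y - (beta%:C - s%:C * x)) < s.
    have -> : beta%:C - s%:C * y - (beta%:C - s%:C * x) = - (s%:C * (y - x)) by ring.
    by rewrite cmodN cmodM cmodR gtr0_norm // => h; rewrite -[ltRHS]mulr1 ltr_pM2l.
  case: (hc y1) => h.
    exists (beta%:C - s%:C); first by rewrite !inE mem_nseq eqxx !orbT.
    by rewrite -[s%:C in X in _ - X]mulr1; apply: dst; rewrite cmod_distC.
  move: h; rewrite subKr.
  have c2 : 4 - (2 + g) ^+ 2 = 4 * complex.Im w ^+ 2.
    by rewrite /= sqr_sqrtr ?ltW ?sin2_gt0 // /cosv; field.
  have sw : 0 < complex.Im w by rewrite /= sqrtr_gt0 sin2_gt0.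
  have w1 : complex.Re w ^+ 2 + complex.Im w ^+ 2 = 1.
    by rewrite -cmod_sqr (cmod_wp g_gt g_lt) expr1n.
  have wr : 2 + g = 2 * complex.Re w by rewrite /= /cosv; field.
  (* For [x] of modulus [1], [cmod (y - x) < 1] means [|y|^2 - 2 Re x Re y < 2 Im x Im y]. The
     second case of [near_crit] gives the square of this inequality, with [x] the one of [w] and its
     conjugate on the same side of the real axis as [y]. *)
  have key (x : R[i]) : complex.Re x = complex.Re w ->
     complex.Im x ^+ 2 = complex.Im w ^+ 2 ->
     cmod y ^+ 2 - 2 * complex.Re w * complex.Re y < 2 * complex.Im y * complex.Im x ->
     cmod (y - x) < 1.
    move=> hx1 hx2; rewrite (cmod_lt_sqr _ ler01) expr1n.
    rewrite !cmod_sqr; move: hx1 hx2 w1; case: (y) (x) => p q [p' q'] /= -> h2 h1; nra.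
  have imy : complex.Im (1 - y) ^+ 2 = complex.Im y ^+ 2.
    by case: (y) => p q /=; rewrite sub0r sqrrN.
  rewrite c2 imy wr.
  set xx := cmod y ^+ 2 - _.
  rewrite (_ : complex.Im y ^+ 2 * (4 * complex.Im w ^+ 2) =
     (2 * `|complex.Im y| * complex.Im w) ^+ 2); last first.
    by rewrite !exprMn real_normK ?num_real //; ring.
  move=> hx; have {}hx : xx < 2 * `|complex.Im y| * complex.Im w.
    have b0 : 0 <= 2 * `|complex.Im y| * complex.Im w by rewrite !mulr_ge0 // ltW.
    by rewrite (le_lt_trans (ler_norm _)) // -(ltr_pXn2r (n := 2)) ?nnegrE //
       real_normK ?num_real.
  case: (lerP 0 (complex.Im y)) => hy.
    exists (beta%:C - s%:C * w); first by rewrite !inE eqxx orbT.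
    by apply/dst/key => //; move: hx; rewrite ger0_norm.
  exists (beta%:C - s%:C * w^*); first by rewrite !inE eqxx.
  apply/dst/key => //=; first by rewrite sqrrN.
  by move: hx; rewrite /xx ltr0_norm //=; lra.
- move=> i y hi hy; rewrite -/beta root_extP zpolyK.
  have [h1 _ _] := contact hi.
  case: hy => ->; first by rewrite /t subKr h1.
  have -> : 1 - (t i)^* = (v i)^* by rewrite /t rmorphB rmorph1 subKr.
  by rewrite valFJ h1 conjc0.
- move=> i hi; have [_ _ h] := contact hi.
  suff -> : cmod (M%:C - t i) = rho by exact: s_rho.
  apply/eqP; rewrite -(eqrXn2 (n := 2)) ?cmod_ge0 ?(ltW rho_gt0) //.
  by rewrite rho_sqr dist_sqr /t h; apply/eqP; ring.
- exact: root_rigid.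
Qed.

Lemma certificate_extremal : exists beta' a' b' c' : R, 0 < beta' < 1 /\
    exists P : {poly R[i]},
      [/\ forall z : R[i],
            P.[z] = line_integral
                      (fun w => (w - a'%:C) ^+ (n - 3)
                                * (w ^+ 2 + b'%:C * w + c'%:C))
                      beta'%:C z,
          disk_poly n P
        & locally_extremal n P].
Proof.
exists beta, a, (g * s - 2 * a), (a ^+ 2 - g * s * a - g * s ^+ 2).
split; first exact: beta_bounds.
exists extP; split; [|exact: disk_extP|exact: extP_locally_extremal].
move=> z.
have -> : (fun y => (y - a%:C) ^+ (n - 3) * (y ^+ 2 + (g * s - 2 * a)%:C * y +
    (a ^+ 2 - g * s * a - g * s ^+ 2)%:C)) = (fun y => extP^`().[y]).
  apply/funext => y; rewrite deriv_extP horner_of_roots 2!big_cons.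
  have -> : \prod_(x <- nseq m (beta%:C - s%:C)) (y - x) = (y - a%:C) ^+ m.
    by rewrite /a rmorphB; elim: m => [|j IH]; rewrite ?big_nil ?expr0 // big_cons IH exprS.
  have -> : (n - 3)%N = m by rewrite /n !subSS subn0.
  rewrite mulrA mulrC; congr (_ * _).
  have e : w + w^* = 2 + g%:C.
    by apply/eqP; rewrite eq_complex /= /cosv; apply/andP; split; apply/eqP; [field|ring].
  have e2 : w * w^* = 1 by apply: wpwm; apply: cmod_wp.
  have -> : beta = a + s by rewrite /a subrK.
  exact: quadratic_factor.
rewrite line_integral_deriv.
have -> : extP.[beta%:C] = 0.
  have F1 : valF k g 1 = 0 by rewrite /valF !primv1; ring.
  by rewrite horner_extP; have := zpolyK 0; rewrite mulr0 subr0 => ->; rewrite subr0 F1 mulr0.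
by rewrite subr0.
Qed.

End Certificate.

Delimit Scope Z_scope with SZ.

(** * Integer ball arithmetic and its soundness *)

Section IntegerCast.
Variable R : realType.

(* Opaque, so that no tactic ever computes the unary integer [int_of_Z a]. *)
Fact zr_spec : {f : Z -> R | forall a, f a = (int_of_Z a)%:~R}.
Proof. by exists (fun a => (int_of_Z a)%:~R). Qed.

Definition zr : Z -> R := sval zr_spec.

Lemma zrE a : zr a = (int_of_Z a)%:~R.
Proof. exact: (svalP zr_spec). Qed.

Lemma zrD a b : zr (Z.add a b) = zr a + zr b.
Proof. by rewrite !zrE (_ : int_of_Z _ = int_of_Z a + int_of_Z b) ?rmorphD //; lia. Qed.

Lemma zrM a b : zr (Z.mul a b) = zr a * zr b.
Proof. by rewrite !zrE (_ : int_of_Z _ = int_of_Z a * int_of_Z b) ?rmorphM //; lia. Qed.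

Lemma zrN a : zr (Z.opp a) = - zr a.
Proof. by rewrite !zrE (_ : int_of_Z _ = - int_of_Z a) ?rmorphN //; lia. Qed.

Lemma zrB a b : zr (Z.sub a b) = zr a - zr b.
Proof. by rewrite -zrN -zrD Z.add_opp_r. Qed.

Lemma zr_abs a : zr (Z.abs a) = `|zr a|.
Proof. by rewrite !zrE -intr_norm; congr (_%:~R); lia. Qed.

Lemma zr_le a b : Z.leb a b -> zr a <= zr b.
Proof. by move=> h; rewrite !zrE ler_int; lia. Qed.

Lemma zr_lt a b : Z.ltb a b -> zr a < zr b.
Proof. by move=> h; rewrite !zrE ltr_int; lia. Qed.

Lemma zr_div a b : Z.ltb 0 b -> zr (Z.div a b) * zr b <= zr a < (zr (Z.div a b) + 1) * zr b.
Proof.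
move=> hb.
have h1 : zr 1 = 1 by rewrite zrE.
rewrite -h1 -zrD -!zrM; apply/andP; split; [apply: zr_le | apply: zr_lt].
  by apply/Z.leb_le; have := Z.mul_div_le a b; lia.
by apply/Z.ltb_lt; have := Z.mul_succ_div_gt a b; lia.
Qed.

Lemma zr_nat (j : nat) : zr (Z.of_nat j) = j%:R.
Proof. by rewrite !zrE (_ : int_of_Z _ = j) //; lia. Qed.

Lemma zr0 : zr 0%SZ = 0. Proof. exact: (zr_nat 0). Qed.
Lemma zr1 : zr 1%SZ = 1. Proof. exact: (zr_nat 1). Qed.
Lemma zr2 : zr 2%SZ = 2. Proof. exact: (zr_nat 2). Qed.
Lemma zr3 : zr 3%SZ = 3. Proof. exact: (zr_nat 3). Qed.

End IntegerCast.

(* A ball [(m, e)] stands for the reals [x] with [|x * 2^80 - m| <= e]. *)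
Definition ball := (Z * Z)%type.
Definition cball := (ball * ball)%type.
Definition scaleZ : Z := Z.pow 2 80.
Definition bexact (m : Z) : ball := (m, Z0).
Definition bint (m : Z) : ball := (Z.mul m scaleZ, Z0).
(** The radius [1] covers the downward rounding of the division. *)
Definition binv (j : nat) : ball := (Z.div scaleZ (Z.of_nat j), Zpos xH).
Definition badd (a b : ball) : ball := (Z.add a.1 b.1, Z.add a.2 b.2).
Definition bopp (a : ball) : ball := (Z.opp a.1, a.2).
Definition bsub (a b : ball) : ball := badd a (bopp b).
(** Both shifts round down: the added [2] is one unit for the midpoint and one for the radius. *)
Definition bmul (a b : ball) : ball :=
  (Z.shiftr (Z.mul a.1 b.1) 80,
   Z.add (Z.shiftr (Z.add (Z.add (Z.mul (Z.abs a.1) b.2) (Z.mul (Z.abs b.1) a.2))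
                      (Z.mul a.2 b.2)) 80) 2%SZ).
Definition bpos (a : ball) : bool := Z.ltb a.2 a.1.

Definition cadd (a b : cball) : cball := (badd a.1 b.1, badd a.2 b.2).
Definition copp (a : cball) : cball := (bopp a.1, bopp a.2).
Definition csub (a b : cball) : cball := cadd a (copp b).
Definition cmul (a b : cball) : cball :=
  (bsub (bmul a.1 b.1) (bmul a.2 b.2), badd (bmul a.1 b.2) (bmul a.2 b.1)).
Definition cconj (a : cball) : cball := (a.1, bopp a.2).
Definition creal (a : ball) : cball := (a, bint 0%SZ).
Definition csqr (a : cball) : ball := badd (bmul a.1 a.1) (bmul a.2 a.2).
Definition cscale (b : ball) (a : cball) : cball := (bmul b a.1, bmul b a.2).
(** Repeated squaring. When the fuel is exhausted it falls back on iterated products, so the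
    enclosure is valid for any fuel; fuel [5] is enough to halve every exponent below [32] down to
    [0]. *)
Fixpoint cpow (fuel : nat) (a : cball) (j : nat) : cball :=
  if fuel is f.+1 then
    if j is 0%N then creal (bint 1%SZ) else
    let h := cpow f a j./2 in let h2 := cmul h h in if odd j then cmul a h2 else h2
  else iter j (cmul a) (creal (bint 1%SZ)).

Fact shiftrE a : Z.shiftr a 80 = Z.div a scaleZ. Proof. exact: Z.shiftr_div_pow2. Qed.

Fact scaleZ_gt0 : Z.ltb 0 scaleZ. Proof. by []. Qed.

#[local] Opaque scaleZ.

Section Balls.
Variable R : realType.
Implicit Types (x y : R) (u v : R[i]) (a b : ball) (c d : cball).
Local Notation zr := (zr R).
Local Notation S := (zr scaleZ).

Definition inb x a : Prop := `|x * S - zr a.1| <= zr a.2.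
Definition inc u c : Prop := inb (complex.Re u) c.1 /\ inb (complex.Im u) c.2.

Lemma scale_gt0 : 0 < S.
Proof. by have := @zr_lt R 0%SZ scaleZ scaleZ_gt0; rewrite zr0. Qed.

Lemma inb_exact m : inb (zr m / S) (bexact m).
Proof. by rewrite /inb /= divfK ?gt_eqF ?scale_gt0 // subrr normr0 zr0. Qed.

Lemma inb_int m : inb (zr m) (bint m).
Proof. by rewrite /inb /= zrM subrr normr0 zr0. Qed.

Lemma inb_inv j : (0 < j)%N -> inb (j%:R^-1) (binv j).
Proof.
move=> j0; have hj : Z.ltb 0 (Z.of_nat j) by apply/Z.ltb_lt; lia.
have jp : 0 < j%:R :> R by rewrite ltr0n.
have /andP[] := zr_div R scaleZ hj; rewrite zr_nat /inb /= => h1 h2.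
have {}h1 : zr (Z.div scaleZ (Z.of_nat j)) <= j%:R^-1 * S by rewrite mulrC ler_pdivlMr.
have {}h2 : j%:R^-1 * S < zr (Z.div scaleZ (Z.of_nat j)) + 1 by rewrite mulrC ltr_pdivrMr.
rewrite zr1.
by rewrite ler_norml; apply/andP; split; move: h1 h2; lra.
Qed.

Lemma inb_add x y a b : inb x a -> inb y b -> inb (x + y) (badd a b).
Proof.
rewrite /inb /= !zrD => h1 h2; apply: le_trans (lerD h1 h2).
by rewrite (_ : _ - _ = (x * S - zr a.1) + (y * S - zr b.1)) ?ler_normD //; ring.
Qed.

Lemma inb_opp x a : inb x a -> inb (- x) (bopp a).
Proof. by rewrite /inb /= zrN mulNr -opprD normrN. Qed.

Lemma inb_sub x y a b : inb x a -> inb y b -> inb (x - y) (bsub a b).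
Proof. by move=> h1 h2; apply: inb_add h1 (inb_opp h2). Qed.

Lemma inb_mul x y a b : inb x a -> inb y b -> inb (x * y) (bmul a b).
Proof.
case: a b => m1 e1 [m2 e2]; rewrite /inb /bmul /fst /snd !shiftrE => h1 h2.
have Sp := scale_gt0.
set E := Z.add (Z.add _ _) _.
have hS := scaleZ_gt0.
have /andP[d1 d2] := zr_div R (Z.mul m1 m2) hS.
have /andP[_ d4] := zr_div R E hS.
set dm := zr (Z.div (Z.mul m1 m2) scaleZ) in d1 d2 *.
have -> : zr (Z.add (Z.div E scaleZ) 2%SZ) = zr (Z.div E scaleZ) + 2 by rewrite zrD zr2.
set de := zr (Z.div E scaleZ) in d4 *.
have hE X Y : `|X - zr m1| <= zr e1 -> `|Y - zr m2| <= zr e2 ->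
    `|X * Y - zr m1 * zr m2| <= zr E.
  move=> {d1 d2 d4 h1 h2 dm de} h1 h2; rewrite /E !zrD !zrM !zr_abs.
  rewrite (_ : X * Y - _ = zr m1 * (Y - zr m2) + zr m2 * (X - zr m1)
                       + (X - zr m1) * (Y - zr m2)); last by ring.
  rewrite (le_trans (ler_normD _ _)) // lerD //; last by rewrite normrM ler_pM.
  by rewrite (le_trans (ler_normD _ _)) // lerD // normrM ler_wpM2l.
have {hE} := hE _ _ h1 h2; move=> hE.
rewrite (zrM R m1 m2) in d1 d2.
move: Sp d1 d2 d4 hE {hS h1 h2}; move: S (zr E) dm de => s0 EE dm de.
move=> Sp d1 d2 d4; rewrite !ler_norml => /andP[hE1 hE2]; apply/andP; split.
  rewrite -(ler_pM2r Sp); move: hE1 hE2 d1 d2 d4; lra.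
rewrite -(ler_pM2r Sp); move: hE1 hE2 d1 d2 d4; lra.
Qed.

Lemma inb_pos x a : inb x a -> bpos a -> 0 < x.
Proof.
rewrite /inb ler_norml => /andP[h _] /(@zr_lt R) h2.
by rewrite -(pmulr_lgt0 _ scale_gt0); move: h h2; lra.
Qed.

Lemma inb1 : inb 1 (bint 1%SZ). Proof. by rewrite -zr1; apply: inb_int. Qed.
Lemma inb2 : inb 2 (bint 2%SZ). Proof. by rewrite -zr2; apply: inb_int. Qed.

Lemma inc_add u v c d : inc u c -> inc v d -> inc (u + v) (cadd c d).
Proof. by case: u v => [x y] [x' y'] [h1 h2] [h3 h4]; split; apply: inb_add. Qed.

Lemma inc_opp u c : inc u c -> inc (- u) (copp c).
Proof. by case: u => [x y] [h1 h2]; split; apply: inb_opp. Qed.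

Lemma inc_sub u v c d : inc u c -> inc v d -> inc (u - v) (csub c d).
Proof. by move=> h1 h2; apply: inc_add h1 (inc_opp h2). Qed.

Lemma inc_mul u v c d : inc u c -> inc v d -> inc (u * v) (cmul c d).
Proof.
case: u v => [x y] [x' y'] [h1 h2] [h3 h4]; split.
  by apply: inb_sub; apply: inb_mul.
by apply: inb_add; apply: inb_mul.
Qed.

Lemma inc_conj u c : inc u c -> inc u^* (cconj c).
Proof. by case: u => [x y] [h1 h2]; split => //; apply: inb_opp. Qed.

Lemma inc_real x a : inb x a -> inc x%:C (creal a).
Proof. by move=> h; split => //; have := inb_int 0%SZ; rewrite zr0. Qed.

Lemma inc_1 : inc 1 (creal (bint 1%SZ)).
Proof. by have := inc_real (inb_int 1%SZ); rewrite zr1. Qed.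

Lemma inc_scale x u a c : inb x a -> inc u c -> inc (x%:C * u) (cscale a c).
Proof.
case: u => [y z] ha [h1 h2]; rewrite /inc /= !mul0r subr0 addr0.
by split; apply: inb_mul.
Qed.

Lemma inc_pow f u c j : inc u c -> inc (u ^+ j) (cpow f c j).
Proof.
move=> h; elim: f j => [|f IH] j /=.
  by elim: j => [|j IH]; [exact: inc_1|rewrite exprS; apply: inc_mul].
case: j => [|j]; first exact: inc_1.
rewrite -[in u ^+ _](odd_double_half j.+1) -addnn !exprD.
by case: (odd j.+1); rewrite ?expr1 ?expr0 ?mul1r; do ?[apply: inc_mul => //]; apply: IH.
Qed.

Lemma inb_sqr u c : inc u c -> inb (cmod u ^+ 2) (csqr c).
Proof. by case=> h1 h2; rewrite cmod_sqr; apply: inb_add; apply: inb_mul. Qed.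

End Balls.

(** * Ball versions of the model functions and of the rows *)

Record powers := Powers {
  q0 : cball; q1 : cball; q2 : cball; q3 : cball; q4 : cball; pw : cball }.

(* Balls for [primv k v, ..., primv k.+4 v] and [v ^+ k.+2]. *)
Definition bpowers (k : nat) (v : cball) : powers :=
  let q j p := cscale (binv j) (csub (creal (bint 1%SZ)) p) in
  let p1 := cpow 5 v k.+1 in let p2 := cmul v p1 in let p3 := cmul v p2 in
  let p4 := cmul v p3 in let p5 := cmul v p4 in
  Powers (q k.+1 p1) (q k.+2 p2) (q k.+3 p3) (q k.+4 p4) (q k.+4.+1 p5) p2.

(** Scaling by an integer is exact, without the rounding of [bmul]. *)
Definition bscal (z : Z) (g : ball) : ball := (Z.mul z g.1, Z.mul (Z.abs z) g.2).

Record rows := Rows { rZ : ball; rB : ball; rA : ball; rE : ball; rX : ball; rI : ball; rU : ball }.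

Section BallModel.
Variable R : realType.
Variables (k : nat) (g M : ball) (v : cball) (P : powers).

Definition bF := csub (cadd (q4 P) (cscale g (q3 P))) (cscale g (q2 P)).
Definition bA := csub (cadd (cadd (copp (q4 P)) (cscale (bsub (bint 1%SZ) g) (q3 P)))
  (cscale (bscal 2%SZ g) (q2 P))) (cscale g (q1 P)).
Definition bE := csub (cadd (cadd (cadd (q4 P) (cscale (bsub g (bint 2%SZ)) (q3 P)))
  (cscale (bsub (bint 1%SZ) (bscal 3%SZ g)) (q2 P))) (cscale (bscal 3%SZ g) (q1 P)))
  (cscale g (q0 P)).
Definition bB := csub (q2 P) (q3 P).
Definition bC := cadd (csub (q2 P) (cscale (bint 2%SZ) (q3 P))) (q4 P).
Definition bh := cmul (pw P) (csub (cadd (cmul v v) (cscale g v)) (creal g)).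
Definition bzeta := cadd (csub (creal M) (creal (bint 1%SZ))) v.
Definition bcos := bmul (badd (bint 2%SZ) g) (binv 2).
Definition bS (B : cball) := csub (cscale bcos B) bC.
Definition brows : rows :=
  let h := bh in let z := bzeta in let W := cconj (cmul z h) in let B := bB in
  let WA := cmul W bA in let WS := cmul W (bS B) in
  Rows (bmul (csqr h) z.1) (cmul W B).1 WA.1 (cmul W bE).1 WS.1 WA.2 WS.2.

Variables (rg rM : R).
Hypotheses (hg : inb rg g) (hM : inb rM M).
Variables (u : R[i]).
Hypotheses (huv : inc u v) (hP : P = bpowers k v).

Lemma inc_prim j p : inc (u ^+ j.+1) p ->
  inc (primv j u) (cscale (binv j.+1) (csub (creal (bint 1%SZ)) p)).
Proof.
by move=> h; apply: inc_scale; [apply: inb_inv|apply: inc_sub h; apply: inc_1].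
Qed.

Lemma inc_powers : [/\ inc (primv k u) (q0 P), inc (primv k.+1 u) (q1 P),
  inc (primv k.+2 u) (q2 P), inc (primv k.+3 u) (q3 P) & inc (primv k.+4 u) (q4 P)]
  /\ inc (u ^+ k.+2) (pw P).
Proof.
rewrite hP /bpowers; have h1 := inc_pow 5 k.+1 huv.
have h2 : inc (u ^+ k.+2) (cmul v (cpow 5 v k.+1)) by rewrite exprS; apply: inc_mul.
have h3 := inc_mul huv h2; rewrite -exprS in h3.
have h4 := inc_mul huv h3; rewrite -exprS in h4.
have h5 := inc_mul huv h4; rewrite -exprS in h5.
by split => //; split; apply: inc_prim.
Qed.

Let i0 : inc (primv k u) (q0 P). Proof. by case: inc_powers => [[]]. Qed.
Let i1 : inc (primv k.+1 u) (q1 P). Proof. by case: inc_powers => [[]]. Qed.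
Let i2 : inc (primv k.+2 u) (q2 P). Proof. by case: inc_powers => [[]]. Qed.
Let i3 : inc (primv k.+3 u) (q3 P). Proof. by case: inc_powers => [[]]. Qed.
Let i4 : inc (primv k.+4 u) (q4 P). Proof. by case: inc_powers => [[]]. Qed.

Lemma inb_scal (x : R) (z : Z) b : inb x b -> inb (zr R z * x) (bscal z b).
Proof.
rewrite /inb /bscal /fst /snd !zrM zr_abs => h.
by rewrite -mulrA -mulrBr normrM ler_wpM2l.
Qed.

Lemma inb_scal2 (x : R) b : inb x b -> inb (2 * x) (bscal 2%SZ b).
Proof. by rewrite -[2](zr2 R); apply: inb_scal. Qed.

Lemma inb_scal3 (x : R) b : inb x b -> inb (3 * x) (bscal 3%SZ b).
Proof. by rewrite -[3](zr3 R); apply: inb_scal. Qed.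

Lemma inc_F : inc (valF k rg u) bF.
Proof. by apply: inc_sub; [apply: inc_add => //; apply: inc_scale|apply: inc_scale]. Qed.

Lemma inc_A : inc (valA k rg u) bA.
Proof.
apply: inc_sub; last exact: inc_scale.
apply: inc_add; last by apply: inc_scale => //; apply: inb_scal2.
by apply: inc_add; [apply: inc_opp|apply: inc_scale => //; apply: inb_sub hg; apply: inb1].
Qed.

Lemma inc_E : inc (valE k rg u) bE.
Proof.
apply: inc_sub; last exact: inc_scale.
apply: inc_add; last by apply: inc_scale => //; apply: inb_scal3.
apply: inc_add; last first.
  by apply: inc_scale => //; apply: inb_sub; [apply: inb1|apply: inb_scal3].
by apply: inc_add => //; apply: inc_scale => //; apply: inb_sub hg _; apply: inb2.
Qed.

Lemma inc_B : inc (valB k u) bB.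
Proof. exact: inc_sub. Qed.

Lemma inc_C : inc (valC k u) bC.
Proof.
by apply: inc_add => //; apply: inc_sub => //; apply: inc_scale => //; apply: inb2.
Qed.

Lemma inc_h : inc (valh k rg u) bh.
Proof.
apply: inc_mul; first by case: inc_powers.
apply: inc_sub; last exact: inc_real.
by apply: inc_add; [rewrite expr2; apply: inc_mul|apply: inc_scale].
Qed.

Lemma inc_zeta : inc (rM%:C - 1 + u) bzeta.
Proof. by apply: inc_add => //; apply: inc_sub; [apply: inc_real|apply: inc_1]. Qed.

Lemma inc_W : inc (valW k rg rM u) (cconj (cmul bzeta bh)).
Proof. by apply: inc_conj; apply: inc_mul; [apply: inc_zeta|apply: inc_h]. Qed.

Lemma inc_S : inc (valS k rg u) (bS bB).
Proof.
apply: inc_sub; last exact: inc_C.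
apply: inc_scale; last exact: inc_B.
by apply: inb_mul; [apply: inb_add hg; apply: inb2|apply: inb_inv].
Qed.

Lemma inb_rows :
  [/\ inb (rowZ k rg rM u) (rZ brows), inb (rowB k rg rM u) (rB brows),
      inb (rowA k rg rM u) (rA brows), inb (rowE k rg rM u) (rE brows)
    & [/\ inb (rowX k rg rM u) (rX brows), inb (rowI k rg rM u) (rI brows)
        & inb (rowU k rg rM u) (rU brows)]].
Proof.
have WA := inc_mul inc_W inc_A; have WS := inc_mul inc_W inc_S.
split; last (by split; [case: WS|case: WA|case: WS]).
- by apply: inb_mul; [apply: inb_sqr; apply: inc_h|apply: (proj1 inc_zeta)].
- by case: (inc_mul inc_W inc_B).
- by case: WA.
- by case: (inc_mul inc_W inc_E).
Qed.

End BallModel.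

(** * Bounded Lipschitz functions and the intermediate value theorem *)

Section Lipschitz.
Variables (R : realType) (a b : R).
Hypothesis ab : a <= b.

(** Boundedness is included to make the class closed under products; the determinant in [g] is then
    handled by sums and products of explicit estimates. *)
Definition lipb (f : R -> R) := exists L B : R, [/\ 0 <= L, 0 <= B,
  forall x, a <= x <= b -> `|f x| <= B
  & forall x y, a <= x <= b -> a <= y <= b -> `|f x - f y| <= L * `|x - y|].

Lemma lipbD f h : lipb f -> lipb h -> lipb (fun x => f x + h x).
Proof.
move=> [L [B [L0 B0 H1 H2]]] [L' [B' [L0' B0' H1' H2']]].
exists (L + L'), (B + B'); split; rewrite ?addr_ge0 //.
  by move=> x hx; rewrite (le_trans (ler_normD _ _)) // lerD ?H1 ?H1'.
move=> x y hx hy; rewrite mulrDl (_ : _ - _ = (f x - f y) + (h x - h y)); last by ring.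
by rewrite (le_trans (ler_normD _ _)) // lerD ?H2 ?H2'.
Qed.

Lemma lipbN f : lipb f -> lipb (fun x => - f x).
Proof.
move=> [L [B [L0 B0 H1 H2]]]; exists L, B; split => //.
  by move=> x hx; rewrite normrN H1.
by move=> x y hx hy; rewrite -opprD normrN H2.
Qed.

Lemma lipbM f h : lipb f -> lipb h -> lipb (fun x => f x * h x).
Proof.
move=> [L [B [L0 B0 H1 H2]]] [L' [B' [L0' B0' H1' H2']]].
exists (B * L' + B' * L), (B * B'); split; rewrite ?addr_ge0 ?mulr_ge0 //.
  by move=> x hx; rewrite normrM ler_pM ?H1 ?H1'.
move=> x y hx hy.
rewrite (_ : _ - _ = f x * (h x - h y) + h y * (f x - f y)); last by ring.
by rewrite (le_trans (ler_normD _ _)) // mulrDl lerD // -mulrA normrM ler_pM ?H1 ?H2 ?H1' ?H2'.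
Qed.

Lemma lipb_cst c : lipb (fun=> c).
Proof.
by exists 0, `|c|; split => // x y _ _; rewrite subrr normr0 mul0r.
Qed.

Definition clamp (x : R) := Num.max a (Num.min b x).

Lemma clamp_in x : a <= clamp x <= b.
Proof. by rewrite /clamp le_max lexx /= ge_max ab ge_min lexx. Qed.

Lemma clamp_id x : a <= x <= b -> clamp x = x.
Proof. by move=> /andP[h1 h2]; rewrite /clamp (min_idPr h2) (max_idPr h1). Qed.

Lemma clamp_lip x y : `|clamp x - clamp y| <= `|x - y|.
Proof.
wlog xy : x y / x <= y => [H|].
  by case: (leP x y) => [/H//|/ltW/H]; rewrite distrC (distrC y).
have h : clamp x <= clamp y.
  rewrite /clamp ge_max; apply/andP; split; first by rewrite le_max lexx.
  rewrite le_max; apply/orP; right; rewrite le_min !ge_min lexx /=.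
  by apply/orP; right.
rewrite distrC (distrC x) !ger0_norm ?subr_ge0 //.
rewrite /clamp; case: (leP b x) => h1; case: (leP b y) => h2.
- by rewrite !subrr subr_ge0.
- by move: xy h1 h2; lra.
- rewrite (max_idPr ab); case: (leP a x) => h3; move: ab xy h1 h2 h3; lra.
- by case: (leP a x) => h3; case: (leP a y) => h4; move: ab xy h1 h2 h3 h4; lra.
Qed.

(** Composing with the retraction [clamp] extends [f] to a continuous function on the line, where
    the intermediate value theorem applies. *)
Lemma lipb_ivt f : lipb f -> f a <= 0 <= f b \/ f b <= 0 <= f a ->
  exists2 x, a <= x <= b & f x = 0.
Proof.
move=> [L [B [L0 _ _ H]]] hs.
have cf : continuous (f \o clamp).
  move=> x; apply/cvgrPdist_le => /= e e0.
  have d0 : 0 < e / (L + 1) by rewrite divr_gt0 // ltr_wpDl.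
  apply/nbhs_ballP; exists (e / (L + 1)) => //= y; rewrite /ball /= => hy.
  apply: le_trans (H _ _ (clamp_in _) (clamp_in _)) _.
  apply: (@le_trans _ _ ((L + 1) * (e / (L + 1)))); last first.
    by rewrite mulrC divfK // gt_eqF // ltr_wpDl.
  apply: ler_pM => //; first by rewrite lerDl.
  exact: le_trans (clamp_lip _ _) (ltW hy).
have aI : a <= a <= b by rewrite lexx.
have bI : a <= b <= b by rewrite lexx ab.
have [||c] := @IVT R (f \o clamp) a b 0 ab.
- exact: continuous_subspaceT.
- rewrite /= (clamp_id aI) (clamp_id bI); case: hs => /andP[h1 h2].
    by rewrite ge_min h1 le_max h2 orbT.
  by rewrite ge_min h1 orbT le_max h2.
rewrite in_itv /= => hc; rewrite (clamp_id hc) => fc; by exists c.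
Qed.

End Lipschitz.

(** * A zero near an approximate zero *)

Section RootNear.
Variable R : realType.
Implicit Types (p : {poly R[i]}) (x y z : R[i]).

(** If all roots were farther than [d] from [x], the logarithmic derivative, a sum of [N] terms
    [1 / (x - z)], would have modulus less than [N / d]. *)
Lemma root_near p N x (d : R) : size p = N.+1 -> p^`().[x] != 0 ->
  N%:R * cmod p.[x] <= d * cmod p^`().[x] -> exists2 y, root p y & cmod (y - x) <= d.
Proof.
move=> sp dp hd.
have dp0 : 0 < cmod p^`().[x] by rewrite cmod_gt0.
have d0 : 0 <= d.
  by rewrite -(pmulr_lge0 _ dp0); apply: le_trans hd; rewrite mulr_ge0.
have [px|px] := eqVneq p.[x] 0.
  by exists x; rewrite ?rootE ?px // subrr cmod0.
have p0 : p != 0 by apply: contraNneq px => ->; rewrite horner0.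
have l0 : lead_coef p != 0 by rewrite lead_coef_eq0.
have sr : size (proots p) = N by apply/eqP; rewrite -eqSS -size_proots // sp.
apply: contrapT => hno.
have far z : z \in proots p -> d < cmod (x - z).
  move=> zp; rewrite ltNge; apply/negP => h; apply: hno; exists z.
    by rewrite -mem_proots.
  by rewrite cmod_distC.
have xn : x \notin proots p by rewrite mem_proots // rootE.
have E : p^`().[x] = p.[x] * \sum_(z <- proots p) (x - z)^-1.
  by rewrite {1 2}(proots_eq p) derivZ !hornerZ deriv_of_roots // mulrA.
have N0 : (0 < N)%N.
  rewrite lt0n; apply: contraTneq dp0 => N0; move: sr; rewrite N0 => /size0nil h.
  by rewrite E h big_nil mulr0 cmod0 ltxx.
have dp1 : 0 < d.
  rewrite -(pmulr_lgt0 _ dp0); apply: lt_le_trans hd.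
  by rewrite mulr_gt0 ?ltr0n // cmod_gt0.
have : d * cmod p^`().[x] < N%:R * cmod p.[x].
  rewrite E cmodM mulrCA mulrC ltr_pM2r ?cmod_gt0 //.
  apply: (@le_lt_trans _ _ (d * \sum_(z <- proots p) (cmod (x - z))^-1)).
    rewrite ler_wpM2l // (le_trans (cmod_sum _ _ _)) //.
    by rewrite le_eqVlt; apply/orP; left; apply/eqP; apply: eq_bigr => z _; rewrite cmodV.
  rewrite mulrC -ltr_pdivlMr // -sr mulr_natl -[X in _ *+ X]card_ord -sumr_const.
  have N1 : (0 < size (proots p))%N by rewrite sr.
  rewrite (big_nth 0) big_mkord; apply: ltr_sum.
    by apply/hasP; exists (Ordinal N1); rewrite ?mem_index_enum.
  move=> i _; rewrite ltf_pV2 ?posrE //.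
    by apply: far; apply: mem_nth.
  by apply: lt_trans dp1 _; apply: far; apply: mem_nth.
by rewrite ltNge hd.
Qed.

End RootNear.

(** * Branches of zeros as functions of [g] *)

Section Enclosure.
Variable R : realType.
Implicit Types (v y z : R[i]).
Variable k : nat.
Let n := k.+4.+1.

(** The counterpart of [prim] as a polynomial in [v], the variable in which the zeros are
    enclosed. *)
Definition vprim (j : nat) : {poly R[i]} := (j.+1%:R^-1 : R)%:C *: (1 - 'X ^+ j.+1).
Definition vpol (g : R) : {poly R[i]} := vprim k.+4 + g%:C *: vprim k.+3 - g%:C *: vprim k.+2.

Lemma horner_vprim j v : (vprim j).[v] = primv j v.
Proof. by rewrite /vprim /primv -polyC1 !(hornerZ, hornerD, hornerN, hornerXn, hornerC). Qed.

Lemma horner_vpol g v : (vpol g).[v] = valF k g v.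
Proof. by rewrite /vpol !(horner_vprim, hornerD, hornerN, hornerZ). Qed.

Lemma deriv_vprim j : (vprim j)^`() = - 'X ^+ j.
Proof.
rewrite /vprim derivZ derivB -polyC1 derivC sub0r derivXn scalerN -(scaler_nat j.+1 (_ ^+ _)) scalerA.
have -> : (j.+1%:R^-1 : R)%:C * j.+1%:R = 1 :> R[i].
  by rewrite -(rmorph_nat (real_complex R)) -rmorphM /= mulVf // pnatr_eq0.
by rewrite scale1r.
Qed.

Lemma deriv_vpol g :
  (vpol g)^`() = - ('X ^+ k.+2 * ('X ^+ 2 + (g%:C *: 'X - g%:C%:P))).
Proof.
rewrite /vpol !(deriv_vprim, derivB, derivD, derivN, derivZ) -!mul_polyC.
by rewrite !exprS; move: ('X ^+ k) => w; ring.
Qed.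

Lemma horner_deriv_vpol g v : (vpol g)^`().[v] = - valh k g v.
Proof.
rewrite deriv_vpol hornerN hornerM hornerXn /valh; congr (- (_ * _)).
by rewrite !(hornerD, hornerN, hornerZ, hornerXn, hornerX, hornerC) addrA.
Qed.

Lemma size_vpol g : size (vpol g) = n.+1.
Proof.
have h : size (vpol g)^`() = n.
  have s2 : (size (g%:C *: 'X - g%:C%:P : {poly R[i]})%R < 3)%N.
    rewrite ltnS; apply: leq_trans (size_polyD _ _) _; rewrite size_polyN geq_max.
    apply/andP; split; last exact: leq_trans (size_polyC_leq1 _) _.
    by apply: leq_trans (size_scale_leq _ _) _; rewrite size_polyX.
  have s3 : size ('X ^+ 2 + (g%:C *: 'X - g%:C%:P) : {poly R[i]}) = 3%N.
    by rewrite size_polyDl size_polyXn.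
  rewrite deriv_vpol size_polyN size_monicM ?monicXn //.
    by rewrite size_polyXn s3 addnC.
  by rewrite -size_poly_gt0 s3.
by move: h; rewrite size_deriv_complex; case: (size _) => [//|j] /= ->.
Qed.

Lemma valF_root_near g v (d : R) : valh k g v != 0 ->
  n%:R * cmod (valF k g v) <= d * cmod (valh k g v) ->
  exists2 y, valF k g y = 0 & cmod (y - v) <= d.
Proof.
move=> h0 hd.
have [||y yr yd] := root_near (d := d) (x := v) (size_vpol g).
- by rewrite horner_deriv_vpol oppr_eq0.
- by rewrite horner_vpol horner_deriv_vpol cmodN.
by exists y => //; move/rootP: yr; rewrite horner_vpol.
Qed.

Variables (g0 g1 r : R) (cs : seq R[i]).
Hypotheses (g01 : g0 <= g1) (r0 : 0 < r) (scs : size cs = n) (ucs : uniq cs).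
Hypothesis cs_near : forall g c, g0 <= g <= g1 -> c \in cs ->
  valh k g c != 0 /\ n%:R * cmod (valF k g c) <= r * cmod (valh k g c).
Hypothesis cs_sep : forall c c', c \in cs -> c' \in cs -> c != c' -> 4 * r < cmod (c - c').

(** The disks around the centers are disjoint and each contains a zero. Their number is the degree,
    so one zero more would exceed it. *)
Lemma root_branches : exists T : R -> R[i] -> R[i], forall g, g0 <= g <= g1 ->
  (forall c, c \in cs -> valF k g (T g c) = 0 /\ cmod (T g c - c) <= r) /\
  (forall y, valF k g y = 0 -> exists2 c, c \in cs & y = T g c).
Proof.
suff H g : exists f : R[i] -> R[i], g0 <= g <= g1 ->
  (forall c, c \in cs -> valF k g (f c) = 0 /\ cmod (f c - c) <= r) /\
  (forall y, valF k g y = 0 -> exists2 c, c \in cs & y = f c).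
  by have [T HT] := choice H; exists T.
case: (EM (g0 <= g <= g1)) => hg; last by exists id.
have [f Hf] : exists f : R[i] -> R[i], forall c, c \in cs ->
    valF k g (f c) = 0 /\ cmod (f c - c) <= r.
  suff H c : exists y, c \in cs -> valF k g y = 0 /\ cmod (y - c) <= r.
    by have [f Hf] := choice H; exists f.
  case: (EM (c \in cs)) => hc; last by exists 0.
  have [h1 h2] := cs_near hg hc.
  by have [y y1 y2] := valF_root_near h1 h2; exists y.
exists f => _; split => // y hy; apply: contrapT => hno.
have injf : {in cs &, injective f}.
  move=> c c' hc hc' e; apply/eqP/negPn/negP => cc.
  have := cs_sep hc hc' cc; have [_ h1] := Hf c hc; have [_ h2] := Hf c' hc'.
  rewrite -e in h2; have := cmod_dist3 c (f c) c'; rewrite (cmod_distC c (f c)).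
  by move: h1 h2 r0; lra.
have un : uniq (y :: map f cs).
  rewrite /= map_inj_in_uniq // ucs andbT; apply/mapP => -[c hc e].
  by apply: hno; exists c.
have v0 : vpol g != 0 by rewrite -size_poly_gt0 size_vpol.
have hr : all (root (vpol g)) (y :: map f cs).
  rewrite /= rootE horner_vpol hy eqxx /=; apply/allP => _ /mapP[c hc ->].
  by rewrite rootE horner_vpol (Hf c hc).1.
by have := max_poly_roots v0 hr un; rewrite size_vpol /= size_map scs ltnn.
Qed.

Variable T : R -> R[i] -> R[i].
Hypothesis HT : forall g, g0 <= g <= g1 ->
  (forall c, c \in cs -> valF k g (T g c) = 0 /\ cmod (T g c - c) <= r) /\
  (forall y, valF k g y = 0 -> exists2 c, c \in cs & y = T g c).

(** The separation [4 * r] leaves room for the radius [3 * r]. The slack is what allows a zero found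
    from another parameter or from a sharper center to be identified with its branch. *)
Lemma branch_unique g y c : g0 <= g <= g1 -> valF k g y = 0 -> c \in cs ->
  cmod (y - c) <= 3 * r -> y = T g c.
Proof.
move=> hg hy hc hd; have [H1 H2] := HT hg; have [c' hc' e] := H2 y hy.
rewrite {1}e; congr (T g _); apply/eqP/negPn/negP => cc.
have [_ h] := H1 c' hc'; rewrite -e in h.
have := cs_sep hc' hc cc; have := cmod_dist3 c' y c; rewrite (cmod_distC c' y).
by move: h hd; lra.
Qed.

Lemma valF_diff (g g' : R) y : valF k g' y = valF k g y - (g' - g)%:C * valB k y.
Proof. by rewrite /valF /valB rmorphB /=; ring. Qed.

(** A zero for [g] is an approximate zero for [g'], because [valF] is affine in the parameter; so a
    true zero lies within [d], a multiple of [|g - g'|]. If [d <= 2 * r], that zero is within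
    [3 * r] of [c] and belongs to the branch. Otherwise [d] exceeds [2 * r], which bounds the
    distance of any two points in the disk around [c]. *)
Lemma branch_lipschitz c (kap : R) : c \in cs -> 0 < kap ->
  (forall g y, g0 <= g <= g1 -> cmod (y - c) <= r -> kap <= cmod (valh k g y)) ->
  exists2 L : R, 0 <= L & forall g g', g0 <= g <= g1 -> g0 <= g' <= g1 ->
    cmod (T g c - T g' c) <= L * `|g - g'|.
Proof.
move=> hc kap0 hk.
pose rr : R := 1 + (1 + cmod c + r).
have rr1 : 1 <= rr by rewrite /rr; have := cmod_ge0 c; move: r0; lra.
pose P := pnorm rr (polB R k); have P0 : 0 <= P by apply: pnorm_ge0.
exists (n%:R * P / kap); first by rewrite !mulr_ge0 // invr_ge0 ltW.
move=> g g' hg hg'; have [H1 _] := HT hg; have [H1' _] := HT hg'.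
have [e1 d1] := H1 c hc; have [e2 d2] := H1' c hc.
set y := T g c in e1 d1 *; set y' := T g' c in e2 d2 *.
have hB : cmod (valB k y) <= P.
  rewrite -[y](subKr 1) -horner_polB; apply: cmod_horner => //.
  have := cmodB 1 y; rewrite cmod1; have := cmodD (y - c) c; rewrite subrK /rr.
  by move: d1; lra.
pose d := n%:R * P / kap * `|g - g'|.
have hy : kap <= cmod (valh k g' y) by apply: hk.
have h0 : valh k g' y != 0 by rewrite -cmod_gt0 (lt_le_trans kap0).
have d0 : 0 <= d by rewrite !mulr_ge0 // invr_ge0 ltW.
have [|z hz zd] := valF_root_near (d := d) h0.
  rewrite (valF_diff g g') e1 sub0r cmodN cmodM cmodR.
  apply: (@le_trans _ _ (d * kap)); last by rewrite ler_wpM2l.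
  rewrite /d mulrAC divfK ?gt_eqF // -mulrA ler_wpM2l // mulrC distrC.
  by rewrite ler_wpM2r.
have [dr|dr] := leP d (2 * r).
  suff <- : z = y' by rewrite cmod_distC.
  apply: branch_unique => //.
  have := cmod_dist3 z y c; move: d1 zd dr; lra.
apply: le_trans (ltW dr); have := cmod_dist3 y c y'; rewrite (cmod_distC c y').
by move: d1 d2; lra.
Qed.

End Enclosure.

(* Degree [ck + 5]; [g] within [cgr] of [cg]; the zeros within [cr] of [1], of the contact points
   [cc 0], [cc 1], [cc 2] and of [crest]; the contact zeros within [cre] of [ce b i] when [g] is
   the upper ([b = true]) or lower end of its range. *)
Record cert := Cert {
  ck : nat; cg : Z; cgr : Z; cr : Z; cre : Z; cM : ball;
  cc : nat -> Z * Z; crest : seq (Z * Z);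
  ce : bool -> nat -> Z * Z }.

Definition cpt (z : Z * Z) : cball := (bexact z.1, bexact z.2).
Definition cbox (e : Z) (z : Z * Z) : cball := ((z.1, e), (z.2, e)).
Definition ctm (u : cball) : cball := csub (creal (bint 1%SZ)) u.

(** The hypothesis of [valF_root_near] in integers: the modulus of [F] is bounded by the sum of its
    parts, that of [h] from below by the larger part. The factor [scaleZ] compensates for the right
    side being a product of two scaled numbers. *)
Definition near_ok (k : nat) (g : ball) (e : Z) (z : Z * Z) : bool :=
  let v := cpt z in let P := bpowers k v in let F := bF g P in let h := bh g v P in
  let ub (b : ball) := Z.add (Z.abs b.1) b.2 in let lb (b : ball) := Z.sub (Z.abs b.1) b.2 in
  let lh := Z.max (lb h.1) (lb h.2) in let n := Z.of_nat k.+4.+1 in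
  Z.ltb 0 lh && Z.leb (Z.mul (Z.mul n (Z.add (ub F.1) (ub F.2))) scaleZ) (Z.mul e lh).

Definition sep_rel (r : Z) (z w : Z * Z) : bool :=
  let dx := Z.sub z.1 w.1 in let dy := Z.sub z.2 w.2 in
  Z.ltb (Z.mul 16%SZ (Z.mul r r)) (Z.add (Z.mul dx dx) (Z.mul dy dy)).

(** A zero within [e] of [z] is then within [3 * r] of [w], the radius in which [branch_unique]
    applies. *)
Definition within_ok (e r : Z) (z w : Z * Z) : bool :=
  Z.leb (Z.add (Z.add (Z.abs (Z.sub z.1 w.1)) (Z.abs (Z.sub z.2 w.2))) e) (Z.mul 3%SZ r).

Definition bdet (u0 u1 u2 : cball) : ball :=
  let t0 := ctm u0 in let t1 := ctm u1 in let t2 := ctm u2 in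
  badd (badd (bmul (csqr t0) (bsub t1.1 t2.1)) (bmul (csqr t1) (bsub t2.1 t0.1)))
       (bmul (csqr t2) (bsub t0.1 t1.1)).

Definition bminor (Z1 B1 Z2 B2 : ball) : ball := bsub (bmul Z1 B2) (bmul Z2 B1).

(** * The boolean checks performed on a certificate *)

Section Check.
Variable c : cert.
Let k := ck c.
Let r := cr c.
Let gB : ball := (cg c, cgr c).
Let M := cM c.
Let end_g (b : bool) : Z := if b then Z.add (cg c) (cgr c) else Z.sub (cg c) (cgr c).
Let box i := cbox r (cc c i).
Definition one_pt : Z * Z := (scaleZ, Z0).
(** The head is the zero [v = 1], that is [t = 0], the image of [beta]; [behead] removes it from the
    checks on the other zeros. *)
Definition centers : seq (Z * Z) := one_pt :: [seq cc c i | i <- iota 0 3] ++ crest c.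

Definition det_end (b : bool) : ball :=
  bdet (cbox (cre c) (ce c b 0)) (cbox (cre c) (ce c b 1)) (cbox (cre c) (ce c b 2)).

(** With [k.+1] further centers the total is the degree [k + 5]. The last clause asks for opposite
    signs of the determinant at the two ends of the range of [g]. *)
Definition check_branches : bool :=
  [&& size (crest c) == k.+1, all (near_ok k gB r) centers, pairwise (sep_rel r) centers,
    Z.ltb 0 r, Z.leb 0 (cgr c),
    all (fun i => bpos (csqr (bh gB (box i) (bpowers k (box i))))) (iota 0 3),
    all (fun b => all (fun i => near_ok k (bexact (end_g b)) (cre c) (ce c b i)
                        && within_ok (cre c) r (ce c b i) (cc c i)) (iota 0 3)) [:: true; false]
    & (bpos (det_end true) && bpos (bopp (det_end false)))
      || (bpos (det_end false) && bpos (bopp (det_end true)))].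

Let t i := ctm (box i).
Let D := bsub (t 0%N).1 (t 1%N).1.
Let N := bsub (csqr (t 0%N)) (csqr (t 1%N)).
Let Mlo := bexact (Z.sub M.1 M.2).
Let Mhi := bexact (Z.add M.1 M.2).
Let K := bsub (csqr (t 0%N)) (bmul (bscal 2%SZ M) (t 0%N).1).

(** The exact center satisfies [2 * M * D = N]. The ball is checked without division, by multiplying
    its ends by [D], for either sign of [D]. *)
Definition check_circle : bool :=
  [&& bpos (badd gB (bint 4%SZ)), bpos (bopp gB), bpos M, bpos K
    & [&& bpos D, bpos (bsub N (bmul (bscal 2%SZ Mlo) D)) & bpos (bsub (bmul (bscal 2%SZ Mhi) D) N)]
      || [&& bpos (bopp D), bpos (bsub (bmul (bscal 2%SZ Mlo) D) N)
           & bpos (bsub N (bmul (bscal 2%SZ Mhi) D))]].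

(** Contact zeros and their conjugates lie on the circle, where no strict inequality can be
    certified; they are recognised by their integer centers instead. *)
Definition inside_ok (z : Z * Z) : bool :=
  let u := ctm (cbox r z) in
  [|| bpos (bsub (badd (bmul (bscal 2%SZ M) u.1) K) (csqr u)), z \in [seq cc c i | i <- iota 0 3]
    | (z.1, Z.opp z.2) \in [seq cc c i | i <- iota 0 3]].

Definition crit_ok (z : Z * Z) : bool :=
  let v := cbox r z in let u := ctm v in let g2 := badd (bint 2%SZ) gB in
  let w := bsub (csqr u) (bmul g2 u.1) in
  bpos (bsub (bint 1%SZ) (csqr v))
  || bpos (bsub (bmul (bmul v.2 v.2) (bsub (bint 4%SZ) (bmul g2 g2))) (bmul w w)).

Let Rw i := brows gB M (box i) (bpowers k (box i)).

Definition check_rows (R0 R1 R2 : rows) : bool :=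
  let l0 := bminor (rZ R1) (rB R1) (rZ R2) (rB R2) in
  let l1 := bminor (rZ R2) (rB R2) (rZ R0) (rB R0) in
  let l2 := bminor (rZ R0) (rB R0) (rZ R1) (rB R1) in
  let cmb F := badd (badd (bmul l0 (F R0)) (bmul l1 (F R1))) (bmul l2 (F R2)) in
  let cA := cmb rA in let d := bsub (bmul (rI R0) (rU R1)) (bmul (rI R1) (rU R0)) in
  [&& bpos l0, bpos l1, bpos l2, bpos cA, bpos (badd cA (cmb rE)), bpos (cmb rX)
    & bpos d || bpos (bopp d)].

Definition check_extremal : bool :=
  [&& all inside_ok (behead centers), all crit_ok (behead centers)
    & check_rows (Rw 0) (Rw 1) (Rw 2)].

Definition check : bool := [&& check_branches, check_circle & check_extremal].
End Check.


Lemma pairwise_sym_mem (T : eqType) (e : rel T) (s : seq T) (x y : T) : symmetric e ->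
  pairwise e s -> x \in s -> y \in s -> x != y -> e x y.
Proof.
move=> se; elim: s => [//|a s IH] /= /andP[/allP ha hs].
rewrite !inE => /orP[/eqP->|xs] /orP[/eqP->|ys]; rewrite ?eqxx // => xy.
- exact: ha.
- by rewrite se; apply: ha.
- exact: IH.
Qed.

Lemma check_rowsP R0 R1 R2 : check_rows R0 R1 R2 ->
  let l0 := bminor (rZ R1) (rB R1) (rZ R2) (rB R2) in
  let l1 := bminor (rZ R2) (rB R2) (rZ R0) (rB R0) in
  let l2 := bminor (rZ R0) (rB R0) (rZ R1) (rB R1) in
  let cmb F := badd (badd (bmul l0 (F R0)) (bmul l1 (F R1))) (bmul l2 (F R2)) in
  let d := bsub (bmul (rI R0) (rU R1)) (bmul (rI R1) (rU R0)) in
  [/\ [/\ bpos l0, bpos l1 & bpos l2], bpos (cmb rA), bpos (badd (cmb rA) (cmb rE)),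
    bpos (cmb rX) & bpos d \/ bpos (bopp d)].
Proof.
rewrite /check_rows; cbv zeta; move: (bminor _ _ _ _) (bminor _ _ _ _) (bminor _ _ _ _).
move=> l2 l1 l0 /andP[p0 /andP[p1 /andP[p2 /andP[pA /andP[pE /andP[pX /orP pD]]]]]].
by split.
Qed.

(** * Soundness of the checks *)

Section Soundness.
Variable R : realType.
Variable c : cert.
Implicit Types (z w : Z * Z) (u v y : R[i]).
Local Notation zr := (zr R).
Local Notation S := (zr scaleZ).
Local Notation k := (ck c).
Local Notation r := (cr c).

Definition real_of (a : Z) : R := zr a / S.
Definition pt z : R[i] := real_of z.1 +i* real_of z.2.

Lemma real_ofD a b : real_of (Z.add a b) = real_of a + real_of b.
Proof. by rewrite /real_of zrD mulrDl. Qed.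

Lemma real_ofB a b : real_of (Z.sub a b) = real_of a - real_of b.
Proof. by rewrite /real_of zrB mulrBl. Qed.

Lemma real_of_le a b : Z.leb a b -> real_of a <= real_of b.
Proof. by move=> h; rewrite /real_of ler_pM2r ?invr_gt0 ?scale_gt0 // zr_le. Qed.

Lemma real_of_abs a : real_of (Z.abs a) = `|real_of a|.
Proof. by rewrite /real_of zr_abs normrM normfV (gtr0_norm (scale_gt0 R)). Qed.

Lemma inb_real_of (x : R) (a e : Z) : inb x (a, e) <-> `|x - real_of a| <= real_of e.
Proof.
have E : `|x * S - zr a| = `|x - real_of a| * S.
  have -> : x * S - zr a = (x - real_of a) * S.
    by rewrite mulrBl divfK // gt_eqF // scale_gt0.
  by rewrite normrM (gtr0_norm (scale_gt0 R)).
by rewrite /inb E /real_of ler_pdivlMr ?scale_gt0.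
Qed.

Lemma inc_pt z : inc (pt z) (cpt z).
Proof. by split; apply: inb_exact. Qed.

Lemma inc_box y z (e : Z) : cmod (y - pt z) <= real_of e -> inc y (cbox e z).
Proof.
move=> h; split; apply/inb_real_of; apply: le_trans h.
  by have := Re_le_cmod (y - pt z); case: y.
by have := Im_le_cmod (y - pt z); case: y.
Qed.

Lemma inb_lower (x : R) (b : ball) : inb x b -> real_of (Z.sub (Z.abs b.1) b.2) <= `|x|.
Proof.
case: b => a e /inb_real_of /= h; rewrite real_ofB real_of_abs.
have := ler_normB x (x - real_of a); rewrite subKr; lra.
Qed.

Lemma inb_upper (x : R) (b : ball) : inb x b -> `|x| <= real_of (Z.add (Z.abs b.1) b.2).
Proof.
case: b => a e /inb_real_of /= h; rewrite real_ofD real_of_abs.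
have := ler_normD (x - real_of a) (real_of a); rewrite subrK; lra.
Qed.

Lemma inb_ge (x : R) (b : ball) : inb x b -> real_of (Z.sub b.1 b.2) <= x.
Proof. by case: b => m e /inb_real_of; rewrite real_ofB ler_norml => /andP[]; lra. Qed.

Lemma inb_between (x : R) (b : ball) :
  real_of (Z.sub b.1 b.2) <= x -> x <= real_of (Z.add b.1 b.2) -> inb x b.
Proof.
case: b => m e; rewrite real_ofB real_ofD /= => h1 h2; apply/inb_real_of.
by rewrite ler_norml; apply/andP; split; lra.
Qed.

Lemma real_of_gt0 a : Z.ltb 0 a -> 0 < real_of a.
Proof. by move=> h; rewrite divr_gt0 ?scale_gt0 // -(zr0 R) zr_lt. Qed.

Lemma bpos_gt0 (b : ball) : bpos b -> 0 < real_of (Z.sub b.1 b.2).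
Proof. by rewrite /bpos => h; apply: real_of_gt0; lia. Qed.

Lemma sep_sym e : symmetric (sep_rel e).
Proof. by move=> z w; rewrite /sep_rel; congr (Z.ltb _ _); ring. Qed.

Lemma sep_irr (e : Z) z : Z.ltb 0 e -> sep_rel e z z = false.
Proof. by rewrite /sep_rel => h; apply/negbTE/negP; nia. Qed.

Lemma near_ok_sound (g : R) (gb : ball) (e : Z) z : inb g gb -> near_ok k gb e z ->
  valh k g (pt z) != 0 /\
  k.+4.+1%:R * cmod (valF k g (pt z)) <= real_of e * cmod (valh k g (pt z)).
Proof.
move=> hg; rewrite /near_ok; cbv zeta.
have hF := inc_F hg (inc_pt z) (erefl (bpowers k (cpt z))).
have hh := inc_h hg (inc_pt z) (erefl (bpowers k (cpt z))).
move: (bF gb (bpowers k (cpt z))) (bh gb (cpt z) (bpowers k (cpt z))) hF hh => F h [F1 F2] [h1 h2].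
set lh := Z.max _ _ => /andP[hl hc].
have lhle : real_of lh <= cmod (valh k g (pt z)).
  have [->|->] : lh = Z.sub (Z.abs h.1.1) h.1.2 \/ lh = Z.sub (Z.abs h.2.1) h.2.2.
    by rewrite /lh; lia.
    by apply: le_trans (inb_lower h1) _; exact: Re_le_cmod.
  by apply: le_trans (inb_lower h2) _; exact: Im_le_cmod.
have Sp := scale_gt0 R.
have lp : 0 < real_of lh by rewrite divr_gt0 // -(zr0 R) zr_lt.
split; first by rewrite -cmod_gt0 (lt_le_trans lp).
have Fle : cmod (valF k g (pt z)) <=
    real_of (Z.add (Z.add (Z.abs F.1.1) F.1.2) (Z.add (Z.abs F.2.1) F.2.2)).
  rewrite real_ofD; apply: le_trans (cmod_le_ReIm _) _; apply: lerD; exact: inb_upper.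
set ub := Z.add _ _ in Fle hc.
have hc' : k.+4.+1%:R * real_of ub <= real_of e * real_of lh.
  have := zr_le R hc; rewrite (zrM R (Z.mul _ ub) scaleZ) (zrM R _ ub) (zrM R e lh) zr_nat.
  rewrite /real_of; move: (zr ub) (zr e) (zr lh) S Sp => U e' l s sp hh.
  rewrite -(ler_pM2r sp) -(ler_pM2r sp).
  have -> : k.+4.+1%:R * (U / s) * s * s = k.+4.+1%:R * U * s by field; rewrite gt_eqF.
  by have -> : e' / s * (l / s) * s * s = e' * l by field; rewrite gt_eqF.
have n0 : 0 <= k.+4.+1%:R :> R by [].
have e0 : 0 <= real_of e.
  rewrite -(pmulr_lge0 _ lp); apply: le_trans hc'; rewrite mulr_ge0 //.
  exact: le_trans Fle.
apply: le_trans (ler_wpM2l n0 Fle) _; apply: le_trans hc' _; exact: ler_wpM2l.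
Qed.

Lemma pt_inj z w : pt z = pt w -> z = w.
Proof.
have inj a b : real_of a = real_of b -> a = b.
  move=> /(mulIf (invr_neq0 (lt0r_neq0 (scale_gt0 R)))) h.
  apply/eqP/negPn/negP => ab.
  have : Z.ltb a b || Z.ltb b a by move/eqP: ab; lia.
  by case/orP => /(@zr_lt R); rewrite h ltxx.
by case: z w => [a b] [a' b'] [] /inj -> /inj ->.
Qed.

Lemma sep_sound (e : Z) z w : Z.ltb 0 e -> sep_rel e z w -> 4 * real_of e < cmod (pt z - pt w).
Proof.
move=> e0; rewrite /sep_rel; set dx := Z.sub _ _; set dy := Z.sub z.2 _ => /(@zr_lt R).
have Sp := scale_gt0 R.
have ep : 0 < real_of e by rewrite divr_gt0 // -(zr0 R) zr_lt.
have z16 : zr 16%SZ = 16 by exact: (zr_nat R 16).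
rewrite (zrM R 16%SZ) zrD !(zrM R e, zrM R dx, zrM R dy) z16 => h.
have e4 : 0 <= 4 * real_of e by rewrite pmulr_rge0 // ltW.
rewrite -(ltr_pXn2r (n := 2)) ?nnegrE ?cmod_ge0 ?e4 //.
have -> : cmod (pt z - pt w) ^+ 2 = real_of dx ^+ 2 + real_of dy ^+ 2.
  by rewrite cmod_sqr /= !real_ofB.
rewrite /real_of -(ltr_pM2r (exprn_gt0 2 Sp)).
have Sn : S != 0 by rewrite gt_eqF.
move: (zr e) (zr dx) (zr dy) S Sp Sn h => e' x y s sp sn h.
have -> : (4 * (e' / s)) ^+ 2 * s ^+ 2 = 16 * (e' * e') by field.
by have -> : ((x / s) ^+ 2 + (y / s) ^+ 2) * s ^+ 2 = x * x + y * y by field.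
Qed.

Lemma within_sound (e r' : Z) z w y : within_ok e r' z w -> cmod (y - pt z) <= real_of e ->
  cmod (y - pt w) <= 3 * real_of r'.
Proof.
rewrite /within_ok => /real_of_le; rewrite !real_ofD !real_of_abs !real_ofB => h hy.
have z3 : real_of (Z.mul 3%SZ r') = 3 * real_of r'.
  by rewrite /real_of zrM (_ : zr 3%SZ = 3) ?mulrA //; exact: (zr_nat R 3).
rewrite z3 in h; apply: le_trans (cmod_dist3 _ (pt z) _) _.
have := cmod_le_ReIm (pt z - pt w); rewrite /= => h2.
by move: h hy h2; lra.
Qed.

Lemma inc_tm u (a : cball) : inc u a -> inc (1 - u) (ctm a).
Proof. by move=> h; apply: inc_sub h; apply: inc_1. Qed.

(* Vanishes when the points [1 - u], [1 - v], [1 - y] lie on a common curve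
   [|t|^2 = 2 * M * Re t + K]. *)
Definition det3 (u v y : R[i]) : R :=
  cmod (1 - u) ^+ 2 * (complex.Re (1 - v) - complex.Re (1 - y))
  + cmod (1 - v) ^+ 2 * (complex.Re (1 - y) - complex.Re (1 - u))
  + cmod (1 - y) ^+ 2 * (complex.Re (1 - u) - complex.Re (1 - v)).

Lemma inb_det u v y (a b d : cball) : inc u a -> inc v b -> inc y d ->
  inb (det3 u v y) (bdet a b d).
Proof.
move=> /inc_tm hu /inc_tm hv /inc_tm hy.
have su := inb_sqr hu; have sv := inb_sqr hv; have sy := inb_sqr hy.
case: hu hv hy => [u1 _] [v1 _] [y1 _].
by apply: inb_add; [apply: inb_add|]; apply: inb_mul => //; apply: inb_sub.
Qed.

Let g0 := real_of (Z.sub (cg c) (cgr c)).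
Let g1 := real_of (Z.add (cg c) (cgr c)).
Let cs := map pt (centers c).
Let gB : ball := (cg c, cgr c).
Let box i := cbox r (cc c i).

Hypothesis Hb : check_branches c.

Lemma g_in g : g0 <= g <= g1 -> inb g gB.
Proof. by move=> /andP[h1 h2]; apply: (@inb_between g gB). Qed.

Lemma ends_le : g0 <= g1.
Proof.
have /andP[_ /andP[_ /andP[_ /andP[_ /andP[gr0 _]]]]] := Hb.
have h : 0 <= real_of (cgr c) by have := real_of_le gr0; rewrite /real_of zr0 mul0r.
rewrite /g0 /g1 real_ofD real_ofB; rewrite lerD2l.
by rewrite (le_trans _ h) // oppr_le0.
Qed.

Lemma cc_centers i : (i < 3)%N -> cc c i \in centers c.
Proof.
move=> hi; rewrite inE mem_cat; apply/orP; right; apply/orP; left.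
by apply: map_f; rewrite mem_iota.
Qed.

Lemma contactP w : w \in [seq cc c i | i <- iota 0 3] -> exists2 i, (i < 3)%N & w = cc c i.
Proof. by case/mapP => i; rewrite mem_iota add0n => /andP[_ hi] ->; exists i. Qed.

(** Along the Lipschitz branches the determinant has opposite signs at the two ends, so it vanishes
    somewhere in between. Nothing more is known about this [g], which is why the other checks use a
    ball covering the whole range. *)
Lemma branches_sound : exists T : R -> R[i] -> R[i],
  [/\ forall g, g0 <= g <= g1 -> (forall z, z \in centers c ->
         valF k g (T g (pt z)) = 0 /\ cmod (T g (pt z) - pt z) <= real_of r) /\
         (forall y, valF k g y = 0 -> exists2 z, z \in centers c & y = T g (pt z)),
      forall g y z, g0 <= g <= g1 -> valF k g y = 0 -> z \in centers c ->
         cmod (y - pt z) <= 3 * real_of r -> y = T g (pt z)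
    & exists2 g, g0 <= g <= g1 &
        det3 (T g (pt (cc c 0))) (T g (pt (cc c 1))) (T g (pt (cc c 2))) = 0].
Proof.
have /andP[hsz /andP[hnear /andP[hsep /andP[r0 /andP[_ /andP[hkap /andP[hend hdet]]]]]]] := Hb.
have g01 := ends_le; have rp := real_of_gt0 r0.
have scs : size cs = k.+4.+1 by rewrite size_map /= (eqP hsz).
have ucs : uniq cs.
  rewrite map_inj_uniq; last exact: pt_inj.
  by apply: pairwise_uniq hsep => z; apply: sep_irr.
have csP y : y \in cs -> exists2 z, z \in centers c & y = pt z by move/mapP.
have cs_near g y : g0 <= g <= g1 -> y \in cs ->
    valh k g y != 0 /\ k.+4.+1%:R * cmod (valF k g y) <= real_of r * cmod (valh k g y).
  move=> /g_in hg /csP[z hz ->]; apply: near_ok_sound hg _; exact: (allP hnear).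
have cs_sep y y' : y \in cs -> y' \in cs -> y != y' -> 4 * real_of r < cmod (y - y').
  move=> /csP[z hz ->] /csP[w hw ->] zw; apply: sep_sound => //.
  apply: (pairwise_sym_mem (sep_sym r) hsep hz hw).
  by apply: contraNneq zw => ->.
have [T HT] := root_branches rp scs ucs cs_near cs_sep.
have mpt z : z \in centers c -> pt z \in cs by move=> hz; apply: map_f.
have Tuniq g y z : g0 <= g <= g1 -> valF k g y = 0 -> z \in centers c ->
         cmod (y - pt z) <= 3 * real_of r -> y = T g (pt z).
  by move=> hg hy hz; apply: (branch_unique cs_sep HT hg hy (mpt z hz)).
exists T; split => //.
  move=> g hg; have [H1 H2] := HT g hg; split; first by move=> z /mpt; apply: H1.
  by move=> y /H2[_ /mapP[z hz ->] ->]; exists z.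
have ccin := cc_centers.
(* The check [hkap] bounds [valh], up to sign the derivative in [v], away from zero on the whole box
   around the contact zero. *)
have lip i : (i < 3)%N -> exists2 L : R, 0 <= L & forall g g', g0 <= g <= g1 ->
    g0 <= g' <= g1 -> cmod (T g (pt (cc c i)) - T g' (pt (cc c i))) <= L * `|g - g'|.
  move=> hi; have /(allP hkap) hp : i \in iota 0 3 by rewrite mem_iota.
  set B := bh _ _ _ in hp.
  have hB g y : g0 <= g <= g1 -> cmod (y - pt (cc c i)) <= real_of r ->
      inb (cmod (valh k g y) ^+ 2) (csqr B).
    move=> /g_in hg hy; apply: inb_sqr; apply: inc_h => //; exact: inc_box.
  pose q := real_of (Z.sub (csqr B).1 (csqr B).2).
  have q0 : 0 < q by exact: bpos_gt0.
  apply: (branch_lipschitz rp cs_sep HT (kap := Num.sqrt q)).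
  - exact: mpt (ccin i hi).
  - by rewrite sqrtr_gt0.
  move=> g y hg hy; have := hB g y hg hy.
  move=> /inb_ge h.
  by rewrite -(ler_pXn2r (n := 2)) ?nnegrE ?cmod_ge0 ?sqrtr_ge0 // sqr_sqrtr ?(ltW q0).
have part (f : R[i] -> R) i : (i < 3)%N -> (forall u v, f (u - v) = f u - f v) ->
    (forall u, `|f u| <= cmod u) -> lipb g0 g1 (fun g => f (T g (pt (cc c i)))).
  move=> hi fB fle; have [L L0 HL] := lip i hi.
  exists L, (real_of r + cmod (pt (cc c i))); split => //.
  - by rewrite addr_ge0 // ltW.
  - move=> g hg; apply: le_trans (fle _) _; have [H1 _] := HT g hg.
    have [_ h] := H1 _ (mpt _ (ccin i hi)).
    have := cmodD (T g (pt (cc c i)) - pt (cc c i)) (pt (cc c i)); rewrite subrK.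
    by move/le_trans; apply; apply: lerD.
  - by move=> g g' hg hg'; rewrite -fB; apply: le_trans (fle _) (HL _ _ hg hg').
have re i : (i < 3)%N -> lipb g0 g1 (fun g => complex.Re (1 - T g (pt (cc c i)))).
  move=> hi.
  have h := lipbD (lipb_cst g0 g1 1) (lipbN (part (@complex.Re R) i hi
    (fun u v => raddfB _ u v) (@Re_le_cmod R))).
  by congr lipb: h; apply/funext => g; case: (T g _).
have im i : (i < 3)%N -> lipb g0 g1 (fun g => complex.Im (1 - T g (pt (cc c i)))).
  move=> hi.
  have h := lipbN (part (@complex.Im R) i hi (fun u v => raddfB _ u v) (@Im_le_cmod R)).
  by congr lipb: h; apply/funext => g; case: (T g _) => a b; rewrite /= sub0r.
have sq i : (i < 3)%N -> lipb g0 g1 (fun g => cmod (1 - T g (pt (cc c i))) ^+ 2).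
  move=> hi; have h := lipbD (lipbM (re i hi) (re i hi)) (lipbM (im i hi) (im i hi)).
  by congr lipb: h; apply/funext => g; rewrite cmod_sqr !expr2.
pose dt g := det3 (T g (pt (cc c 0))) (T g (pt (cc c 1))) (T g (pt (cc c 2))).
have ldt : lipb g0 g1 dt.
  have df i j : (i < 3)%N -> (j < 3)%N -> lipb g0 g1 (fun g =>
      complex.Re (1 - T g (pt (cc c i))) - complex.Re (1 - T g (pt (cc c j)))).
    by move=> hi hj; exact: lipbD (re i hi) (lipbN (re j hj)).
  exact: lipbD (lipbD (lipbM (sq 0%N isT) (df 1%N 2%N isT isT))
    (lipbM (sq 1%N isT) (df 2%N 0%N isT isT))) (lipbM (sq 2%N isT) (df 0%N 1%N isT isT)).
(* The range of [g] is so short that boxes of radius [r] could not decide the sign; the sharper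
   centers [ce] are used, and [Tuniq] identifies their zeros with the branches. *)
have ends (b : bool) : inb (dt (if b then g1 else g0)) (det_end c b).
  have gin : g0 <= (if b then g1 else g0) <= g1 by case: b; rewrite lexx g01.
  have /(allP hend) hb : b \in [:: true; false] by case: b {gin}.
  have ge : inb (if b then g1 else g0) (bexact (if b then Z.add (cg c) (cgr c)
      else Z.sub (cg c) (cgr c))) by case: (b); apply: inb_exact.
  have one i : (i < 3)%N -> inc (T (if b then g1 else g0) (pt (cc c i))) (cbox (cre c) (ce c b i)).
    move=> hi; have /(allP hb) /andP[hn hw] : i \in iota 0 3 by rewrite mem_iota.
    have [h0 h1] := near_ok_sound ge hn.
    have [y hy yd] := valF_root_near h0 h1.
    rewrite -(Tuniq _ y _ gin hy (ccin i hi)); first exact: inc_box.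
    exact: within_sound hw yd.
  by apply: inb_det; apply: one.
apply: (lipb_ivt g01 ldt).
have e1 := ends true; have e0 := ends false.
case/orP: hdet => /andP[p1 p2]; [left|right].
  by have := inb_pos e1 p1; have := inb_pos (inb_opp e0) p2; rewrite oppr_gt0 => /ltW-> /ltW->.
by have := inb_pos e0 p1; have := inb_pos (inb_opp e1) p2; rewrite oppr_gt0 => /ltW-> /ltW->.
Qed.

Hypotheses (Hc : check_circle c) (He : check_extremal c).

(** At the parameter where the determinant vanishes, the first two contact zeros determine [M] and
    [K] as real numbers, and the vanishing puts the third on the same circle. The balls then give
    every remaining strict inequality. *)
Lemma check_sound : exists beta a b d : R, 0 < beta < 1 /\
    exists P : {poly R[i]},
      [/\ forall y : R[i],
            P.[y] = line_integral
                      (fun u => (u - a%:C) ^+ (k.+4.+1 - 3)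
                                * (u ^+ 2 + b%:C * u + d%:C))
                      beta%:C y,
          disk_poly k.+4.+1 P
        & locally_extremal k.+4.+1 P].
Proof.
have [T [HT Tuniq [g hg hdet]]] := branches_sound.
have [H1 H2] := HT g hg; have gI := g_in hg.
have ccin := cc_centers.
pose v i := T g (pt (cc c i)).
have vbox i : (i < 3)%N -> inc (v i) (box i).
  by move=> hi; apply: inc_box; apply: (H1 _ (ccin i hi)).2.
have vF i : (i < 3)%N -> valF k g (v i) = 0 by move=> hi; apply: (H1 _ (ccin i hi)).1.
have vh i : (i < 3)%N -> valh k g (v i) != 0.
  move=> hi; have /andP[_ /andP[_ /andP[_ /andP[_ /andP[_ /andP[hkap _]]]]]] := Hb.
  have /(allP hkap) hp : i \in iota 0 3 by rewrite mem_iota.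
  have /inb_pos /(_ hp) := inb_sqr (inc_h gI (vbox i hi) (erefl (bpowers k (box i)))).
  by rewrite exprn_even_gt0 //= cmod_eq0.
pose x i := complex.Re (1 - v i); pose q i := cmod (1 - v i) ^+ 2.
have xI i : (i < 3)%N -> inb (x i) (ctm (box i)).1 by move=> /vbox /inc_tm[].
have qI i : (i < 3)%N -> inb (q i) (csqr (ctm (box i))).
  by move=> /vbox /inc_tm; apply: inb_sqr.
have /andP[g4 /andP[gn /andP[pM /andP[pK hM]]]] := Hc.
have g_gt : -4 < g.
  have i4 : inb (4 : R) (bint 4%SZ) by rewrite (_ : 4 = zr 4%SZ); [apply: inb_int|rewrite (zr_nat R 4)].
  by rewrite -subr_gt0 opprK; exact: inb_pos (inb_add gI i4) g4.
have g_lt : g < 0 by have := inb_pos (inb_opp gI) gn; rewrite oppr_gt0.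
pose D := x 0%N - x 1%N; pose N := q 0%N - q 1%N; pose M := N / (2 * D).
have DI := inb_sub (xI 0%N isT) (xI 1%N isT); have NI := inb_sub (qI 0%N isT) (qI 1%N isT).
rewrite -/D in DI; rewrite -/N in NI.
have [D0 MI] : D != 0 /\ inb M (cM c).
  pose lo := real_of (Z.sub (cM c).1 (cM c).2); pose hi := real_of (Z.add (cM c).1 (cM c).2).
  suff [D0 [h1 h2]] : D != 0 /\ lo <= M /\ M <= hi.
    by split => //; apply: inb_between.
  have loI := inb_mul (inb_scal2 (inb_exact R (Z.sub (cM c).1 (cM c).2))) DI.
  have hiI := inb_mul (inb_scal2 (inb_exact R (Z.add (cM c).1 (cM c).2))) DI.
  rewrite -/(real_of _) -/lo in loI; rewrite -/(real_of _) -/hi in hiI.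
  clearbody lo hi.
  case/orP: hM => /and3P[dp n1 n2].
    have d0 := inb_pos DI dp; have := inb_pos (inb_sub NI loI) n1.
    have := inb_pos (inb_sub hiI NI) n2; rewrite !subr_gt0 => h1 h2.
    have d2 : 0 < 2 * D by rewrite mulr_gt0.
    split; first by rewrite gt_eqF.
    by rewrite /M ler_pdivlMr // ler_pdivrMr // !(mulrCA _ 2) !(mulrA 2); split; [exact: ltW h2|exact: ltW h1].
  have d0 := inb_pos (inb_opp DI) dp; have := inb_pos (inb_sub loI NI) n1.
  have := inb_pos (inb_sub NI hiI) n2; rewrite oppr_gt0 in d0; rewrite !subr_gt0 => h1 h2.
  have d2 : 2 * D < 0 by rewrite pmulr_rlt0.
  split; first by rewrite lt_eqF.
  by rewrite /M ler_ndivlMr // ler_ndivrMr // !(mulrCA _ 2) !(mulrA 2); split; [exact: ltW h2|exact: ltW h1].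
have M0 := inb_pos MI pM.
pose K := q 0%N - 2 * M * x 0%N.
have KI := inb_sub (qI 0%N isT) (inb_mul (inb_scal2 MI) (xI 0%N isT)).
rewrite -/K in KI; have K0 := inb_pos KI pK.
have MD : 2 * M * D = N.
  have E (a b : R) : b != 0 -> 2 * (a / (2 * b)) * b = a by move=> b0; field.
  exact: E.
have circ i : (i < 3)%N -> q i = 2 * M * x i + K.
  case: i => [|[|[|//]]] _; first by rewrite /K addrC subrK.
    have -> : q 1%N = q 0%N - 2 * M * D by rewrite MD /N subKr.
    by rewrite /K /D; ring.
  apply: (mulIf D0).
  have := hdet; rewrite /det3 -/(v _) -/(q _) -/(x _) -/(v 1%N) -/(v 2%N) -/(q _) -/(x _) => hd.
  have -> : (2 * M * x 2%N + K) * D = 2 * M * D * (x 2%N - x 0%N) + q 0%N * D.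
    by rewrite /K; ring.
  rewrite MD; apply/eqP; rewrite -subr_eq0 -[X in _ == X]hd; apply/eqP.
  by rewrite /N /D /q /x /v; ring.
have /and3P[hins hcrit hrows] := He.
have F1 : valF k g 1 = 0 by rewrite /valF !primv1; ring.
have pt1 : pt one_pt = 1.
  by apply/eqP; rewrite eq_complex /= /real_of zr0 mul0r divff ?eqxx // gt_eqF // scale_gt0.
have r00 : 0 <= real_of r.
  have /andP[_ /andP[_ /andP[_ /andP[r0 _]]]] := Hb.
  by rewrite divr_ge0 ?(ltW (scale_gt0 R)) // -(zr0 R) ltW // zr_lt.
have all_roots y : valF k g y = 0 ->
    cmod (1 - y) ^+ 2 <= 2 * M * complex.Re (1 - y) + K /\ (y != 1 -> near_crit g y).
  move=> hy; have [z hz yz] := H2 y hy.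
  have [z1|zn] := eqVneq z one_pt.
    have -> : y = 1.
      rewrite yz z1; apply/esym; apply: (Tuniq g 1 _ hg F1); first by rewrite -z1.
      by rewrite pt1 subrr cmod0 mulr_ge0.
    by rewrite subrr cmod0 expr0n /= mulr0 add0r ltW // eqxx.
  have hz' : z \in behead (centers c) by move: hz; rewrite inE (negbTE zn).
  have yb : inc y (cbox r z) by apply: inc_box; rewrite yz; apply: (H1 z hz).2.
  have tb := inc_tm yb.
  have onc w : w \in [seq cc c i | i <- iota 0 3] -> T g (pt w) = y \/ T g (pt w) = conjc y ->
      cmod (1 - y) ^+ 2 = 2 * M * complex.Re (1 - y) + K.
    move=> /contactP[i hi ->] hT.
    have := circ i hi; rewrite /q /x /v; case: hT => -> //.
    have -> : 1 - conjc y = conjc (1 - y) by rewrite rmorphB rmorph1.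
    by rewrite cmodJ; case: (1 - y).
  split.
    case/or3P: (allP hins z hz') => [h|h|h].
    - have t1 : inb (complex.Re (1 - y)) (ctm (cbox r z)).1 by case: tb.
      have := inb_pos (inb_sub (inb_add (inb_mul (inb_scal2 MI) t1) KI) (inb_sqr tb)) h.
      by rewrite subr_gt0 => /ltW.
    - by rewrite (onc z h) // -yz; left.
    (* The conjugate of [y] is a zero near the conjugate center, hence by [Tuniq] it is the contact
       zero itself, and conjugation preserves the equation of the circle. *)
    - rewrite (onc _ h) //; right.
      have Fc : valF k g (conjc y) = 0.
        by rewrite valFJ hy conjc0.
      apply/esym; apply: Tuniq hg Fc _ _.
        by have [i hi ->] := contactP h; apply: ccin.
      have -> : conjc y - pt (z.1, Z.opp z.2) = conjc (y - pt z).
        rewrite rmorphB; congr (_ - _); rewrite /pt /= /real_of zrN mulNr.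
        by [].
      rewrite cmodJ yz; apply: le_trans (H1 z hz).2 _.
      by rewrite ler_peMl // ler1n.
  move=> _; rewrite /near_crit.
  have g2 : inb (2 + g) (badd (bint 2%SZ) gB) by apply: inb_add gI; apply: inb2.
  have i4 : inb (4 : R) (bint 4%SZ) by rewrite (_ : 4 = zr 4%SZ); [apply: inb_int|rewrite (zr_nat R 4)].
  have t1 : inb (complex.Re (1 - y)) (ctm (cbox r z)).1 by case: tb.
  have y2 : inb (complex.Im y) (cbox r z).2 by case: yb.
  case/orP: (allP hcrit z hz') => h; [left|right].
    have := inb_pos (inb_sub (inb1 R) (inb_sqr yb)) h.
    by rewrite subr_gt0 -[X in _ < X](expr1n _ 2) ltr_pXn2r ?nnegrE ?cmod_ge0.
  have w := inb_sub (inb_sqr tb) (inb_mul g2 t1).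
  have := inb_pos (inb_sub (inb_mul (inb_mul y2 y2) (inb_sub i4 (inb_mul g2 g2)))
    (inb_mul w w)) h.
  by rewrite subr_gt0 -!expr2.
have rowsI i hi := inb_rows gI MI (vbox i hi) (erefl (bpowers k (box i))).
have [Z0 B0 A0 E0 [X0 I0 U0]] := rowsI 0%N isT.
have [Z1 B1 A1 E1 [X1 I1 U1]] := rowsI 1%N isT.
have [Z2 B2 A2 E2 [X2 I2 U2]] := rowsI 2%N isT.
have L0 := inb_sub (inb_mul Z1 B2) (inb_mul Z2 B1).
have L1 := inb_sub (inb_mul Z2 B0) (inb_mul Z0 B2).
have L2 := inb_sub (inb_mul Z0 B1) (inb_mul Z1 B0).
have CA := inb_add (inb_add (inb_mul L0 A0) (inb_mul L1 A1)) (inb_mul L2 A2).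
have CE := inb_add (inb_add (inb_mul L0 E0) (inb_mul L1 E1)) (inb_mul L2 E2).
have CX := inb_add (inb_add (inb_mul L0 X0) (inb_mul L1 X1)) (inb_mul L2 X2).
have CD := inb_sub (inb_mul I0 U1) (inb_mul I1 U0).
have [[p0 p1 p2] pA pAE pX pD] := check_rowsP hrows.
apply: (certificate_extremal (k := k) (g := g) (M := M) (K := K) (v := v)) => //.
- by move=> i hi; split; [exact: vF|exact: vh|exact: circ].
- exact: inb_pos L0 p0.
- exact: inb_pos L1 p1.
- exact: inb_pos L2 p2.
- exact: inb_pos CA pA.
- exact: inb_pos (inb_add CA CE) pAE.
- exact: inb_pos CX pX.
- by case: pD => [/(inb_pos CD)|/(inb_pos (inb_opp CD))]; rewrite ?oppr_gt0;
    [move/gt_eqF->|move/lt_eqF->].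
Qed.

End Soundness.

(* All data are integer multiples of [2 ^ -60]: the parameter [g] is known up to [2 ^ -38], the
   roots up to [2 ^ -28], the contact roots at the two ends of the range of [g] up to [2 ^ -54]. *)
Definition make_cert (k : nat) (g M : Z) (contacts rest ends0 ends1 : seq (Z * Z)) : cert :=
  let up (a : Z) := Z.mul a (Z.pow 2 20) in
  let up2 (z : Z * Z) := (up z.1, up z.2) in
  Cert k (up g) (Z.pow 2 42) (Z.pow 2 52) (Z.pow 2 26) (up M, Z.pow 2 62)
    (fun i => up2 (nth (Z0, Z0) contacts i)) [seq up2 z | z <- rest]
    (fun b i => up2 (nth (Z0, Z0) (if b then ends1 else ends0) i)).



(** * The numerical certificates, one for each degree *)

Section Certificates.
Local Open Scope Z_scope.

(** For even degrees the third contact center is real. The zero is then its own conjugate and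
    carries no odd row, so the antisymmetric condition has to rest on the first two contact
    points. *)
Definition cert8 : cert := make_cert 3%N (-1172130807421698048) 901302326260662272
  [:: (318765197554614272, 1234384042070114304); (885874541539098624, 1061099752952692736);
      ((-984589764608917504), 0)]
  [:: ((-619016576275841024), (-820884106219880448)); ((-619016576275841024), 820884106219880448);
      (318765197554614272, (-1234384042070114304)); (885874541539098624, (-1061099752952692736))]
  [:: (318765197553751342, 1234384042071797898); (885874541537172842, 1061099752962063764);
      ((-984589764608919468), 0)]
  [:: (318765197551159720, 1234384042073181980); (885874541536033197, 1061099752959171686);
      ((-984589764609542318), 0)].

Definition cert9 : cert := make_cert 4%N (-1528824202722738176) 885583907745955840
  [:: (639268804664229888, 1182202766102102016); (910453507365011456, 1059404610613018624);
      ((-908730704630644736), 390895836470444032)]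
  [:: ((-908730704630644736), (-390895836470444032)); ((-357488745655566336),
      (-984985469508911104)); ((-357488745655566336), 984985469508911104); (639268804664229888,
      (-1182202766102102016)); (910453507365011456, (-1059404610613018624))]
  [:: (639268804663192315, 1182202766104685140); (910453507359430076, 1059404610609462681);
      ((-908730704635429901), 390895836473159346)]
  [:: (639268804660143526, 1182202766108811915); (910453507358725651, 1059404610604316273);
      ((-908730704635876949), 390895836473257962)].

Definition cert12 : cert := make_cert 7%N (-772107583954911232) 1013522288332505088
  [:: (120198100819116032, 1205901598673338368); (635005124627922944, 1099519045989826560);
      ((-1066655238422790144), 0)]
  [:: ((-908015361083834368), (-581419646834442240)); ((-908015361083834368), 581419646834442240);
      ((-472639500078546944), (-1013857125744508928)); ((-472639500078546944),
      1013857125744508928); (120198100819116032, (-1205901598673338368)); (635005124627922944,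
      (-1099519045989826560)); (1003468093877387264, (-624806762163208192)); (1003468093877387264,
      624806762163208192)]
  [:: (120198100820167261, 1205901598678708966); (635005124633679919, 1099519045992103114);
      ((-1066655238418166753), 0)]
  [:: (120198100818492525, 1205901598678846116); (635005124632567420, 1099519045990605944);
      ((-1066655238418761225), 0)].

Definition cert13 : cert := make_cert 8%N (-957511679252938752) 1002024030594662400
  [:: (286509187704291328, 1203239553029111808); (713822951236960256, 1072049843242795008);
      ((-1027940058293862400), 276618925406420992)]
  [:: ((-1027940058293862400), (-276618925406420992)); ((-763476223262195712),
      (-767650872200003584)); ((-763476223262195712), 767650872200003584); ((-290308445393911808),
      (-1089733668806590464)); ((-290308445393911808), 1089733668806590464); (286509187704291328,
      (-1203239553029111808)); (713822951236960256, (-1072049843242795008)); (1023583995289403392,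
      (-586561375271124992)); (1023583995289403392, 586561375271124992)]
  [:: (286509187712208007, 1203239553026360220); (713822951243365581, 1072049843244379462);
      ((-1027940058292897438), 276618925405306782)]
  [:: (286509187710389868, 1203239553026798739); (713822951242335852, 1072049843242644163);
      ((-1027940058293375331), 276618925405355784)].

Definition cert14 : cert := make_cert 9%N (-1156890199591534592) 993959624979775488
  [:: (440717828048289792, 1185344152628363264); (772548323549642752, 1052586742432923648);
      ((-1059408825536217088), 0)]
  [:: ((-941855685350522880), (-499230626860236800)); ((-941855685350522880), 499230626860236800);
      ((-610634252114984960), (-900301856813613056)); ((-610634252114984960), 900301856813613056);
      ((-123568229921587200), (-1128483815002472448)); ((-123568229921587200),
      1128483815002472448); (440717828048289792, (-1185344152628363264)); (772548323549642752,
      (-1052586742432923648)); (1038976552957640704, (-552559393636352000)); (1038976552957640704,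
      552559393636352000)]
  [:: (440717828044341321, 1185344152620272921); (772548323546596808, 1052586742427165831);
      ((-1059408825535106086), 0)]
  [:: (440717828042271209, 1185344152621245573); (772548323545687358, 1052586742424965072);
      ((-1059408825535485472), 0)].

Definition cert15 : cert := make_cert 10%N (-1372517907294453760) 981170455765319680
  [:: (597025651039404032, 1150408873694199808); (807148993007058944, 1049079842814820352);
      ((-1031397017038880768), 238188569926041600)]
  [:: ((-1031397017038880768), (-238188569926041600)); ((-830442264013570048),
      (-673044420685201408)); ((-830442264013570048), 673044420685201408); ((-460194922784358400),
      (-990962092393627648)); ((-460194922784358400), 990962092393627648); (25778700683313152,
      (-1139719918204223488)); (25778700683313152, 1139719918204223488); (597025651039404032,
      (-1150408873694199808)); (807148993007058944, (-1049079842814820352)); (1050897557129003008,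
      (-522182310712311808)); (1050897557129003008, 522182310712311808)]
  [:: (597025651039870008, 1150408873693811798); (807148993009180135, 1049079842810039153);
      ((-1031397017033042750), 238188569928646865)]
  [:: (597025651037309494, 1150408873696189965); (807148993008561451, 1049079842806547988);
      ((-1031397017033353586), 238188569928683803)].

Definition cert19 : cert := make_cert 14%N (-1002051732918452224) 1042119407876177920
  [:: (390247321893339136, 1166994399985401856); (677731662494171136, 1057618282325999616);
      ((-1074095249745248256), 189694071386669056)]
  [:: ((-1074095249745248256), (-189694071386669056)); ((-948686177597128704),
      (-548680857695551488)); ((-948686177597128704), 548680857695551488); ((-710842813033480192),
      (-848868933179015168)); ((-710842813033480192), 848868933179015168); ((-384834855478755328),
      (-1059106439118716928)); ((-384834855478755328), 1059106439118716928); ((-3010520835686400),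
      (-1161409798378356736)); ((-3010520835686400), 1161409798378356736); (390247321893339136,
      (-1166994399985401856)); (677731662494171136, (-1057618282325999616)); (914994578971426816,
      (-759573607184596992)); (914994578971426816, 759573607184596992); (1090895937842184192,
      (-396012731741765632)); (1090895937842184192, 396012731741765632)]
  [:: (390247321894326850, 1166994399978882902); (677731662495648830, 1057618282330567450);
      ((-1074095249739970026), 189694071384278379)]
  [:: (390247321892772003, 1166994399979222004); (677731662494758035, 1057618282329126677);
      ((-1074095249740287294), 189694071384301764)].

Definition cert20 : cert := make_cert 15%N (-1150024122299154432) 1034330609238933504
  [:: (487287242671259648, 1149166855236091904); (721992417137393664, 1045192834463825920);
      ((-1088273412524081152), 0)]
  [:: ((-1030865165735690240), (-355361147303493632)); ((-1030865165735690240),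
      355361147303493632); ((-864005694339153920), (-676018715954774016)); ((-864005694339153920),
      676018715954774016); ((-603147627244027904), (-930906040109629440)); ((-603147627244027904),
      930906040109629440); ((-271823060116439040), (-1096228724644249600));
      ((-271823060116439040), 1096228724644249600); (102263192037621760, (-1160427504746364928));
      (102263192037621760, 1160427504746364928); (487287242671259648, (-1149166855236091904));
      (721992417137393664, (-1045192834463825920)); (934801999508013056, (-731357821949444096));
      (934801999508013056, 731357821949444096); (1096448503892148224, (-378545243261239296));
      (1096448503892148224, 378545243261239296)]
  [:: (487287242673300815, 1149166855234630893); (721992417144659728, 1045192834460286791);
      ((-1088273412531231240), 0)]
  [:: (487287242671464260, 1149166855235386565); (721992417143838768, 1045192834458390037);
      ((-1088273412531502566), 0)].

Definition cert26 : cert := make_cert 21%N (-1146794985299509248) 1057337492765671424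
  [:: (511201083100495872, 1124774238729797632); (693055423695028224, 1039655014882082816);
      ((-1103521754317324288), 0)]
  [:: ((-1069612038495404032), (-275251326751866880)); ((-1069612038495404032),
      275251326751866880); ((-969790934529081344), (-534525043242172416)); ((-969790934529081344),
      534525043242172416); ((-809656033281572864), (-762811354389151744)); ((-809656033281572864),
      762811354389151744); ((-598112660772356096), (-947006569449521152)); ((-598112660772356096),
      947006569449521152); ((-346719006947803136), (-1076830035509248000));
      ((-346719006947803136), 1076830035509248000); ((-68670003779469312),
      (-1145898904798101504)); ((-68670003779469312), 1145898904798101504); (222905538806022144,
      (-1154213026505687040)); (222905538806022144, 1154213026505687040); (511201083100495872,
      (-1124774238729797632)); (693055423695028224, (-1039655014882082816)); (866492943152709632,
      (-814884619814961152)); (866492943152709632, 814884619814961152); (1021142360051941376,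
      (-563144427074224128)); (1021142360051941376, 563144427074224128); (1119396846209335296,
      (-288291418072416256)); (1119396846209335296, 288291418072416256)]
  [:: (511201083096179829, 1124774238722041529); (693055423694749524, 1039655014888050377);
      ((-1103521754323640785), 0)]
  [:: (511201083094483326, 1124774238722662981); (693055423693978624, 1039655014886335111);
      ((-1103521754323851647), 0)].

End Certificates.

Fact cert8_ok : check cert8. Proof. by vm_compute. Qed.
Fact cert9_ok : check cert9. Proof. by vm_compute. Qed.
Fact cert12_ok : check cert12. Proof. by vm_compute. Qed.
Fact cert13_ok : check cert13. Proof. by vm_compute. Qed.
Fact cert14_ok : check cert14. Proof. by vm_compute. Qed.
Fact cert15_ok : check cert15. Proof. by vm_compute. Qed.
Fact cert19_ok : check cert19. Proof. by vm_compute. Qed.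
Fact cert20_ok : check cert20. Proof. by vm_compute. Qed.
Fact cert26_ok : check cert26. Proof. by vm_compute. Qed.

Theorem theorem1 (R : realType) (n : nat)
    (hn : n \in [:: 8; 9; 12; 13; 14; 15; 19; 20; 26]%N) :
  exists beta a b c : R, 0 < beta < 1 /\
    exists P : {poly R[i]},
      [/\ forall z : R[i],
            P.[z] = line_integral
                      (fun w => (w - a%:C) ^+ (n - 3)
                                * (w ^+ 2 + b%:C * w + c%:C))
                      beta%:C z,
          disk_poly n P
        & locally_extremal n P].
Proof.
move: hn; rewrite !inE; do 8?[case/orP]; move/eqP->.
- by have /and3P[hb hc he] := cert8_ok; exact: (check_sound R hb hc he).
- by have /and3P[hb hc he] := cert9_ok; exact: (check_sound R hb hc he).
- by have /and3P[hb hc he] := cert12_ok; exact: (check_sound R hb hc he).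
- by have /and3P[hb hc he] := cert13_ok; exact: (check_sound R hb hc he).
- by have /and3P[hb hc he] := cert14_ok; exact: (check_sound R hb hc he).
- by have /and3P[hb hc he] := cert15_ok; exact: (check_sound R hb hc he).
- by have /and3P[hb hc he] := cert19_ok; exact: (check_sound R hb hc he).
- by have /and3P[hb hc he] := cert20_ok; exact: (check_sound R hb hc he).
- by have /and3P[hb hc he] := cert26_ok; exact: (check_sound R hb hc he).
Qed.
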